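(* Let $f\in\mathscr S_*(\mathscr Q)$. Then the inverse $\mathscr R^{-1}$ of the bijection $\mathscr R:\mathscr S_*(\mathscr Q)\to\mathscr S_*(\mathscr Q)$ is given by $$\mathscr R^{-1}(f)=\mathscr F^{-1}\Psi^{-1}\mathscr F_2(f).$$
   Context: $\mathbb Q$ denotes the quaternions, identified with $\mathbb R^4$, and $\Im\mathbb Q\cong\mathbb R^3$ the imaginary quaternions; $\langle q,h\rangle=\Re(\overline qh)$ is the Euclidean inner product and $|q|^2=\langle q,q\rangle$. The quaternion Heisenberg group is $\mathscr Q=\{(x,t):x\in\mathbb Q,\ t\in\Im\mathbb Q\}$ with product $(x,t)(x',t')=(x+x',\,t+t'-2\Im(\overline{x'}x))$. $\mathscr S(\mathscr Q)$ is the Schwartz space on $\mathbb R^4\times\mathbb R^3$. The Radon transform is $\mathscr R(f)(x,t)=\int_{\mathbb Q}f((x,t)(y,0))\,dy=\int_{\mathbb Q}f(y,t-2\Im(\overline yx))\,dy$. Euclidean Fourier transforms: $$\mathscr F_2(f)(x,a)=\int_{\Im\mathbb Q}f(x,t)e^{i\langle t,a\rangle}dt,\qquad \mathscr F(f)(y,a)=\int_{\mathscr Q}f(x,t)e^{i\langle x,y\rangle}e^{i\langle t,a\rangle}dx\,dt.$$ With $t^s=t_1^{s_1}t_2^{s_2}t_3^{s_3}$ for $s\in\mathbb N^3$, $$\mathscr S_*(\mathscr Q)=\Big\{f\in\mathscr S(\mathscr Q):\int_{\Im\mathbb Q}f(x,t)t^s\,dt=0\text{ for all }x\in\mathbb Q,\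 s\in\mathbb N^3\Big\},$$ $$\mathscr S^*(\mathscr Q)=\{f\in\mathscr S(\mathscr Q):\partial_t^sf(x,0)=0\text{ for all }x\in\mathbb Q,\ s\in\mathbb N^3\}.$$ Both $\mathscr F$ and $\mathscr F_2$ map $\mathscr S_*(\mathscr Q)$ bijectively onto $\mathscr S^*(\mathscr Q)$. The map $\Psi(f)(x,t)=f(-2xt,t)$ (quaternion product $xt$) is a bijection of $\mathscr S^*(\mathscr Q)$ onto itself, with inverse $\Psi^{-1}(f)(x,t)=f\big(\frac{xt}{2|t|^2},t\big)$ for $t\ne0$ and $\Psi^{-1}(f)(x,0)=0$. *)

(* Defs.v *)
From HB Require Import structures.
From mathcomp Require Import all_boot all_order all_algebra.
From mathcomp Require Import complex.
From mathcomp Require Import all_classical all_reals all_analysis.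

Set Implicit Arguments.
Unset Strict Implicit.
Unset Printing Implicit Defensive.

Import Order.TTheory GRing.Theory Num.Theory.
Import numFieldNormedType.Exports.

Local Open Scope classical_set_scope.
Local Open Scope ring_scope.
Local Open Scope complex_scope.

(* (a, b, c, d) stands for a + b i + c j + d k, and (b, c, d) for the imaginary
   quaternion b i + c j + d k. Both types are nested products of R, and thereby
   carry the product topology and sigma-algebra; the library norm on them is
   the sup norm, so the Euclidean one is written out through qdot and idot. *)
Definition quat (R : realType) := (R * R * R * R)%type.
Definition imquat (R : realType) := (R * R * R)%type.

Definition qconj (R : realType) (q : quat R) : quat R :=
  let: (a, b, c, d) := q in (a, - b, - c, - d).

Definition qmul (R : realType) (p q : quat R) : quat R :=
  let: (a, b, c, d) := p in
  let: (a', b', c', d') := q in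
  (a * a' - b * b' - c * c' - d * d',
   a * b' + b * a' + c * d' - d * c',
   a * c' - b * d' + c * a' + d * b',
   a * d' + b * c' - c * b' + d * a').

Definition qRe (R : realType) (q : quat R) : R := let: (a, _, _, _) := q in a.

Definition qIm (R : realType) (q : quat R) : imquat R :=
  let: (_, b, c, d) := q in (b, c, d).

Definition quat_of_im (R : realType) (t : imquat R) : quat R :=
  let: (b, c, d) := t in (0, b, c, d).

Definition qdot (R : realType) (p q : quat R) : R := qRe (qmul (qconj p) q).

Definition idot (R : realType) (s t : imquat R) : R :=
  qdot (quat_of_im s) (quat_of_im t).

Definition heis (R : realType) := (quat R * imquat R)%type.

Definition heis_mul (R : realType) (g h : heis R) : heis R :=
  (g.1 + h.1, g.2 + h.2 - 2 *: qIm (qmul (qconj h.1) g.1)).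

Lemma prod_sigma_finite (d1 d2 : measure_display) (T1 : measurableType d1)
    (T2 : measurableType d2) (R : realType)
    (m1 : {sigma_finite_measure set T1 -> \bar R})
    (m2 : {sigma_finite_measure set T2 -> \bar R}) :
  sigma_finite setT (m1 \x m2)%E.
Proof.
have /sigma_finiteP[F [TF ndF Foo]] := sigma_finiteT m1.
have /sigma_finiteP[G [TG ndG Goo]] := sigma_finiteT m2.
exists (fun n => F n `*` G n).
  rewrite -setXTT TF TG predeqE => -[x y]; split.
    move=> [/= [n _ Fnx] [k _ Gky]]; exists (maxn n k) => //; split.
    - by move: x Fnx; exact/subsetPset/ndF/leq_maxl.
    - by move: y Gky; exact/subsetPset/ndG/leq_maxr.
  by move=> [n _ []/= ? ?]; split; exists n.
move=> k; have [? ?] := Foo k; have [? ?] := Goo k.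
split; first exact: measurableX.
by rewrite product_measure1E// lte_mul_pinfty// ge0_fin_numE.
Qed.

(* Lebesgue measure on R^2, R^3, R^4 and R^7. The sigma-finite instances are
   registered on these names because on a product \x the canonical structure
   of sigma-finite measure only covers products of subprobabilities. *)
Definition leb2 (R : realType) :
    set (measurableTypeR R * measurableTypeR R) -> \bar R :=
  (@lebesgue_measure R \x @lebesgue_measure R)%E.
Arguments leb2 : clear implicits.
HB.instance Definition _ (R : realType) := Measure.on (leb2 R).
HB.instance Definition _ (R : realType) :=
  Measure_isSigmaFinite.Build _ _ _ (leb2 R) (prod_sigma_finite _ _).

Definition imquat_leb (R : realType) :
    set (measurableTypeR R * measurableTypeR R * measurableTypeR R) ->
    \bar R :=
  (leb2 R \x @lebesgue_measure R)%E.
Arguments imquat_leb : clear implicits.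
HB.instance Definition _ (R : realType) := Measure.on (imquat_leb R).
HB.instance Definition _ (R : realType) :=
  Measure_isSigmaFinite.Build _ _ _ (imquat_leb R) (prod_sigma_finite _ _).

Definition quat_leb (R : realType) :
    set (measurableTypeR R * measurableTypeR R * measurableTypeR R *
         measurableTypeR R) -> \bar R :=
  (imquat_leb R \x @lebesgue_measure R)%E.
Arguments quat_leb : clear implicits.
HB.instance Definition _ (R : realType) := Measure.on (quat_leb R).
HB.instance Definition _ (R : realType) :=
  Measure_isSigmaFinite.Build _ _ _ (quat_leb R) (prod_sigma_finite _ _).

Definition heis_leb (R : realType) :
    set (measurableTypeR R * measurableTypeR R * measurableTypeR R *
         measurableTypeR R *
         (measurableTypeR R * measurableTypeR R * measurableTypeR R)) ->
    \bar R :=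
  (quat_leb R \x imquat_leb R)%E.
Arguments heis_leb : clear implicits.
HB.instance Definition _ (R : realType) := Measure.on (heis_leb R).
HB.instance Definition _ (R : realType) :=
  Measure_isSigmaFinite.Build _ _ _ (heis_leb R) (prod_sigma_finite _ _).

Definition cintegral (R : realType) (d : measure_display)
    (T : measurableType d) (mu : {measure set T -> \bar R}) (f : T -> R[i]) :
    R[i] :=
  (\int[mu]_x complex.Re (f x)) +i* (\int[mu]_x complex.Im (f x)).

Definition expi (R : realType) (r : R) : R[i] := cos r +i* sin r.

Definition hcoord (R : realType) (z : heis R) (i : 'I_7) : R :=
  let: ((x0, x1, x2, x3), (t1, t2, t3)) := z in
  [:: x0; x1; x2; x3; t1; t2; t3]`_i.

Definition hbasis (R : realType) (i : 'I_7) : heis R :=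
  let e (k : nat) : R := (i == k :> nat)%:R in
  ((e 0%N, e 1%N, e 2%N, e 3%N), (e 4%N, e 5%N, e 6%N)).

Definition hmonom (R : realType) (al : 'I_7 -> nat) (z : heis R) : R :=
  \prod_(i < 7) hcoord z i ^+ al i.

Definition pderiv (R : realType) (l : seq 'I_7) (f : heis R -> R) :
    heis R -> R :=
  foldr (fun i (g : heis R -> R) z => 'D_(hbasis R i) g z) f l.

(* C^infinity: the iterated partial derivatives of all orders exist and are
   continuous ('D is a total function, hence the explicit derivability). *)
Definition smooth (R : realType) (f : heis R -> R) : Prop :=
  forall l : seq 'I_7, continuous (pderiv l f) /\
    forall (i : 'I_7) (z : heis R), derivable (pderiv l f) z (hbasis R i).

Definition cpderiv (R : realType) (l : seq 'I_7) (f : heis R -> R[i]) :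
    heis R -> R[i] :=
  fun z => pderiv l (@complex.Re R \o f) z +i* pderiv l (@complex.Im R \o f) z.

Definition schwartz (R : realType) : set (heis R -> R[i]) :=
  [set f : heis R -> R[i] | [/\ smooth (@complex.Re R \o f), smooth (@complex.Im R \o f) &
    forall (al : 'I_7 -> nat) (l : seq 'I_7), exists M : R,
      forall z, `|(hmonom al z)%:C * cpderiv l f z| <= M%:C]].

Definition imonom (R : realType) (s : 'I_3 -> nat) (t : imquat R) : R :=
  let: (t1, t2, t3) := t in \prod_(j < 3) [:: t1; t2; t3]`_j ^+ s j.

(* The space written S with a lower star. *)
Definition schwartz_lstar (R : realType) : set (heis R -> R[i]) :=
  [set f : heis R -> R[i] | schwartz f /\ forall (x : quat R) (s : 'I_3 -> nat),
    cintegral (imquat_leb R) (fun t => f (x, t) * (imonom s t)%:C) = 0].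

Definition radon (R : realType) (f : heis R -> R[i]) : heis R -> R[i] :=
  fun g => cintegral (quat_leb R) (fun y => f (heis_mul g (y, 0))).

Definition fourier2 (R : realType) (f : heis R -> R[i]) : heis R -> R[i] :=
  fun z => cintegral (imquat_leb R) (fun t => f (z.1, t) * expi (idot t z.2)).

Definition fourier (R : realType) (f : heis R -> R[i]) : heis R -> R[i] :=
  fun w => cintegral (heis_leb R)
    (fun z => f z * expi (qdot z.1 w.1) * expi (idot z.2 w.2)).

Definition Psi_inv (R : realType) (f : heis R -> R[i]) : heis R -> R[i] :=
  fun z => if z.2 == 0 then 0
    else f ((2 * idot z.2 z.2)^-1 *: qmul z.1 (quat_of_im z.2), z.2).

(* On the image under T of the lower star space, this is the inverse of T
   restricted to that space; elsewhere it has the arbitrary value 0. *)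
Definition inv_lstar (R : realType)
    (T : (heis R -> R[i]) -> (heis R -> R[i])) :
    (heis R -> R[i]) -> (heis R -> R[i]) :=
  'pinv_(fun=> fun=> 0) (@schwartz_lstar R) T.

(* Main.v *)
(* The transform in t of the Radon transform of f is a slice of the full Fourier
   transform: F_2 (R f) (x, a) = F f (- 2 x a, a), that is F_2 R = Psi F. Vanishing
   t-moments make F f flat at a = 0. Since |x|^2 = |2 x a|^2 / (4 |a|^2), the
   t-inversion formula then bounds |x|^(2 N) |R f|, which is how R f turns out to be
   a Schwartz function. Inverting the Fourier transform in the variable y of
   R h (y, .), through Gaussian regularization, gives R (Delta_t^2 (R h)) = pi^4 h,
   so that R is bijective on the lower star space. Finally F_2 R f determines
   R f, hence f, so F is injective there, and F_2 R = Psi F reads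
   R^-1 = F^-1 Psi^-1 F_2. Splitting into real and imaginary parts, it suffices to
   treat real functions and cosine transforms with a free phase. *)

Require Import Defs.
From mathcomp Require Import all_boot all_order all_algebra.
From mathcomp Require Import complex.
From mathcomp Require Import all_classical all_reals all_analysis.
From mathcomp Require Import measurable_realfun simple_functions.
From mathcomp Require Import ring lra.

Set Implicit Arguments.
Unset Strict Implicit.
Unset Printing Implicit Defensive.

Import Order.TTheory GRing.Theory Num.Theory.
Import numFieldNormedType.Exports.

Local Open Scope classical_set_scope.
Local Open Scope ring_scope.

(** The constant pi^4 comes from a dilation. F (R h) (- 2 x a, a) is an integral over y of F h (- 2
    y a, a) with a phase. As |y a| = |y| |a|, the map y |-> - 2 y a is a similarity of R^4 of ratio
    2 |a|, so inversion in y produces (2 pi / (2 |a|))^4 = pi^4 / |a|^4 times F_2 h (x, a), and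
    |a|^4 is the symbol of Delta_t^2. A similarity turns Gaussians into Gaussians, so translations,
    dilations and shears are the only changes of variables.

    The obstacle to R f being a Schwartz function is multiplication by the coordinates of x.
    Derivatives of R f are again Radon transforms, but x_j R f is not visibly one. Hence the class
    [xspan], closed under multiplication by every coordinate, while decay in x is imported from the
    Fourier side.

    A free phase in the cosine absorbs translations and iterated integrals. The price is that a
    first derivative turns the phase by pi / 2, so the symbols used as multipliers are polynomials
    in the squares of the coordinates. *)

Definition rintegrable (R : realType) d (T : measurableType d)
  (mu : {measure set T -> \bar R}) (f : T -> R) :=
  mu.-integrable setT (EFin \o f).

(** * Integrals of real functions *)

Section rintegrable_theory.
Context (R : realType) d (T : measurableType d) (mu : {measure set T -> \bar R}).
Implicit Types f g : T -> R.

Lemma rintegrable_measurable f : rintegrable mu f -> measurable_fun setT f.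
Proof. by move=> /integrableP[/measurable_EFinP]. Qed.

Lemma rintegrable_le f g : measurable_fun setT f ->
  (forall x, `|f x| <= g x) -> rintegrable mu g -> rintegrable mu f.
Proof.
move=> mf fg ig; apply: le_integrable ig => //; first exact/measurable_EFinP.
by move=> x _ /=; rewrite lee_fin (le_trans (fg x))// ler_norm.
Qed.

Lemma rintegrableD f g : rintegrable mu f -> rintegrable mu g ->
  rintegrable mu (fun x => f x + g x).
Proof. by move=> fi gi; apply: (integrableD _ fi gi). Qed.

Lemma rintegrableZ c f : rintegrable mu f -> rintegrable mu (fun x => c * f x).
Proof. by move=> fi; apply: (integrableZl _ c fi). Qed.

Lemma dominated_cvg_Rintegral (F : nat -> T -> R) f g :
  (forall n, measurable_fun setT (F n)) ->
  (forall x, F ^~ x @ \oo --> f x) ->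
  (forall n x, `|F n x| <= g x) -> rintegrable mu g ->
  (fun n => \int[mu]_x F n x) @ \oo --> \int[mu]_x f x.
Proof.
move=> mF Ff Fg ig.
have mf : measurable_fun setT f.
  by apply: (measurable_fun_cvg mF) => x _; exact: Ff.
have [] := @dominated_convergence _ _ _ mu _ measurableT
  (fun n x => (F n x)%:E) (EFin \o f) (EFin \o g).
- by move=> n; exact/measurable_EFinP.
- exact/measurable_EFinP.
- by apply: aeW => x _; apply: cvg_EFin; [exact: nearW|exact: Ff].
- exact: ig.
- by apply: aeW => x n _; rewrite lee_fin.
move=> fi _ H; apply: fine_cvg; rewrite fineK; last exact: integrable_fin_num.
exact: H.
Qed.

End rintegrable_theory.

(** Dominated convergence speaks of sequences, continuity of filters. If continuity failed at [z],
    each ball of radius 1 / (n + 1) would contain a point whose value is at least [e] away, and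
    these points form a sequence tending to [z]. *)
Lemma continuous_seq (R : realType) (V : pseudoMetricType R) (F : V -> R) :
  (forall z (u : nat -> V), u @ \oo --> z -> F \o u @ \oo --> F z) -> continuous F.
Proof.
move=> H z; apply/cvgrPdist_lt => e e0; apply: contrapT => nF.
have K (n : nat) : exists w, ball z (n.+1%:R^-1) w /\ ~ `|F z - F w| < e.
  apply: contrapT => nw; apply: nF.
  apply/nbhs_ballP; exists (n.+1%:R^-1) => /=; first by rewrite invr_gt0.
  move=> w bw; apply: contrapT => h; apply: nw; by exists w.
move/choice : K => [u uP].
have uz : u @ \oo --> z.
  apply/cvg_ballP => r r0; near=> n; apply: le_ball (proj1 (uP n)).
  near: n; move: (near_infty_natSinv_lt (PosNum r0)); apply: filterS => n /= /ltW//.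
have /cvgrPdist_lt/(_ e e0)[N _ HN] := H z u uz.
exact: (uP N).2 (HN N (leqnn N)).
Unshelve. all: by end_near.
Qed.

Section parameter_integrals.
Context (R : realType) d (T : measurableType d) (mu : {measure set T -> \bar R}).

Lemma continuous_Rintegral (V : pseudoMetricType R) (F : V -> T -> R) (g : T -> R) :
  (forall z, measurable_fun setT (F z)) -> (forall t, continuous (F ^~ t)) ->
  (forall z t, `|F z t| <= g t) -> rintegrable mu g ->
  continuous (fun z => \int[mu]_t F z t).
Proof.
move=> mF cF Fg ig; apply: continuous_seq => z u uz.
apply: (dominated_cvg_Rintegral (g := g)) => //.
by move=> t; apply: (cvg_comp u (F ^~ t) uz); exact: cF.
Qed.

End parameter_integrals.

Section fubini.
Context (R : realType) d1 d2 (T1 : measurableType d1) (T2 : measurableType d2).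
Context (m1 : {sigma_finite_measure set T1 -> \bar R}).
Context (m2 : {sigma_finite_measure set T2 -> \bar R}).

Lemma rintegrable_prod (g1 : T1 -> R) (g2 : T2 -> R) :
  rintegrable m1 g1 -> rintegrable m2 g2 ->
  rintegrable (m1 \x m2)%E (fun z => g1 z.1 * g2 z.2).
Proof.
move=> i1 i2.
have mg : measurable_fun setT (fun z : T1 * T2 => g1 z.1 * g2 z.2).
  apply: measurable_funM.
    by apply: (measurableT_comp (rintegrable_measurable i1)).
  by apply: (measurableT_comp (rintegrable_measurable i2)).
apply/integrable12ltyP; first exact/measurable_EFinP.
under eq_integral => x _.
  under eq_integral => y _ do rewrite /= normrM EFinM.
  rewrite ge0_integralZl//=; last first.
    by apply/measurable_EFinP; apply: measurableT_comp => //; exact: rintegrable_measurable i2.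
  over.
have /integrableP[_ h1] := i1; have /integrableP[_ h2] := i2.
rewrite ge0_integralZr//=; last 2 first.
  by apply/measurable_EFinP; apply: measurableT_comp => //; exact: rintegrable_measurable i1.
  by apply: integral_ge0 => y _; rewrite lee_fin.
rewrite lte_mul_pinfty//; first exact: integral_ge0.
by rewrite ge0_fin_numE//; exact: integral_ge0.
Qed.

(** A real integral is [fine] of an extended one, and [fine] sends infinities to 0. Asking for every
    slice, not just almost every one, to be integrable makes the inner real and extended integrals
    agree at every point. *)
Lemma Rfubini (f : T1 * T2 -> R) :
  rintegrable (m1 \x m2)%E f -> (forall x, rintegrable m2 (fun y => f (x, y))) ->
  rintegrable m1 (fun x => \int[m2]_y f (x, y)) /\
  \int[(m1 \x m2)%E]_z f z = \int[m1]_x \int[m2]_y f (x, y).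
Proof.
move=> fi f2i.
have E : (EFin \o (fun x => \int[m2]_y f (x, y))) = fubini_F m2 (EFin \o f).
  apply/funext => x; rewrite /= /fubini_F /Rintegral fineK//.
  exact: integrable_fin_num (f2i x).
split; first by rewrite /rintegrable E; exact: integrable_fubini_F.
rewrite {1}/Rintegral -integral12_prod_meas1//= [RHS]/Rintegral.
by congr fine; rewrite -E.
Qed.

Lemma Rfubini_sym (f : T1 * T2 -> R) :
  rintegrable (m1 \x m2)%E f -> (forall y, rintegrable m1 (fun x => f (x, y))) ->
  rintegrable m2 (fun y => \int[m1]_x f (x, y)) /\
  \int[(m1 \x m2)%E]_z f z = \int[m2]_y \int[m1]_x f (x, y).
Proof.
move=> fi f2i.
have E : (EFin \o (fun y => \int[m1]_x f (x, y))) = fubini_G m1 (EFin \o f).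
  apply/funext => x; rewrite /= /fubini_G /Rintegral fineK//.
  exact: integrable_fin_num (f2i x).
have mf : measurable_fun setT (EFin \o f) by exact: measurable_int fi.
have mabs : measurable_fun setT (fun y => \int[m1]_x `|(EFin \o f) (x, y)|)%E.
  apply: (measurable_fun_fubini_tonelli_G (abse \o (EFin \o f))) => //=.
  exact: measurableT_comp.
split.
  rewrite /rintegrable E; have mG := measurable_fubini_G fi.
  apply/integrableP; split => //.
  apply: le_lt_trans ((integrable21ltyP m1 m2 mf).1 fi).
  apply: ge0_le_integral => //; first exact: measurableT_comp.
  by move=> y _; apply: le_abse_integral => //; exact: measurableT_comp.
rewrite {1}/Rintegral -integral21_prod_meas1//= [RHS]/Rintegral.
by congr fine; rewrite -E.
Qed.

End fubini.

(** Change of variables as a rule for nonnegative integrals, [c] being the inverse Jacobian. In this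
    form Tonelli carries it to products without determinants. *)
Definition scales_measure (R : realType) d (T : measurableType d)
    (mu : {measure set T -> \bar R}) (phi : T -> T) (c : R) :=
  measurable_fun setT phi /\
  forall f : T -> \bar R, measurable_fun setT f -> (forall x, 0 <= f x)%E ->
    (\int[mu]_x f (phi x) = c%:E * \int[mu]_x f x)%E.

Section scales.
Context (R : realType) d (T : measurableType d) (mu : {measure set T -> \bar R}).

Lemma scales_Rintegral phi c (f : T -> R) : scales_measure mu phi c -> 
  rintegrable mu f ->
  rintegrable mu (f \o phi) /\ \int[mu]_x f (phi x) = c * \int[mu]_x f x.
Proof.
move=> [mphi H] fi; have mf := rintegrable_measurable fi.
have mE : measurable_fun setT (EFin \o f) by exact/measurable_EFinP.
have fpi : rintegrable mu (f \o phi).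
  apply/integrableP; split; first by apply: (measurableT_comp mE).
  rewrite (H (fun x => `|(EFin \o f) x|)%E)//; last exact: measurableT_comp.
  have /integrableP[_ lty] := fi.
  have [fin|] := boolP ((\int[mu]_x `|(EFin \o f) x|)%E \is a fin_num).
    by rewrite -(fineK fin) -EFinM ltry.
  by rewrite ge0_fin_numE ?lty//; exact: integral_ge0.
split => //.
rewrite /Rintegral integralE [in RHS]integralE.
under eq_integral do rewrite (funepos_comp (EFin \o f))/=.
under [X in (_ - X)%E]eq_integral do rewrite (funeneg_comp (EFin \o f))/=.
have pf := integrable_pos_fin_num measurableT fi.
have nf := integrable_neg_fin_num measurableT fi.
rewrite (H (EFin \o f)^\+%E)//; last exact: measurable_funepos.
rewrite (H (EFin \o f)^\-%E)//; last exact: measurable_funeneg.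
rewrite -(fineK pf) -(fineK nf) -!EFinM -!EFinB/=; ring.
Qed.

End scales.

Section scales_prod.
Context (R : realType) d1 d2 (T1 : measurableType d1) (T2 : measurableType d2).
Context (m1 : {sigma_finite_measure set T1 -> \bar R}).
Context (m2 : {sigma_finite_measure set T2 -> \bar R}).

(** By Tonelli the inner integral is rescaled slice by slice, which is why the second map may depend
    on the first coordinate. This covers shears. *)
Lemma scales_prod (phi1 : T1 -> T1) (phi2 : T1 -> T2 -> T2) c1 c2 : 0 <= c2 ->
  scales_measure m1 phi1 c1 -> (forall x, scales_measure m2 (phi2 x) c2) ->
  measurable_fun setT (fun z : T1 * T2 => phi2 z.1 z.2) ->
  scales_measure (m1 \x m2)%E (fun z => (phi1 z.1, phi2 z.1 z.2)) (c1 * c2).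
Proof.
move=> c20 [mp1 H1] H2 mp2.
have mp : measurable_fun setT (fun z : T1 * T2 => (phi1 z.1, phi2 z.1 z.2)).
  by apply/measurable_fun_pair => //; exact: measurableT_comp.
split => // f mf f0.
have m2f : measurable_fun setT (fun x => \int[m2]_y f (x, y))%E.
  exact: measurable_fun_fubini_tonelli_F.
have m2f0 x : (0 <= \int[m2]_y f (x, y))%E by exact: integral_ge0.
rewrite fubini_tonelli1//; last exact: (measurableT_comp mf mp).
rewrite fubini_tonelli1// /fubini_F /=.
under eq_integral => x _.
  rewrite ((H2 x).2 (fun y => f (phi1 x, y)))//; last exact: measurableT_comp.
  over.
rewrite ge0_integralZl; [|by []|exact: (measurableT_comp m2f mp1)|by move=> *; exact: m2f0|by []].
by rewrite (H1 (fun x => \int[m2]_y f (x, y))%E)// muleA -EFinM mulrC.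
Qed.

End scales_prod.

(** Uniqueness of Lebesgue measure: [c] times the image measure under x |-> v + c x gives every
    half-open interval its length. *)
Lemma scales_lebesgue (R : realType) (v c : R) : 0 < c ->
  scales_measure (@lebesgue_measure R) (fun x => v + c * x) c^-1.
Proof.
move=> c0; have mphi : @measurable_fun _ _ (measurableTypeR R) (measurableTypeR R) setT
    (fun x => v + c * x).
  by apply: measurable_funD => //; exact: measurable_funM.
have c0' : 0 <= c by exact: ltW.
split => // f mf f0.
have [nu nuE] : exists nu : {measure set (measurableTypeR R) -> \bar R},
    forall A, nu A = pushforward (@lebesgue_measure R) (fun x : measurableTypeR R => v + c * x : measurableTypeR R) A.
  by unshelve eexists (pushforward (@lebesgue_measure R) (fun x : measurableTypeR R => v + c * x : measurableTypeR R)).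
have mcE : forall A, measurable A -> lebesgue_measure A = mscale (NngNum c0') nu A.
  apply: lebesgue_measure_unique => _ [[a b]] _ <-.
  rewrite -[RHS]/(c%:E * nu `]a, b]%classic)%E nuE /pushforward.
  have -> : ((fun x : R => v + c * x) @^-1` `]a, b]) = `](a - v) / c, (b - v) / c]%classic.
    apply/seteqP; split => x /=; rewrite !in_itv/= ltr_pdivrMr// ler_pdivlMr// !(mulrC x); lra.
  rewrite !lebesgue_measure_itv/= !lte_fin.
  rewrite ltr_pM2r ?invr_gt0// ltrD2r; case: ifP => _; last by rewrite mule0.
  rewrite -!EFinD -EFinM; congr EFin; field; exact: lt0r_neq0.
have := @ge0_integral_pushforward _ _ _ _ R _ mphi (@lebesgue_measure R) setT f measurableT mf (fun x _ => f0 x).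
rewrite preimage_setT => <-.
rewrite [LHS](eq_measure_integral nu)//.
rewrite [X in _ = (_ * X)%E](eq_measure_integral (mscale (NngNum c0') nu)); last first.
  by move=> A mA _; exact: mcE.
rewrite ge0_integral_mscale//= muleA -EFinM mulVf ?mul1e//; exact: lt0r_neq0.
Qed.

(** * Measurability of continuous functions on product spaces *)

Section caratheodory.
Context (R : realType) d (T : measurableType d).

(* Freezing the second variable at the grid point [floor (n y) / n] gives
   countably piecewise functions that are measurable and converge to [f]. *)
Lemma measurable_fun_caratheodory (f : T * measurableTypeR R -> R) :
  (forall y, measurable_fun setT (fun x => f (x, y))) ->
  (forall x, continuous (fun y : R => f (x, y))) ->
  measurable_fun setT f.
Proof.
move=> mf cf.
pose q (n : nat) (k : int) : R := k%:~R / n.+1%:R.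
pose F (n : nat) (z : T * measurableTypeR R) : R := f (z.1, q n (Num.floor (n.+1%:R * (z.2 : R)))).
apply: (measurable_fun_cvg (h := F)).
  move=> n _ Y mY; rewrite setTI.
  have -> : F n @^-1` Y = \bigcup_(k : int) (((fun x => f (x, q n k)) @^-1` Y) `*` `[q n k, q n (k + 1)[%classic).
    apply/seteqP; split => [[x y] /= FY|[x y] [k _ /= []]].
      exists (Num.floor (n.+1%:R * y)) => //; split => //=.
      rewrite in_itv/= /q ler_pdivrMr ?ltr0n// ltr_pdivlMr ?ltr0n// mulrC.
      by rewrite floor_itv.
    move=> FY; rewrite in_itv/= /q ler_pdivrMr ?ltr0n// ltr_pdivlMr ?ltr0n// mulrC.
    by move=> /floor_def; rewrite /F/= => ->.
  apply: countable_bigcupT_measurable => // k.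
  apply: measurableX; last exact: measurable_itv.
  by rewrite -[X in measurable X]setTI; exact: mf.
move=> [x y] _; rewrite /F/=.
apply: (cvg_comp (fun n : nat => q n (Num.floor (n.+1%:R * y))) (fun y => f (x, y))); last exact: cf.
apply/cvgrPdist_le => e e0; near=> n.
have /andP[h1 h2] := floor_itv (n.+1%:R * y).
have n0 : 0 < n.+1%:R :> R by rewrite ltr0n.
rewrite ger0_norm; last by rewrite subr_ge0 /q ler_pdivrMr// (mulrC y).
apply: (@le_trans _ _ n.+1%:R^-1).
  rewrite lerBlDr -lerBlDl /q ler_pdivlMr// mulrBl mulVf ?gt_eqF//.
  by rewrite lerBlDr (mulrC y) ltW// -(intrD _ _ 1).
near: n; move: (near_infty_natSinv_lt (PosNum e0)); apply: filterS => n /= /ltW//.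
Unshelve. all: by end_near.
Qed.

End caratheodory.

Lemma continuous_pair (U V W : topologicalType) (f : U -> V) (g : U -> W) :
  continuous f -> continuous g -> continuous (fun x => (f x, g x)).
Proof. by move=> cf cg x; apply: cvg_pair; [exact: cf|exact: cg]. Qed.

Lemma continuous_comp2 (U V W : topologicalType) (f : U -> V) (g : V -> W) :
  continuous f -> continuous g -> continuous (fun x => g (f x)).
Proof. by move=> cf cg x; apply: continuous_comp; [exact: cf|exact: cg]. Qed.

Section measurable_continuous.
Context (R : realType).
Local Notation mR := (measurableTypeR R).

(** The product sigma-algebra and the product topology sit on two convertible types, and [j] is in
    use the identity between them. The property is passed on one real factor at a time through
    [measurable_fun_caratheodory]. *)
Definition continuous_measurable d (T : measurableType d) (U : topologicalType)
  (j : T -> U) :=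
  forall f : U -> R, continuous f -> measurable_fun setT (f \o j).

Lemma continuous_measurable_R : @continuous_measurable _ mR R id.
Proof. by move=> f cf; exact: continuous_measurable_fun. Qed.

Lemma continuous_pairl (U V : topologicalType) (x : U) : continuous (fun y : V => (x, y)).
Proof. by move=> y; apply: cvg_pair; [exact: cvg_cst|exact: cvg_id]. Qed.

Lemma continuous_pairr (U V : topologicalType) (y : V) : continuous (fun x : U => (x, y)).
Proof. by move=> x; apply: cvg_pair; [exact: cvg_id|exact: cvg_cst]. Qed.

Lemma continuous_measurable_prod d (T : measurableType d) (U : topologicalType)
    (j : T -> U) : continuous_measurable j ->
  @continuous_measurable _ (T * mR)%type (U * R)%type (fun z => (j z.1, z.2)).
Proof.
move=> mj f cf; apply: measurable_fun_caratheodory => /=.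
  move=> y; apply: (mj (fun x => f (x, y))) => x.
  by apply: (continuous_comp (@continuous_pairr _ _ y x)); exact: cf.
move=> x y; apply: (continuous_comp (@continuous_pairl _ _ (j x) y)); exact: cf.
Qed.

Lemma continuous_measurable_imquat :
  @continuous_measurable _ (mR * mR * mR)%type (imquat R) id.
Proof.
move=> f cf; have := continuous_measurable_prod
  (continuous_measurable_prod continuous_measurable_R) cf.
by apply: eq_measurable_fun => -[[]].
Qed.

Lemma continuous_measurable_quat :
  @continuous_measurable _ (mR * mR * mR * mR)%type (quat R) id.
Proof.
move=> f cf; have := continuous_measurable_prod continuous_measurable_imquat cf.
by apply: eq_measurable_fun => -[[[]]].
Qed.

Lemma continuous_measurable_heis :
  @continuous_measurable _ (mR * mR * mR * mR * (mR * mR * mR))%type (heis R) id.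
Proof.
move=> f cf.
(* [heis] is R^4 times R^3, not a left-nested product, so the three t-coordinates are first split
   off as separate real factors. *)
pose g (z : quat R * R * R * R) : R := f (z.1.1.1, (z.1.1.2, z.1.2, z.2)).
have cg : continuous g.
  move=> z; apply: (@continuous_comp _ _ _ (fun z : quat R * R * R * R =>
    (z.1.1.1, (z.1.1.2, z.1.2, z.2)))); last exact: cf.
  have c1 : continuous (fun z : quat R * R * R * R => z.1) by move=> ?; exact: cvg_fst.
  have c2 : continuous (fun z : quat R * R * R * R => z.1.1).
    by apply: continuous_comp2 c1 _ => ?; exact: cvg_fst.
  apply: continuous_pair; first by apply: continuous_comp2 c2 _ => ?; exact: cvg_fst.
  apply: continuous_pair; last by move=> ?; exact: cvg_snd.
  apply: continuous_pair; first by apply: continuous_comp2 c2 _ => ?; exact: cvg_snd.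
  by apply: continuous_comp2 c1 _ => ?; exact: cvg_snd.
have mg := continuous_measurable_prod (continuous_measurable_prod
  (continuous_measurable_prod continuous_measurable_quat)) cg.
pose h (z : mR * mR * mR * mR * (mR * mR * mR)) : (mR * mR * mR * mR) * mR * mR * mR
  := (z.1, z.2.1.1, z.2.1.2, z.2.2).
have mh : measurable_fun setT h.
  have m2 : measurable_fun setT (fun z : mR * mR * mR * mR * (mR * mR * mR) => z.2.1).
    exact: (measurableT_comp measurable_fst measurable_snd).
  apply/measurable_fun_pair; last exact: (measurableT_comp measurable_snd measurable_snd).
  apply/measurable_fun_pair; last exact: (measurableT_comp measurable_snd m2).
  apply/measurable_fun_pair; last exact: (measurableT_comp measurable_fst m2).
  exact: measurable_fst.
have := measurableT_comp mg mh.
by apply: eq_measurable_fun => -[[[[? ?] ?] ?] [[? ?] ?]] _.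
Qed.

End measurable_continuous.

Section weight1.
Context (R : realType).

(** The basic integrable majorant. Its inverse is a polynomial: rapid decay therefore gives bounds
    by products of [wt1], and on the Fourier side the inverse is the symbol of a differential
    operator. *)
Definition wt1 (x : R) : R := (1 + x ^+ 2)^-1.

Lemma wt1_gt0 x : 0 < wt1 x.
Proof. by rewrite invr_gt0 ltr_pwDl// sqr_ge0. Qed.

Lemma continuous_wt1 : continuous wt1.
Proof. exact: continuous_oneDsqrV. Qed.

Lemma rintegrable_wt1 : rintegrable (@lebesgue_measure R) wt1.
Proof.
have mw : measurable_fun setT (EFin \o wt1).
  by apply/measurable_EFinP; apply: continuous_measurable_fun; exact: continuous_wt1.
apply/integrableP; split => //.
under eq_integral do rewrite /= ger0_norm ?ltW ?wt1_gt0//.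
rewrite ge0_symfun_integralT//; last 3 first.
- by move=> x; rewrite ltW// wt1_gt0.
- exact: continuous_wt1.
- by move=> x; rewrite /wt1/= sqrrN.
have -> : [set x | 0 <= x] = `[0%R, +oo[%classic :> set R.
  by apply/seteqP; split => x /=; rewrite in_itv/= andbT.
rewrite (@ge0_continuous_FTC2y R wt1 atan 0 (pi / 2)).
- by rewrite -EFinB -EFinM ltry.
- by move=> x _; rewrite ltW// wt1_gt0.
- by apply: continuous_subspaceT; exact: continuous_wt1.
- exact: cvgy_atan.
- by move=> x _; exact: derivable_atan.
- by apply: cvg_at_right_filter; exact: continuous_atan.
- by move=> x _; rewrite derive1_atan.
Qed.

(** One majorant for all small translates, as differentiation under the integral requires. The
    constant comes from x^2 <= 2 (h + x)^2 + 2 h^2. *)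
Lemma wt1_shift h x : `|h| <= 1 -> wt1 (h + x) <= 3 * wt1 x.
Proof.
move=> h1; rewrite /wt1 -[3]invrK -invfM lef_pV2 ?posrE.
- have : h ^+ 2 <= 1 by rewrite -real_normK ?num_real// expr_le1.
  have := sqr_ge0 (2 * h + x); have := sqr_ge0 (h + x); nra.
- by rewrite ltr_pwDl// sqr_ge0.
- by rewrite mulr_gt0// ltr_pwDl// sqr_ge0.
Qed.

End weight1.

(** * Differentiation under the integral sign *)

Section integral_derivative.
Context (R : realType) d (T : measurableType d) (mu : {measure set T -> \bar R}).

Lemma is_derive_Rintegral (F F' : R -> T -> R) (G : T -> R) (a : R) :
  (forall h, rintegrable mu (F h)) ->
  (forall (h : R) t, is_derive h (1 : R) (F ^~ t) (F' h t)) ->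
  (forall h t, `|h - a| < 1 -> `|F' h t| <= G t) -> rintegrable mu G ->
  is_derive a (1 : R) (fun h => \int[mu]_t F h t) (\int[mu]_t F' a t).
Proof.
move=> iF dF F'G iG.
have Ia : `](a - 1), (a + 1)[%classic a by rewrite /= in_itv/=; lra.
have E h t : partial1of2 F h t = F' h t.
  by rewrite partial1of2E; have [_ ->] := dF h t.
have G0 t : 0 <= G t.
  by apply: le_trans (F'G a t _) => //; rewrite subrr normr0.
have iF' h (_ : `](a - 1), (a + 1)[%classic h) := iF h.
have dF' h t : `](a - 1), (a + 1)[%classic h -> setT t -> derivable (F ^~ t) h 1.
  by move=> _ _; have [] := dF h t.
have Gub h t : `](a - 1), (a + 1)[%classic h -> setT t -> `|partial1of2 F h t| <= G t.
  move=> /=; rewrite in_itv/= => /andP[h1 h2] _; rewrite E; apply: F'G.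
  by rewrite ltr_norml; lra.
apply: DeriveDef.
  exact: (derivable_under_integral measurableT Ia iF' dF' G0 iG Gub).
rewrite -derive1E (differentiation_under_integral measurableT Ia iF' dF' G0 iG Gub).
by apply: eq_Rintegral => t _; rewrite E.
Qed.

(* Translation invariance makes [h |-> \int g (tau h z)] constant. *)
Lemma Rintegral_derivative0 (tau : R -> T -> T) (g dg G : T -> R) :
  (forall h, scales_measure mu (tau h) 1) -> (forall z, tau 0 z = z) ->
  rintegrable mu g ->
  (forall (h : R) z, is_derive h (1 : R) (fun h => g (tau h z)) (dg (tau h z))) ->
  (forall h z, `|h| < 1 -> `|dg (tau h z)| <= G z) -> rintegrable mu G ->
  \int[mu]_z dg z = 0.
Proof.
move=> stau tau0 ig der dgG iG.
have := @is_derive_Rintegral (fun h z => g (tau h z)) (fun h z => dg (tau h z)) G 0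
  (fun h => (scales_Rintegral (stau h) ig).1) der.
have -> : (fun h => \int[mu]_t g (tau h t)) = cst (\int[mu]_t g t).
  by apply/funext => h; rewrite (scales_Rintegral (stau h) ig).2 mul1r.
have -> : \int[mu]_z dg z = \int[mu]_z dg (tau 0 z).
  by apply: eq_Rintegral => z _; rewrite tau0.
case=> //; first by move=> h t h1; apply: dgG; rewrite -(subr0 h).
by rewrite derive_cst => _ <-.
Qed.

End integral_derivative.

Section pointwise_is_derive.
Context (R : realType) (V : normedModType R).
Implicit Types (f g : V -> R) (x v : V).

Lemma is_derive_add f g x v df dg :
  is_derive x v f df -> is_derive x v g dg -> is_derive x v (fun x => f x + g x) (df + dg).
Proof. exact: is_deriveD. Qed.

Lemma is_derive_mul f g x v df dg :
  is_derive x v f df -> is_derive x v g dg ->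
  is_derive x v (fun x => f x * g x) (df * g x + f x * dg).
Proof.
move=> hf hg; apply: is_derive_eq (is_deriveM hf hg) _.
by rewrite addrC /GRing.scale/= (mulrC df).
Qed.

Lemma is_derive_mulZ f x v df c :
  is_derive x v f df -> is_derive x v (fun x => c * f x) (c * df).
Proof. by move=> hf; exact: is_deriveZ. Qed.

Lemma is_derive_const x v (c : R) : is_derive x v (fun=> c) 0.
Proof. exact: is_derive_cst. Qed.

(** Reduces directional derivatives to one real variable, where the chain rule and the mean value
    theorem are available. *)
Lemma derive_line f x v : 'D_1 (fun h : R => f (h *: v + x)) 0 = 'D_v f x.
Proof.
rewrite /derive; set g1 := fun h => h^-1 *: _; set g2 := fun h => h^-1 *: _.
suff -> : g1 = g2 by [].
by rewrite funeqE /g1 /g2 => h /=; rewrite addr0 scale0r add0r [_%:A]mulr1.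
Qed.

Lemma is_derive_line f x v df : is_derive x v f df ->
  is_derive (0 : R) (1 : R) (fun h : R => f (h *: v + x)) df.
Proof.
move=> [df1 df2]; apply: DeriveDef; first exact: (derivable1P f x v).1 df1.
by rewrite derive_line.
Qed.

Lemma line_is_derive f x v df :
  is_derive (0 : R) (1 : R) (fun h : R => f (h *: v + x)) df -> is_derive x v f df.
Proof.
move=> [df1 df2]; apply: DeriveDef; first exact: (derivable1P f x v).2 df1.
by rewrite -derive_line.
Qed.

Lemma is_derive_comp1 (F : R -> R) f x v dF df : is_derive x v f df ->
  is_derive (f x) (1 : R) F dF -> is_derive x v (fun x => F (f x)) (dF * df).
Proof.
move=> dfx dFx; apply: line_is_derive.
apply: (@is_derive1_comp R F (fun h : R => f (h *: v + x))); last exact: is_derive_line.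
by rewrite scale0r add0r.
Qed.

End pointwise_is_derive.

Lemma is_derive_affine (R : realType) (c u x : R) :
  is_derive x (1 : R) (fun x : R => c + x * u) u.
Proof.
have := is_derive_add (is_derive_const x 1 c)
  (is_derive_mul (is_derive_id x 1) (is_derive_const x 1 u)).
by rewrite mulr0 addr0 add0r mul1r.
Qed.

Lemma is_derive_sqrZ (R : realType) (k x : R) :
  is_derive x (1 : R) (fun x : R => k * x ^+ 2) (k * (2 * x)).
Proof.
apply: is_derive_mulZ; have := is_derive_mul (is_derive_id x (1:R)) (is_derive_id x 1).
by rewrite mul1r mulr1 -mulr2n mulr_natl.
Qed.

(** * Gaussian integrals *)

Section gauss1.
Context (R : realType).
Local Notation mu := (@lebesgue_measure R).

(** Squaring 1 + x^2 / 2 <= exp (x^2 / 2) bounds the Gaussian by (1 + x^2 / 2)^(-2). The factor 1 +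
    |x| leaves room for the x that a derivative of the Gaussian or of the cosine brings down. *)
Lemma expR_sqr_bound (x : R) : (1 + `|x|) * expR (- x ^+ 2) <= 4 * wt1 x.
Proof.
have h : expR (- x ^+ 2) <= (1 + x ^+ 2 / 2) ^- 2.
  rewrite expRN lef_pV2 ?posrE ?expR_gt0//; last first.
    by rewrite exprn_gt0// ltr_pwDl// divr_ge0// sqr_ge0.
  rewrite [X in expR X](_ : _ = x ^+ 2 / 2 + x ^+ 2 / 2); last by lra.
  by rewrite expRD -expr2 lerXn2r ?nnegrE ?expR_ge0 ?expR_ge1Dx// addr_ge0// divr_ge0// sqr_ge0.
apply: (le_trans (ler_wpM2l _ h)); first by rewrite addr_ge0.
have x0 := sqr_ge0 x.
have xn := normr_ge0 x; have xE : x ^+ 2 = `|x| ^+ 2 by rewrite real_normK// num_real.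
rewrite /wt1 ler_pdivrMr; last by rewrite exprn_gt0//; lra.
rewrite mulrAC ler_pdivlMr; last by lra.
rewrite xE; set y := `|x| in xn *.
have : 0 <= (y - 1) ^+ 2 by exact: sqr_ge0.
nra.
Qed.

Lemma rintegrable_expR_sqr : rintegrable mu (fun x => expR (- x ^+ 2)).
Proof.
apply: rintegrable_le (rintegrableZ 4 (@rintegrable_wt1 R)).
  exact: measurable_gauss_fun.
move=> x; rewrite ger0_norm ?expR_ge0//; apply: le_trans (expR_sqr_bound x).
by rewrite ler_peMl ?expR_ge0// lerDl.
Qed.

Lemma measurable_gauss_trig (f : R -> R) (c u : R) : continuous f ->
  measurable_fun setT (fun x : measurableTypeR R => expR (- x ^+ 2) * f (c + x * u)).
Proof.
move=> cf; apply: measurable_funM; first exact: measurable_gauss_fun.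
apply: continuous_measurable_fun; apply: continuous_comp2 cf => x.
by apply: cvgD; [exact: cvg_cst|apply: cvgM; [exact: cvg_id|exact: cvg_cst]].
Qed.

Lemma normr_sin_le1 (x : R) : `|sin x| <= 1.
Proof. by rewrite ler_norml sin_le1 sin_geN1. Qed.

Lemma rintegrable_gauss_trig (f : R -> R) (c u : R) : continuous f ->
  (forall x, `|f x| <= 1) ->
  rintegrable mu (fun x => expR (- x ^+ 2) * f (c + x * u)).
Proof.
move=> cf f1; apply: rintegrable_le rintegrable_expR_sqr; first exact: measurable_gauss_trig.
by move=> x; rewrite normrM (ger0_norm (expR_ge0 _)) ler_piMr ?expR_ge0.
Qed.

Lemma is_derive_gauss_trig (f f' : R -> R) (c u x : R) :
  (forall x : R, is_derive x (1 : R) f (f' x)) ->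
  is_derive x 1 (fun x => expR (- x ^+ 2) * f (c + x * u))
    (expR (- x ^+ 2) * (u * f' (c + x * u) - 2 * x * f (c + x * u))).
Proof.
move=> df.
have d2 := is_derive_comp1 (is_derive_affine c u x) (df _).
have d3 : is_derive x (1 : R) (fun x : R => expR (- x ^+ 2)) (expR (- x ^+ 2) * (- 1 * (2 * x))).
  have := is_derive_sqrZ (- 1) x; under eq_fun do rewrite mulN1r.
  by move=> h; apply: is_derive_comp1 h (is_derive_expR _).
apply: is_derive_eq (is_derive_mul d3 d2) _; ring.
Qed.

Lemma Rintegral_gauss_cos (c u : R) :
  \int[mu]_x (expR (- x ^+ 2) * cos (c + x * u)) =
  cos c * Num.sqrt pi * expR (- (u ^+ 2 / 4)).
Proof.
have cc : continuous (@cos R) by exact: continuous_cos.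
have cs : continuous (@sin R) by exact: continuous_sin.
pose phi (u : R) := \int[mu]_x (expR (- x ^+ 2) * cos (c + x * u)).
(* Integrating the derivative of [exp (- x^2) * sin (c + x u)] turns
   differentiation under the integral into the equation phi' = - u / 2 * phi. *)
have dphi (v : R) : is_derive v (1 : R) phi (- (v / 2) * phi v).
  pose f (v x : R) := expR (- x ^+ 2) * cos (c + x * v).
  pose f' (v x : R) := expR (- x ^+ 2) * (- (x * sin (c + x * v))).
  have df x w : is_derive w (1 : R) (f ^~ x) (f' w x).
    have d1 : is_derive w (1 : R) (fun w : R => c + x * w) x.
      by under eq_fun do rewrite mulrC; exact: is_derive_affine.
    have d2 := is_derive_comp1 d1 (is_derive_cos _).
    apply: is_derive_eq (is_derive_mulZ (expR (- x ^+ 2)) d2) _.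
    by rewrite /f'; ring.
  have intf w : rintegrable mu (f w).
    by apply: rintegrable_gauss_trig => // x; exact: cos_max.
  have iG := rintegrableZ 4 (@rintegrable_wt1 R).
  have f'G w x : `|f' w x| <= 4 * wt1 x.
    rewrite /f' normrM (ger0_norm (expR_ge0 _)) normrN normrM.
    apply: le_trans (expR_sqr_bound x); rewrite mulrC ler_wpM2r ?expR_ge0//.
    have := normr_sin_le1 (c + x * w); have := normr_ge0 x; have := normr_ge0 (sin (c + x * w)); nra.
  have if' : rintegrable mu (f' v).
    refine (@rintegrable_le _ _ _ mu (f' v) (fun x => 4 * wt1 x) _ (f'G v) iG).
    have -> : f' v = (fun x : R => - x * (expR (- x ^+ 2) * sin (c + x * v))).
      by apply/funext => x; rewrite /f'; ring.
    by apply: measurable_funM; [by apply: continuous_measurable_fun => x; exact: opp_continuous|exact: measurable_gauss_trig].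
  have ig : rintegrable mu (fun x => v / 2 * (expR (- x ^+ 2) * cos (c + x * v))).
    by apply: rintegrableZ; apply: rintegrable_gauss_trig => // x; exact: cos_max.
  have IBP : \int[mu]_x (v / 2 * (expR (- x ^+ 2) * cos (c + x * v)) + f' v x) = 0.
    pose dg (x : R) := expR (- x ^+ 2) * (v * cos (c + x * v) - 2 * x * sin (c + x * v)).
    have dgG x : `|dg x| <= (`|v| + 2) * (4 * wt1 x).
      rewrite /dg normrM (ger0_norm (expR_ge0 _)).
      apply: (@le_trans _ _ ((`|v| + 2) * ((1 + `|x|) * expR (- x ^+ 2)))); last first.
        by rewrite ler_wpM2l ?addr_ge0// expR_sqr_bound.
      rewrite mulrA mulrC ler_wpM2r ?expR_ge0//.
      apply: (le_trans (ler_normB _ _)); rewrite !normrM (ger0_norm (ler0n _ 2)).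
      have := normr_sin_le1 (c + x * v); have := cos_max (c + x * v).
      have := normr_ge0 x; have := normr_ge0 v.
      have := normr_ge0 (sin (c + x * v)); have := normr_ge0 (cos (c + x * v)); nra.
    have idg : rintegrable mu dg.
      refine (@rintegrable_le _ _ _ mu dg _ _ dgG (rintegrableZ (`|v| + 2) iG)).
      have -> : dg = (fun x : R => 2 * (v / 2 * (expR (- x ^+ 2) * cos (c + x * v)) + f' v x)).
        by apply/funext => x; rewrite /f' /dg; field.
      by apply: measurable_funM => //; apply: measurable_funD; [exact: rintegrable_measurable ig|exact: rintegrable_measurable if'].
    pose tau (h x : R) : R := h + 1 * x.
    pose g (x : R) : R := expR (- x ^+ 2) * sin (c + x * v).
    (* 12 is the 4 of [expR_sqr_bound] times the 3 of [wt1_shift]. *)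
    pose G (x : R) : R := ((`|v| + 2) * 12) * wt1 x.
    have stau h : scales_measure mu (tau h) 1.
      by have := @scales_lebesgue R h 1 ltr01; rewrite invr1.
    have tau0 x : tau 0 x = x by rewrite /tau mul1r add0r.
    have ig' : rintegrable mu g by apply: rintegrable_gauss_trig => // x; exact: normr_sin_le1.
    have dtau (h x : R) : is_derive h (1 : R) (fun h => g (tau h x)) (dg (tau h x)).
      have a1 : is_derive h (1 : R) (fun h : R => h + 1 * x) 1.
        by have := is_derive_affine (1 * x) 1 h; under eq_fun do rewrite mulr1 addrC.
      have a2 : is_derive (h + 1 * x) (1 : R) g (dg (h + 1 * x)).
        by apply: is_derive_gauss_trig => y; exact: is_derive_sin.
      by apply: is_derive_eq (is_derive_comp1 a1 a2) _; rewrite mulr1.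
    have dgtau (h x : R) : `|h| < 1 -> `|dg (tau h x)| <= G x.
      move=> h1; rewrite /tau mul1r; apply: (le_trans (dgG _)).
      rewrite /G -mulrA ler_wpM2l ?addr_ge0//.
      have := wt1_shift x (ltW h1); lra.
    have iG' : rintegrable mu G by exact: rintegrableZ (@rintegrable_wt1 R).
    have H := Rintegral_derivative0 stau tau0 ig' dtau dgtau iG'.
    transitivity (2^-1 * \int[mu]_x dg x); last by rewrite H mulr0.
    rewrite -RintegralZl//.
    by apply: eq_Rintegral => x _; rewrite /f' /dg; field.
  have D := is_derive_Rintegral intf (fun w x => df x w) (fun w x (_ : `|w - v| < 1) => f'G w x) iG.
  suff <- : \int[mu]_x f' v x = - (v / 2) * phi v by exact: D.
  move: IBP; rewrite RintegralD// RintegralZl//; last first.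
    by apply: rintegrable_gauss_trig => // x; exact: cos_max.
  by rewrite -/(phi v) => IBP; lra.
(* Integrating factor: phi' = - u / 2 * phi makes [psi] constant, and its value at 0 is cos c times
   the Gaussian integral. *)
pose psi (u : R) := phi u * expR (u ^+ 2 / 4).
have dpsi (v : R) : is_derive v (1 : R) psi 0.
  have d3 : is_derive v (1 : R) (fun x : R => expR (x ^+ 2 / 4))
      (expR (v ^+ 2 / 4) * (4^-1 * (2 * v))).
    have := is_derive_sqrZ (4^-1) v; under eq_fun do rewrite mulrC.
    by move=> h; apply: is_derive_comp1 h (is_derive_expR _).
  by apply: is_derive_eq (is_derive_mul (dphi v) d3) _; field.
have := is_derive_0_is_cst u 0 dpsi.
rewrite {2}/psi expr0n/= mul0r expR0 mulr1.
have -> : phi 0 = cos c * Num.sqrt pi.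
  rewrite /phi; under eq_Rintegral do rewrite mulr0 addr0 mulrC.
  rewrite RintegralZl//; last exact: rintegrable_expR_sqr.
  by congr (_ * _); rewrite /Rintegral integralT_gauss.
move=> <-; rewrite /psi -/(phi u) -mulrA -expRD subrr expR0 mulr1//.
Qed.

End gauss1.

Section gaussian_kernel.
Context (R : realType).

(** What is needed of the squared norm [sq] and inner product [dot] of an n-dimensional Euclidean
    space. The free phase [c] makes the notion stable under products: in the inner integral the
    contribution of the first factor to the phase is a constant, and the result is a cosine of the
    first variable alone. *)
Definition gaussian_kernel d (T : measurableType d) (mu : {measure set T -> \bar R})
    (sq : T -> R) (dot : T -> T -> R) (n : nat) :=
  [/\ forall u, measurable_fun setT (dot ^~ u),
    forall e, 0 < e -> rintegrable mu (fun x => expR (- (e ^+ 2 * sq x))) &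
    forall e c u, 0 < e ->
      \int[mu]_x (expR (- (e ^+ 2 * sq x)) * cos (c + dot x u)) =
      cos c * (Num.sqrt pi / e) ^+ n * expR (- (sq u / (4 * e ^+ 2)))].

Lemma gaussian_kernel_integrable d (T : measurableType d) (mu : {measure set T -> \bar R})
    (sq : T -> R) (dot : T -> T -> R) (n : nat) e c u :
  gaussian_kernel mu sq dot n -> 0 < e ->
  rintegrable mu (fun x => expR (- (e ^+ 2 * sq x)) * cos (c + dot x u)).
Proof.
move=> [md ig _] e0; have ie := ig e e0.
have me : measurable_fun setT (fun x => expR (- (e ^+ 2 * sq x)) * cos (c + dot x u)).
  apply: measurable_funM; first exact: rintegrable_measurable ie.
  apply: measurableT_comp; first by apply: continuous_measurable_fun; exact: continuous_cos.
  exact: measurable_funD.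
apply: rintegrable_le me _ ie => x.
by rewrite normrM (ger0_norm (expR_ge0 _)) ler_piMr ?expR_ge0// cos_max.
Qed.

Lemma gaussian_kernel_lebesgue :
  gaussian_kernel (@lebesgue_measure R) (fun x => x ^+ 2) (fun x u => x * u) 1.
Proof.
split.
- by move=> u; exact: measurable_funM.
- move=> e e0.
  have := (scales_Rintegral (@scales_lebesgue R 0 e e0) (@rintegrable_expR_sqr R)).1.
  apply: eq_ind; congr rintegrable; apply/funext => x /=.
  by rewrite add0r exprMn.
- move=> e c u e0.
  have ic : rintegrable (@lebesgue_measure R) (fun x => expR (- x ^+ 2) * cos (c + x * (u / e))).
    by apply: rintegrable_gauss_trig; [exact: continuous_cos|exact: cos_max].
  have e0' := lt0r_neq0 e0.
  have := (scales_Rintegral (@scales_lebesgue R 0 e e0) ic).2.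
  rewrite Rintegral_gauss_cos => H.
  rewrite (_ : cos c * _ * _ = e^-1 * (cos c * Num.sqrt pi * expR (- ((u / e) ^+ 2 / 4)))).
    rewrite -H; apply: eq_Rintegral => x _; rewrite add0r exprMn; congr (_ * cos _).
    by congr (_ + _); field.
  rewrite expr1 (_ : u ^+ 2 / (4 * e ^+ 2) = (u / e) ^+ 2 / 4); last by field.
  ring.
Qed.

Lemma gaussian_kernel_prod d1 d2 (T1 : measurableType d1) (T2 : measurableType d2)
    (m1 : {sigma_finite_measure set T1 -> \bar R})
    (m2 : {sigma_finite_measure set T2 -> \bar R}) sq1 sq2 dot1 dot2 n1 n2 :
  gaussian_kernel m1 sq1 dot1 n1 -> gaussian_kernel m2 sq2 dot2 n2 ->
  gaussian_kernel (m1 \x m2)%E (fun z => sq1 z.1 + sq2 z.2)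
    (fun z w => dot1 z.1 w.1 + dot2 z.2 w.2) (n1 + n2).
Proof.
move=> g1 g2; have [md1 i1 e1] := g1; have [md2 i2 e2] := g2.
have gi e : 0 < e -> rintegrable (m1 \x m2)%E (fun z => expR (- (e ^+ 2 * (sq1 z.1 + sq2 z.2)))).
  move=> e0; have := rintegrable_prod (i1 e e0) (i2 e e0).
  apply: eq_ind; congr rintegrable; apply/funext => z /=.
  by rewrite -expRD; congr expR; ring.
have md u : measurable_fun setT (fun z : T1 * T2 => dot1 z.1 u.1 + dot2 z.2 u.2).
  apply: measurable_funD; first exact: (measurableT_comp (md1 u.1) measurable_fst).
  exact: (measurableT_comp (md2 u.2) measurable_snd).
split => //.
move=> e c u e0.
pose f z := expR (- (e ^+ 2 * (sq1 z.1 + sq2 z.2))) * cos (c + (dot1 z.1 u.1 + dot2 z.2 u.2)).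
have fE x y : f (x, y) = expR (- (e ^+ 2 * sq1 x)) *
    (expR (- (e ^+ 2 * sq2 y)) * cos ((c + dot1 x u.1) + dot2 y u.2)).
  by rewrite /f/= mulrA -expRD -addrA; congr (expR _ * _); ring.
have fi : rintegrable (m1 \x m2)%E f.
  have mf : measurable_fun setT f.
    apply: measurable_funM; first exact: rintegrable_measurable (gi e e0).
    apply: measurableT_comp; first by apply: continuous_measurable_fun; exact: continuous_cos.
    by apply: measurable_funD => //; exact: md.
  apply: rintegrable_le mf _ (gi e e0) => z.
  by rewrite normrM (ger0_norm (expR_ge0 _)) ler_piMr ?expR_ge0// cos_max.
have f2i x : rintegrable m2 (fun y => f (x, y)).
  have -> : (fun y => f (x, y)) = (fun y => expR (- (e ^+ 2 * sq1 x)) *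
    (expR (- (e ^+ 2 * sq2 y)) * cos ((c + dot1 x u.1) + dot2 y u.2))).
    by apply/funext => y; rewrite fE.
  by apply: rintegrableZ; exact: gaussian_kernel_integrable g2 e0.
have [_ ->] := Rfubini fi f2i.
transitivity (\int[m1]_x ((Num.sqrt pi / e) ^+ n2 * expR (- (sq2 u.2 / (4 * e ^+ 2))) *
   (expR (- (e ^+ 2 * sq1 x)) * cos (c + dot1 x u.1)))).
  apply: eq_Rintegral => x _.
  under eq_Rintegral do rewrite fE.
  rewrite RintegralZl//; last exact: gaussian_kernel_integrable g2 e0.
  by rewrite e2//; ring.
rewrite RintegralZl//; last exact: gaussian_kernel_integrable g1 e0.
rewrite e1// exprD (_ : - ((sq1 u.1 + sq2 u.2) / (4 * e ^+ 2)) =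
  - (sq1 u.1 / (4 * e ^+ 2)) - sq2 u.2 / (4 * e ^+ 2)); last by rewrite mulrDl opprD.
by rewrite expRD; ring.
Qed.

End gaussian_kernel.

(** Since [c > 0], an infinite integral of |f| would make that of |f o phi| infinite as well. This
    serves when integrability is seen only after rescaling. *)
Lemma scales_rintegrable (R : realType) d (T : measurableType d)
    (mu : {measure set T -> \bar R}) phi c (f : T -> R) :
  scales_measure mu phi c -> 0 < c -> measurable_fun setT f ->
  rintegrable mu (f \o phi) -> rintegrable mu f.
Proof.
move=> [mphi H] c0 mf /integrableP[_]; have mE : measurable_fun setT (EFin \o f) by exact/measurable_EFinP.
rewrite (H (fun x => `|(EFin \o f) x|)%E)//; last exact: measurableT_comp.
move=> lt; apply/integrableP; split => //.
move: lt; set I := integral _ _ _; case: I => [x| |] //; first by move=> _; exact: ltry.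
by rewrite gt0_muley ?lte_fin// ltxx.
Qed.

(** * Gaussian regularization *)

Section gaussian_inversion.
Context (R : realType) d1 d2 (Z : measurableType d1) (V : measurableType d2).
Context (nu : {sigma_finite_measure set Z -> \bar R}).
Context (mu : {sigma_finite_measure set V -> \bar R}).

(* Multiplying by [exp (- e^2 |xi|^2)] makes Fubini applicable; [e] then tends to 0. *)
Lemma gaussian_inversion sq dot n (h al : Z -> R) (G : V -> R) (u : Z -> V) :
  gaussian_kernel mu sq dot n -> (forall v, 0 <= sq v) ->
  rintegrable nu h -> measurable_fun setT al ->
  measurable_fun setT (fun p : V * Z => dot p.1 (u p.2)) ->
  (forall xi, `|\int[nu]_z (h z * cos (al z + dot xi (u z)))| <= G xi) ->
  rintegrable mu G ->
  (fun m : nat => \int[nu]_z (h z * cos (al z) *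
     ((Num.sqrt pi / m.+1%:R^-1) ^+ n *
      expR (- (sq (u z) / (4 * m.+1%:R^-1 ^+ 2)))))) @ \oo -->
  \int[mu]_xi \int[nu]_z (h z * cos (al z + dot xi (u z))).
Proof.
move=> gk sq0 ih mal mdot IG iG; have [md ik ek] := gk.
pose Ih xi := \int[nu]_z (h z * cos (al z + dot xi (u z))).
pose e (m : nat) : R := m.+1%:R^-1.
have e0 m : 0 < e m by rewrite invr_gt0.
have mh := rintegrable_measurable ih.
have mcos : measurable_fun setT (@cos R).
  by apply: continuous_measurable_fun; exact: continuous_cos.
pose F m (p : V * Z) := expR (- (e m ^+ 2 * sq p.1)) * (h p.2 * cos (al p.2 + dot p.1 (u p.2))).
have bnd m (p : V * Z) : `|F m p| <= expR (- (e m ^+ 2 * sq p.1)) * `|h p.2|.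
  rewrite normrM (ger0_norm (expR_ge0 _)) ler_wpM2l ?expR_ge0// normrM.
  by rewrite ler_piMr// cos_max.
have inh : rintegrable nu (fun z => `|h z|).
  exact: (integrable_norm ih).
have mF m : measurable_fun setT (F m).
  apply: measurable_funM.
    exact: (measurableT_comp (rintegrable_measurable (ik (e m) (e0 m))) measurable_fst).
  apply: measurable_funM; first exact: (measurableT_comp mh measurable_snd).
  apply: measurableT_comp => //; apply: measurable_funD => //.
  exact: (measurableT_comp mal measurable_snd).
have iF m : rintegrable (mu \x nu)%E (F m).
  exact: rintegrable_le (mF m) (bnd m) (rintegrable_prod (ik (e m) (e0 m)) inh).
have iFl m xi : rintegrable nu (fun z => F m (xi, z)).
  have mFx : measurable_fun setT (fun z => F m (xi, z)).
    exact: (measurableT_comp (mF m) (measurable_pair1 xi)).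
  exact: rintegrable_le mFx (fun z => bnd m (xi, z)) (rintegrableZ (expR (- (e m ^+ 2 * sq xi))) inh).
have mslice xi : measurable_fun setT (fun z => h z * cos (al z + dot xi (u z))).
  apply: measurable_funM => //; apply: measurableT_comp => //; apply: measurable_funD => //.
  exact: (measurableT_comp mdot (measurable_pair1 xi)).
have islice xi : rintegrable nu (fun z => h z * cos (al z + dot xi (u z))).
  apply: rintegrable_le (mslice xi) _ inh => z.
  by rewrite normrM ler_piMr// cos_max.
have iFr m z : rintegrable mu (fun xi => F m (xi, z)).
  have := rintegrableZ (h z) (gaussian_kernel_integrable (al z) (u z) gk (e0 m)).
  by apply: eq_ind; congr rintegrable; apply/funext => xi; rewrite /F/=; ring.
(* Two evaluations of the double integral of [F m]. Integrating over xi first gives the Gaussian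
   average in z; integrating over z first gives the damped transform, which [G] dominates uniformly
   in [m]. *)
have FE m : \int[nu]_z (h z * cos (al z) *
     ((Num.sqrt pi / e m) ^+ n * expR (- (sq (u z) / (4 * e m ^+ 2))))) =
   \int[mu]_xi (expR (- (e m ^+ 2 * sq xi)) * Ih xi).
  transitivity (\int[nu]_z \int[mu]_xi F m (xi, z)).
    apply: eq_Rintegral => z _.
    transitivity (h z * (\int[mu]_xi (expR (- (e m ^+ 2 * sq xi)) * cos (al z + dot xi (u z))))).
      by rewrite ek//; ring.
    rewrite -RintegralZl//; last exact: gaussian_kernel_integrable gk (e0 m).
    by apply: eq_Rintegral => xi _; rewrite /F/=; ring.
  rewrite -(Rfubini_sym (iF m) (iFr m)).2 (Rfubini (iF m) (iFl m)).2.
  apply: eq_Rintegral => xi _; rewrite -RintegralZl//; exact: islice.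
rewrite (_ : (fun m : nat => _) = (fun m => \int[mu]_xi (expR (- (e m ^+ 2 * sq xi)) * Ih xi))); last first.
  by apply/funext => m; rewrite -FE.
apply: (dominated_cvg_Rintegral (g := G)) => //.
- move=> m; have := rintegrable_measurable (Rfubini (iF m) (iFl m)).1.
  rewrite (_ : (fun xi => \int[nu]_z F m (xi, z)) = (fun xi => expR (- (e m ^+ 2 * sq xi)) * Ih xi))//.
  by apply/funext => xi; rewrite -RintegralZl//; exact: islice.
- move=> xi; rewrite -[X in _ --> X]mul1r; apply: cvgMl.
  rewrite -expR0 -oppr0 -(mul0r (sq xi)).
  apply: (cvg_comp (fun m => - (e m ^+ 2 * sq xi)) expR); last exact: continuous_expR.
  apply: cvgN; apply: cvgMl; rewrite -(mulr0 0).
  by apply: cvgM; exact: cvg_harmonic.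
- move=> m xi; rewrite normrM (ger0_norm (expR_ge0 _)); apply: le_trans (IG xi).
  by rewrite ler_piMl// -expR0 ler_expR oppr_le0 mulr_ge0// sqr_ge0.
Qed.

End gaussian_inversion.

Section gaussian_limit.
Context (R : realType) d (V : measurableType d) (mu : {measure set V -> \bar R}).

(** Approximate identity: the substitution v = A r w turns the shrinking Gaussian into the fixed exp
    (- sq w), and k (A r w) tends to [k0] under the majorant M exp (- sq w). The factors sqrt pi /
    e, r = 2 e / la and the total mass sqrt pi, each to the power n, multiply to (2 pi / la)^n. *)
Lemma gaussian_limit sq dot n (k sqx : V -> R) (A : R -> V -> V) (v0 : V) (k0 M la : R) :
  gaussian_kernel mu sq dot n -> (forall v, dot v v0 = 0) -> sq v0 = 0 -> 0 < la ->
  (forall r, 0 < r -> scales_measure mu (A r) ((r^-1) ^+ n)) ->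
  (forall r w, sqx (A r w) = r ^+ 2 * sq w) ->
  measurable_fun setT k -> measurable_fun setT sqx -> (forall v, `|k v| <= M) ->
  (forall w (r : nat -> R), r @ \oo --> 0 -> (fun m => k (A (r m) w)) @ \oo --> k0) ->
  (fun m : nat => \int[mu]_v (k v *
     ((Num.sqrt pi / m.+1%:R^-1) ^+ n *
      expR (- ((la ^+ 2 * sqx v) / (4 * m.+1%:R^-1 ^+ 2)))))) @ \oo -->
  (2 * pi / la) ^+ n * k0.
Proof.
move=> gk dot0 sq0 la0 sA sqA mk msq kM kA; have [md ik ek] := gk.
have la0' := lt0r_neq0 la0.
have M0 : 0 <= M by apply: le_trans (kM v0).
(* With e = 1 / (m + 1), this radius solves la^2 r^2 / (4 e^2) = 1. *)
pose r (m : nat) : R := 2 * m.+1%:R^-1 / la.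
have r0 m : 0 < r m by rewrite divr_gt0// mulr_gt0// invr_gt0.
have cr : r @ \oo --> (0 : R).
  rewrite (_ : r = (fun m => (2 / la) * m.+1%:R^-1)); last by apply/funext => m; rewrite /r; ring.
  rewrite -(mulr0 (2 / la)); apply: cvgMr => //.
  exact: cvg_harmonic.
have i1 : rintegrable mu (fun w => expR (- sq w)).
  by have := ik 1 ltr01; under eq_fun do rewrite expr1n mul1r.
have mA m : measurable_fun setT (A (r m)) by have [] := sA _ (r0 m).
have E m : \int[mu]_v (k v * ((Num.sqrt pi / m.+1%:R^-1) ^+ n *
      expR (- ((la ^+ 2 * sqx v) / (4 * m.+1%:R^-1 ^+ 2))))) =
    (2 * Num.sqrt pi / la) ^+ n * \int[mu]_w (k (A (r m) w) * expR (- sq w)).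
  pose e : R := m.+1%:R^-1.
  have e0 : e != 0 by rewrite invr_eq0 pnatr_eq0.
  pose f v := k v * ((Num.sqrt pi / e) ^+ n * expR (- ((la ^+ 2 * sqx v) / (4 * e ^+ 2)))).
  have fA w : f (A (r m) w) = (Num.sqrt pi / e) ^+ n * (k (A (r m) w) * expR (- sq w)).
    rewrite /f sqA (_ : la ^+ 2 * (r m ^+ 2 * sq w) / (4 * e ^+ 2) = sq w); first by ring.
    by rewrite /r -/e; field; rewrite e0 la0'.
  have mf : measurable_fun setT f.
    apply: measurable_funM => //; apply: measurable_funM => //; apply: measurableT_comp => //.
    apply: measurable_funN.
    by apply: measurable_funM => //; exact: measurable_funM.
  have ik1 : rintegrable mu (fun w => k (A (r m) w) * expR (- sq w)).
    refine (rintegrable_le _ (_ : forall w, _ <= M * expR (- sq w)) (rintegrableZ M i1)).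
      apply: measurable_funM; last exact: rintegrable_measurable i1.
      exact: (measurableT_comp mk (mA m)).
    by move=> w; rewrite normrM (ger0_norm (expR_ge0 _)) ler_wpM2r ?expR_ge0.
  have ifA : rintegrable mu (f \o A (r m)).
    have := rintegrableZ ((Num.sqrt pi / e) ^+ n) ik1.
    by apply: eq_ind; congr rintegrable; apply/funext => w /=; rewrite fA.
  have rn0 : 0 < ((r m)^-1) ^+ n by rewrite exprn_gt0// invr_gt0.
  have iff := scales_rintegrable (sA _ (r0 m)) rn0 mf ifA.
  have H := (scales_Rintegral (sA _ (r0 m)) iff).2.
  transitivity (r m ^+ n * \int[mu]_w f (A (r m) w)).
    by rewrite H mulrA -exprMn divff ?expr1n ?mul1r// gt_eqF.
  under eq_Rintegral do rewrite fA.
  rewrite RintegralZl// mulrA -exprMn; congr (_ ^+ n * _).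
  by rewrite /r -/e; field; rewrite e0 la0'.
under eq_fun do rewrite E.
have -> : (2 * pi / la) ^+ n * k0 = (2 * Num.sqrt pi / la) ^+ n * \int[mu]_w (k0 * expR (- sq w)).
  rewrite RintegralZl//.
  have -> : \int[mu]_w expR (- sq w) = Num.sqrt pi ^+ n.
    have := ek 1 0 v0 ltr01; rewrite sq0 !mul0r oppr0 expR0 cos0 mul1r mulr1 divr1 => <-.
    by apply: eq_Rintegral => w _; rewrite dot0 addr0 cos0 mulr1 expr1n mul1r.
  rewrite mulrCA -exprMn mulrC; congr (_ * _ ^+ n).
  rewrite -[in LHS](sqr_sqrtr (pi_ge0 R)); field; exact: la0'.
apply: cvgMr.
apply: (dominated_cvg_Rintegral (g := fun w => M * expR (- sq w))).
- move=> m; apply: measurable_funM; last exact: rintegrable_measurable i1.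
  exact: (measurableT_comp mk (mA m)).
- by move=> w; apply: cvgMl; apply: kA.
- by move=> m w; rewrite normrM (ger0_norm (expR_ge0 _)) ler_wpM2r ?expR_ge0.
- exact: rintegrableZ.
Qed.

End gaussian_limit.

(** * Gaussian kernels, dilations and weights on R^2, R^3, R^4 and R^7 *)

Section euclidean_spaces.
Context (R : realType).
Local Notation mR := (measurableTypeR R).

Lemma idotE (s t : imquat R) :
  idot s t = s.1.1 * t.1.1 + s.1.2 * t.1.2 + s.2 * t.2.
Proof. by case: s => [[s1 s2] s3]; case: t => [[t1 t2] t3]; rewrite /idot /qdot/=; ring. Qed.

Lemma qdotE (p q : quat R) :
  qdot p q = p.1.1.1 * q.1.1.1 + p.1.1.2 * q.1.1.2 + p.1.2 * q.1.2 + p.2 * q.2.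
Proof. by case: p => [[[p1 p2] p3] p4]; case: q => [[[q1 q2] q3] q4]; rewrite /qdot/=; ring. Qed.

Lemma qdot_ge0 (p : quat R) : 0 <= qdot p p.
Proof. by rewrite qdotE -!expr2 !addr_ge0// sqr_ge0. Qed.

Lemma idot_ge0 (p : imquat R) : 0 <= idot p p.
Proof. exact: qdot_ge0. Qed.

Let lebR : {sigma_finite_measure set mR -> \bar R} := @lebesgue_measure R.

Lemma gaussian_kernel_leb2 :
  gaussian_kernel (leb2 R) (fun z => z.1 ^+ 2 + z.2 ^+ 2)
    (fun z w => z.1 * w.1 + z.2 * w.2) 2.
Proof.
exact: (@gaussian_kernel_prod R _ _ _ _ lebR lebR _ _ _ _ _ _
  (gaussian_kernel_lebesgue R) (gaussian_kernel_lebesgue R)).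
Qed.

Lemma gaussian_kernel_imquat :
  gaussian_kernel (imquat_leb R) (fun t => idot t t) (@idot R) 3.
Proof.
have := @gaussian_kernel_prod R _ _ _ _ (leb2 R) lebR _ _ _ _ _ _
  gaussian_kernel_leb2 (gaussian_kernel_lebesgue R).
have -> : (fun t => idot t t) = (fun t : imquat R => t.1.1 ^+ 2 + t.1.2 ^+ 2 + t.2 ^+ 2).
  by apply/funext => t; rewrite idotE.
have -> : @idot R = (fun s t => s.1.1 * t.1.1 + s.1.2 * t.1.2 + s.2 * t.2).
  by apply/funext => s; apply/funext => t; rewrite idotE.
exact.
Qed.

Lemma gaussian_kernel_quat :
  gaussian_kernel (quat_leb R) (fun p => qdot p p) (@qdot R) 4.
Proof.
have := @gaussian_kernel_prod R _ _ _ _ (imquat_leb R) lebR _ _ _ _ _ _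
  gaussian_kernel_imquat (gaussian_kernel_lebesgue R).
have -> : (fun t => qdot t t) = (fun t : quat R => idot t.1 t.1 + t.2 ^+ 2).
  by apply/funext => t; rewrite idotE qdotE.
have -> : @qdot R = (fun s t => idot s.1 t.1 + s.2 * t.2).
  by apply/funext => s; apply/funext => t; rewrite qdotE idotE.
exact.
Qed.

Lemma scales_leb_prod d (T : measurableType d) (mu : {sigma_finite_measure set T -> \bar R})
    (phi : T -> T) c (v r : R) : 0 < r -> scales_measure mu phi c ->
  scales_measure (mu \x lebR)%E (fun z => (phi z.1, v + r * z.2)) (c * r^-1).
Proof.
move=> r0 sphi.
have r0' : 0 <= r^-1 by rewrite invr_ge0 ltW.
have m2 : measurable_fun setT (fun z : T * mR => v + r * z.2).
  by apply: measurable_funD => //; apply: measurable_funM => //; exact: measurable_snd.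
exact: (@scales_prod R _ _ _ _ mu lebR phi (fun=> (fun x : R => v + r * x)) c _ r0' sphi
  (fun _ => scales_lebesgue v r0) m2).
Qed.

Lemma scales_leb2 (v : R * R) (r : R) : 0 < r ->
  scales_measure (leb2 R) (fun t : R * R => v + r *: t) (r^-1 ^+ 2).
Proof.
move=> r0; case: v => [v1 v2].
exact: (@scales_leb_prod _ _ lebR _ _ v2 r r0 (scales_lebesgue v1 r0)).
Qed.

Lemma scales_imquat (v : imquat R) (r : R) : 0 < r ->
  scales_measure (imquat_leb R) (fun t : imquat R => v + r *: t) (r^-1 ^+ 3).
Proof.
move=> r0; case: v => [v v3]; rewrite exprSr.
exact: (@scales_leb_prod _ _ (leb2 R) _ _ v3 r r0 (scales_leb2 v r0)).
Qed.

Lemma scales_quat (v : quat R) (r : R) : 0 < r ->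
  scales_measure (quat_leb R) (fun t : quat R => v + r *: t) (r^-1 ^+ 4).
Proof.
move=> r0; case: v => [v v4]; rewrite exprSr.
exact: (@scales_leb_prod _ _ (imquat_leb R) _ _ v4 r r0 (scales_imquat v r0)).
Qed.

Lemma scales_imquatD (v : imquat R) :
  scales_measure (imquat_leb R) (fun t : imquat R => v + t) 1.
Proof.
have := scales_imquat v ltr01; rewrite invr1 expr1n.
by under eq_fun do rewrite scale1r.
Qed.

Lemma scales_quatD (v : quat R) :
  scales_measure (quat_leb R) (fun t : quat R => v + t) 1.
Proof.
have := scales_quat v ltr01; rewrite invr1 expr1n.
by under eq_fun do rewrite scale1r.
Qed.

(** A constant [w] gives the translations; [w] linear in y gives the shear t |-> t - twist y x
    behind the Radon transform. *)
Lemma scales_heis (v : heis R) (w : quat R -> imquat R) : continuous w ->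
  scales_measure (heis_leb R) (fun z : heis R => (v.1 + z.1, w z.1 + z.2)) 1.
Proof.
move=> cw.
have mw : @measurable_fun _ _ (mR * mR * mR * mR * (mR * mR * mR))%type
    (mR * mR * mR)%type setT (fun z : heis R => w z.1 + z.2).
  have c (f : imquat R -> R) : continuous f ->
    @measurable_fun _ _ (mR * mR * mR * mR * (mR * mR * mR))%type R setT
      (fun z : heis R => f (w z.1 + z.2)).
    move=> cf; suff cg : continuous (fun z : heis R => f (w z.1 + z.2)).
      exact: (continuous_measurable_heis cg).
    apply: continuous_comp2 cf => z.
    apply: cvgD; last exact: cvg_snd.
    by apply: (@cvg_comp _ _ _ fst w); [exact: cvg_fst|exact: cw].
  apply/measurable_fun_pair; last exact: (c snd (fun _ => cvg_snd)).
  apply/measurable_fun_pair.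
    by apply: (c (fun t => t.1.1)); apply: continuous_comp2 (fun _ => cvg_fst) (fun _ => cvg_fst).
  by apply: (c (fun t => t.1.2)); apply: continuous_comp2 (fun _ => cvg_fst) (fun _ => cvg_snd).
have := @scales_prod R _ _ _ _ (quat_leb R) (imquat_leb R) _ (fun x (t : imquat R) => w x + t)
  1 1 ler01 (scales_quatD v.1) (fun x => scales_imquatD (w x)) mw.
by rewrite mulr1.
Qed.

Definition wt3 (t : imquat R) : R := wt1 t.1.1 * wt1 t.1.2 * wt1 t.2.
Definition wt4 (x : quat R) : R := wt1 x.1.1.1 * wt1 x.1.1.2 * wt1 x.1.2 * wt1 x.2.
Definition wt7 (z : heis R) : R := wt4 z.1 * wt3 z.2.

Lemma rintegrable_wt3 : rintegrable (imquat_leb R) wt3.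
Proof.
have i1 := @rintegrable_wt1 R.
exact: (@rintegrable_prod R _ _ _ _ (leb2 R) lebR _ _ (@rintegrable_prod R _ _ _ _ lebR lebR _ _ i1 i1) i1).
Qed.

Lemma rintegrable_wt4 : rintegrable (quat_leb R) wt4.
Proof. exact: (@rintegrable_prod R _ _ _ _ (imquat_leb R) lebR _ _ rintegrable_wt3 (@rintegrable_wt1 R)). Qed.

Lemma rintegrable_wt7 : rintegrable (heis_leb R) wt7.
Proof. exact: (@rintegrable_prod R _ _ _ _ (quat_leb R) (imquat_leb R) _ _ rintegrable_wt4 rintegrable_wt3). Qed.

End euclidean_spaces.

(** * Real Schwartz functions *)

Section coordinates.
Context (R : realType).
Implicit Types (z v : heis R) (f g : heis R -> R) (i j : 'I_7).

Lemma hcoordE z i : hcoord z i =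
  [:: z.1.1.1.1; z.1.1.1.2; z.1.1.2; z.1.2; z.2.1.1; z.2.1.2; z.2.2]`_i.
Proof. by case: z => [[[[? ?] ?] ?] [[? ?] ?]]. Qed.

Lemma hcoord_line z v i h : hcoord (h *: v + z) i = hcoord z i + h * hcoord v i.
Proof.
rewrite !hcoordE; case: i => -[|[|[|[|[|[|[|k]]]]]]] //= _; exact: addrC.
Qed.

Lemma hcoord_basis i j : hcoord (hbasis R i) j = (i == j)%:R.
Proof. by rewrite hcoordE; case: j => -[|[|[|[|[|[|[|k]]]]]]]. Qed.

Lemma continuous_hcoord i : continuous (fun z => hcoord z i).
Proof.
have c1 (U V : topologicalType) (h : heis R -> U * V) :
  continuous h -> continuous (fun z => (h z).1).
  by move=> ch; apply: continuous_comp2 ch _ => ?; exact: cvg_fst.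
have c2 (U V : topologicalType) (h : heis R -> U * V) :
  continuous h -> continuous (fun z => (h z).2).
  by move=> ch; apply: continuous_comp2 ch _ => ?; exact: cvg_snd.
have c0 : continuous (fun z : heis R => z) by move=> ?; exact: cvg_id.
under eq_fun do rewrite hcoordE.
case: i => -[|[|[|[|[|[|[|k]]]]]]] //= _.
- exact/c1/c1/c1/c1.
- exact/c2/c1/c1/c1.
- exact/c2/c1/c1.
- exact/c2/c1.
- exact/c1/c1/c2.
- exact/c2/c1/c2.
- exact/c2/c2.
Qed.

Lemma is_derive_hcoord z i j :
  is_derive z (hbasis R i) (fun z => hcoord z j) (i == j)%:R.
Proof.
apply: line_is_derive; under eq_fun do rewrite hcoord_line.
by rewrite -hcoord_basis; exact: is_derive_affine.
Qed.

End coordinates.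

Section schwartz_real.
Context (R : realType).
Implicit Types (z v : heis R) (f g : heis R -> R) (i j : 'I_7).

Definition hD i f : heis R -> R := fun z => 'D_(hbasis R i) f z.

Definition rapid f := forall al : 'I_7 -> nat, exists M : R, forall z,
  `|hmonom al z * f z| <= M.

Definition rschwartz f := smooth f /\ forall l, rapid (pderiv l f).

Lemma rapidD f g : rapid f -> rapid g -> rapid (fun z => f z + g z).
Proof.
move=> rf rg al; have [M HM] := rf al; have [N HN] := rg al.
by exists (M + N) => z; rewrite mulrDr (le_trans (ler_normD _ _))// lerD.
Qed.

Lemma rapidZ c f : rapid f -> rapid (fun z => c * f z).
Proof.
move=> rf al; have [M HM] := rf al.
by exists (`|c| * M) => z; rewrite mulrCA normrM ler_wpM2l.
Qed.

Lemma rapid_hcoord i f : rapid f -> rapid (fun z => hcoord z i * f z).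
Proof.
move=> rf al; have [M HM] := rf (fun j => al j + (j == i))%N.
exists M => z; rewrite mulrA (_ : hmonom al z * hcoord z i = hmonom (fun j => al j + (j == i))%N z)//.
rewrite /hmonom; under [RHS]eq_bigr do rewrite exprD.
rewrite big_split/=; congr (_ * _).
rewrite (bigD1 i)//= eqxx expr1 big1 ?mulr1// => j /negPf ->.
by rewrite expr0.
Qed.

Lemma rapid_hcoord_sqr i f : rapid f -> rapid (fun z => (1 + hcoord z i ^+ 2) * f z).
Proof.
move=> rf; have := rapidD rf (rapid_hcoord i (rapid_hcoord i rf)).
by congr rapid; apply/funext => z; ring.
Qed.

Lemma rapid_bounded f : rapid f -> exists M, forall z, `|f z| <= M.
Proof.
move=> rf; have [M HM] := rf (fun=> 0%N); exists M => z.
by have := HM z; rewrite /hmonom big1 ?mul1r.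
Qed.

Lemma wt7_gt0 z : 0 < wt7 z.
Proof. by rewrite /wt7 /wt4 /wt3 !mulr_gt0// wt1_gt0. Qed.

(** Rapid decay bounds f times the seven factors 1 + z_i^2, whose product is the inverse of
    [wt7]. *)
Lemma rapid_wt7 f : rapid f -> exists M, forall z, `|f z| <= M * wt7 z.
Proof.
move=> rf.
have := rapid_bounded (rapid_hcoord_sqr ord0 (rapid_hcoord_sqr 1 (rapid_hcoord_sqr 2
  (rapid_hcoord_sqr 3 (rapid_hcoord_sqr 4 (rapid_hcoord_sqr 5 (rapid_hcoord_sqr 6 rf))))))).
move=> [M HM]; exists M => z.
have w0 (x : R) : 1 + x ^+ 2 != 0 by rewrite gt_eqF// ltr_pwDl// sqr_ge0.
have E : f z = wt7 z * ((1 + hcoord z ord0 ^+ 2) * ((1 + hcoord z 1 ^+ 2) *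
  ((1 + hcoord z 2 ^+ 2) * ((1 + hcoord z 3 ^+ 2) * ((1 + hcoord z 4 ^+ 2) *
  ((1 + hcoord z 5 ^+ 2) * ((1 + hcoord z 6 ^+ 2) * f z))))))).
  rewrite !hcoordE/= /wt7 /wt4 /wt3 /wt1; field.
  by rewrite !w0.
rewrite {1}E normrM (ger0_norm (ltW (wt7_gt0 z))) mulrC ler_wpM2r ?(ltW (wt7_gt0 z))//.
Qed.

(** The module generated by [P] over polynomials in the seven coordinates: differentiating natural
    classes of functions produces polynomial coefficients. *)
Inductive hspan (P : (heis R -> R) -> Prop) : (heis R -> R) -> Prop :=
| hspan_base f : P f -> hspan P f
| hspanD f g : hspan P f -> hspan P g -> hspan P (fun z => f z + g z)
| hspanZ c f : hspan P f -> hspan P (fun z => c * f z)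
| hspan_hcoord i f : hspan P f -> hspan P (fun z => hcoord z i * f z).

(** Coinduction: a class stable under partial derivatives contains all iterated derivatives of its
    members, by induction on the list of directions. *)
Lemma rschwartz_coind (P : (heis R -> R) -> Prop) :
  (forall f, P f -> [/\ continuous f, forall i z, derivable f z (hbasis R i),
    forall i, P (hD i f) & rapid f]) ->
  forall f, P f -> rschwartz f.
Proof.
move=> HP f Pf.
have Pl l : P (pderiv l f) by elim: l => //= i l /HP[_ _ + _]; exact.
split=> l; last by have [] := HP _ (Pl l).
by have [] := HP _ (Pl l).
Qed.

Lemma rschwartz_continuous f : rschwartz f -> continuous f.
Proof. by move=> [sf _]; have [] := sf [::]. Qed.

Lemma rschwartz_derivable f i z : rschwartz f -> derivable f z (hbasis R i).
Proof. by move=> [sf _]; have [] := sf [::]. Qed.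

Lemma rschwartz_is_derive f i z : rschwartz f -> is_derive z (hbasis R i) f (hD i f z).
Proof. by move=> sf; apply/derivableP; exact: rschwartz_derivable. Qed.

Lemma rschwartz_rapid f : rschwartz f -> rapid f.
Proof. by move=> [_ rf]; exact: (rf [::]). Qed.

Lemma pderiv_rcons l i f : pderiv (rcons l i) f = pderiv l (hD i f).
Proof. by rewrite /pderiv foldr_rcons. Qed.

Lemma rschwartz_hD f i : rschwartz f -> rschwartz (hD i f).
Proof. by move=> [sf rf]; split=> l; rewrite -pderiv_rcons; [exact: sf|exact: rf]. Qed.

Lemma hD_eq i f df : (forall z, is_derive z (hbasis R i) f (df z)) -> hD i f = df.
Proof. by move=> H; apply/funext => z; have [] := H z. Qed.

(** Coinduction up to [hspan]. The Leibniz rule for a coordinate times f keeps the span stable as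
    soon as the derivatives of [P] fall into it. It is applied to the Schwartz functions themselves
    and to Radon transforms. *)
Lemma rschwartz_span (P : (heis R -> R) -> Prop) :
  (forall f, P f -> [/\ continuous f, forall i z, derivable f z (hbasis R i),
    forall i, hspan P (hD i f) & rapid f]) ->
  forall f, hspan P f -> rschwartz f.
Proof.
move=> HP; apply: rschwartz_coind => f; elim => {f}.
- by move=> f /HP[].
- move=> f g Pf [cf df Df rf] Pg [cg dg Dg rg].
  have E i z : is_derive z (hbasis R i) (fun z => f z + g z) (hD i f z + hD i g z).
    by apply: is_derive_add; exact/derivableP.
  split.
  + by move=> z; apply: cvgD; [exact: cf|exact: cg].
  + by move=> i z; have [] := E i z.
  + by move=> i; rewrite (hD_eq (E i)); exact: hspanD.
  + exact: rapidD.
- move=> c f Pf [cf df Df rf].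
  have E i z : is_derive z (hbasis R i) (fun z => c * f z) (c * hD i f z).
    by apply: is_derive_mulZ; exact/derivableP.
  split.
  + by move=> z; apply: cvgM; [exact: cvg_cst|exact: cf].
  + by move=> i z; have [] := E i z.
  + by move=> i; rewrite (hD_eq (E i)); exact: hspanZ.
  + exact: rapidZ.
- move=> j f Pf [cf df Df rf].
  have E i z : is_derive z (hbasis R i) (fun z => hcoord z j * f z) ((i == j)%:R * f z + hcoord z j * hD i f z).
    by apply: is_derive_mul; [exact: is_derive_hcoord|exact/derivableP].
  split.
  + by move=> z; apply: cvgM; [exact: continuous_hcoord|exact: cf].
  + by move=> i z; have [] := E i z.
  + move=> i; rewrite (hD_eq (E i)); apply: hspanD; first exact: hspanZ.
    exact: hspan_hcoord.
  + exact: rapid_hcoord.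
Qed.

Lemma hspan_rschwartz f : hspan rschwartz f -> rschwartz f.
Proof.
apply: rschwartz_span => {}f sf; split.
- exact: rschwartz_continuous.
- by move=> i z; exact: rschwartz_derivable.
- by move=> i; apply: hspan_base; exact: rschwartz_hD.
- exact: rschwartz_rapid.
Qed.

Lemma rschwartzD f g : rschwartz f -> rschwartz g -> rschwartz (fun z => f z + g z).
Proof. by move=> sf sg; apply: hspan_rschwartz; apply: hspanD; exact: hspan_base. Qed.

Lemma rschwartzZ c f : rschwartz f -> rschwartz (fun z => c * f z).
Proof. by move=> sf; apply: hspan_rschwartz; apply: hspanZ; exact: hspan_base. Qed.

Lemma rschwartz_hcoord i f : rschwartz f -> rschwartz (fun z => hcoord z i * f z).
Proof. by move=> sf; apply: hspan_rschwartz; apply: hspan_hcoord; exact: hspan_base. Qed.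

End schwartz_real.

(** * Derivatives along arbitrary directions *)

Section directional.
Context (R : realType) (V : normedModType R).
Implicit Types (f : V -> R) (z u w : V).

Lemma is_derive_along f z v (h : R) df : is_derive (h *: v + z) v f df ->
  is_derive h (1 : R) (fun h : R => f (h *: v + z)) df.
Proof.
move=> /is_derive_line H; apply: line_is_derive.
move: H; congr (is_derive _ _ _ _); apply/funext => k.
by rewrite addrA -scalerDl /GRing.scale/= mulr1.
Qed.

Lemma mvt_line f u (fu : V -> R) z (h : R) : (forall z, is_derive z u f (fu z)) ->
  exists2 x : R, `|x| <= `|h| & f (h *: u + z) - f z = fu (x *: u + z) * h.
Proof.
move=> df.
have dg (x : R) : is_derive x (1 : R) (fun x : R => f (x *: u + z)) (fu (x *: u + z)).
  by apply: is_derive_along; exact: df.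
have cg A : {within A, continuous (fun x : R => f (x *: u + z))}.
  apply: continuous_subspaceT => x; apply/differentiable_continuous/derivable1_diffP.
  by have [] := dg x.
have [h0|h0] := leP 0 h.
  have [c] := @MVT_segment R _ _ 0 h h0 (fun x _ => dg x) (cg _).
  rewrite in_itv/= scale0r add0r subr0 => /andP[c0 ch] E; exists c => //.
  by rewrite !ger0_norm.
have [c] := @MVT_segment R _ _ h 0 (ltW h0) (fun x _ => dg x) (cg _).
rewrite in_itv/= scale0r add0r sub0r => /andP[c0 ch] E; exists c => //.
  by rewrite !ler0_norm ?lerN2// ltW.
by rewrite -opprB E mulrN opprK.
Qed.

Lemma is_derive_dirZ f u c z df : is_derive z u f df -> is_derive z (c *: u) f (c * df).
Proof.
move=> H; apply: line_is_derive.
have d1 : is_derive (0 : R) (1 : R) (fun h : R => h * c) c.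
  by have := is_derive_affine 0 c 0; under eq_fun do rewrite add0r.
have d2 : is_derive (0 * c) (1 : R) (fun h : R => f (h *: u + z)) df.
  by rewrite mul0r; exact: is_derive_line.
have := is_derive_comp1 d1 d2; rewrite mulrC.
by congr (is_derive _ _ _ _); apply/funext => h; rewrite scalerA.
Qed.

(** Only directional derivatives are at hand, not a differential. The increment along u + w is cut
    at h w + z; the mean value theorem on the u-part gives a value of [fu] at a point tending to z,
    where continuity of [fu] applies. *)
Lemma is_derive_dirD f u w (fu : V -> R) z df : (forall z, is_derive z u f (fu z)) ->
  continuous fu -> is_derive z w f df -> is_derive z (u + w) f (fu z + df).
Proof.
move=> du cfu dw; apply: line_is_derive.
have key : (fun h : R => h^-1 *: (f ((h + 0) *: (u + w) + z) - f (0 *: (u + w) + z))) @ 0^' --> fu z + df.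
  have -> : (fun h : R => h^-1 *: (f ((h + 0) *: (u + w) + z) - f (0 *: (u + w) + z))) =
    (fun h : R => h^-1 *: (f (h *: u + (h *: w + z)) - f (h *: w + z)) +
     h^-1 *: (f (h *: w + z) - f z)).
    apply/funext => h; rewrite addr0 scale0r add0r -scalerDr; congr (_ *: _).
    by rewrite scalerDr -(addrA (h *: u)) [RHS]addrA subrK.
  apply: cvgD; last first.
    by have [/[dup] H _ <-] := dw; exact: H.
  apply/cvgrPdist_lt => e e0.
  have /cvgrPdist_lt/(_ e e0) := cfu z.
  move=> /nbhs_ballP[d /= d0 Hd].
  near=> h.
  have h0 : h != 0 by near: h; exact: nbhs_dnbhs_neq.
  have [x xh ->] := mvt_line (h *: w + z) h du.
  rewrite /GRing.scale/= mulrC mulfK//; apply: Hd.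
  rewrite -ball_normE /= distrC addrA addrK.
  apply: le_lt_trans (ler_normD _ _) _; rewrite !normrZ.
  apply: (@le_lt_trans _ _ (`|h| * (`|u| + `|w| + 1))).
    have := normr_ge0 u; have := normr_ge0 w; have := normr_ge0 h; nra.
  rewrite -ltr_pdivlMr; last by rewrite ltr_wpDl// addr_ge0.
  near: h; apply: dnbhs0_lt; rewrite divr_gt0// ltr_wpDl// addr_ge0//.
have E : (fun h : R => h^-1 *: (((fun h : R => f (h *: (u + w) + z)) \o shift 0) h%:A -
    f ((0 : R) *: (u + w) + z))) = (fun h : R => h^-1 *: (f ((h + 0) *: (u + w) + z) - f (0 *: (u + w) + z))).
  by apply/funext => h /=; rewrite [_%:A]mulr1.
apply: DeriveDef; first by apply/cvg_ex; exists (fu z + df); rewrite E; exact: key.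
by apply: cvg_lim => //; rewrite E; exact: key.
Unshelve. all: by end_near.
Qed.

End directional.

Section continuity_lemmas.
Context (R : realType) (U : topologicalType).
Implicit Types f g : U -> R.

Lemma continuousD' f g : continuous f -> continuous g -> continuous (fun x => f x + g x).
Proof. by move=> cf cg x; apply: cvgD; [exact: cf|exact: cg]. Qed.

Lemma continuousN' f : continuous f -> continuous (fun x => - f x).
Proof. by move=> cf x; apply: cvgN; exact: cf. Qed.

Lemma continuousM' f g : continuous f -> continuous g -> continuous (fun x => f x * g x).
Proof. by move=> cf cg x; apply: cvgM; [exact: cf|exact: cg]. Qed.

Lemma continuous_cst' (W : topologicalType) (c : W) : continuous (fun _ : U => c).
Proof. by move=> x; exact: cvg_cst. Qed.

Lemma continuous_fst' (V W : topologicalType) (h : U -> V * W) :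
  continuous h -> continuous (fun z => (h z).1).
Proof. by move=> ch; apply: continuous_comp2 ch _ => ?; exact: cvg_fst. Qed.

Lemma continuous_snd' (V W : topologicalType) (h : U -> V * W) :
  continuous h -> continuous (fun z => (h z).2).
Proof. by move=> ch; apply: continuous_comp2 ch _ => ?; exact: cvg_snd. Qed.

End continuity_lemmas.

Lemma continuous_id' (U : topologicalType) : continuous (fun x : U => x).
Proof. by move=> x; exact: cvg_id. Qed.

Ltac continuity := repeat first
  [ exact: continuous_id' | exact: continuous_cst' | assumption
  | apply: continuous_pair | apply: continuousD' | apply: continuousM'
  | apply: continuousN' | apply: continuous_fst' | apply: continuous_snd' ].

Arguments hcoord : simpl never.

(** * Integrals in t and vanishing moments *)

Section vanishing_moments.
Context (R : realType).
Implicit Types (z : heis R) (f g : heis R -> R) (i : 'I_7) (l k : 'I_3) (j : 'I_4).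

Definition ti l : 'I_7 := rshift 4 l.
Definition xi j : 'I_7 := lshift 3 j.

Lemma hbasis_ti l : (hbasis R (ti l)).1 = 0.
Proof. by rewrite /hbasis/= /ti/=; case: l => -[|[|[|k]]]. Qed.

Lemma hbasis_xi j : (hbasis R (xi j)).2 = 0.
Proof. by rewrite /hbasis/= /xi/=; case: j => -[|[|[|[|k]]]]. Qed.

Lemma heis_lineE (h : R) (v z : heis R) : h *: v + z = (h *: v.1 + z.1, h *: v.2 + z.2).
Proof. by []. Qed.

Lemma wt1_le1 (x : R) : wt1 x <= 1.
Proof. by rewrite invf_le1 ?lerDl ?sqr_ge0// ltr_pwDl// sqr_ge0. Qed.

Lemma wt1_ge0 (x : R) : 0 <= wt1 x.
Proof. by rewrite ltW// wt1_gt0. Qed.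

Lemma wt3_ge0 (t : imquat R) : 0 <= wt3 t.
Proof. by rewrite /wt3 !mulr_ge0// wt1_ge0. Qed.

Lemma wt4_ge0 (x : quat R) : 0 <= wt4 x.
Proof. by rewrite /wt4 !mulr_ge0// wt1_ge0. Qed.

Lemma wt3_le1 (t : imquat R) : wt3 t <= 1.
Proof.
by rewrite /wt3 !mulr_ile1 ?mulr_ge0 ?wt1_ge0 ?wt1_le1.
Qed.

Lemma wt4_le1 (x : quat R) : wt4 x <= 1.
Proof.
by rewrite /wt4 !mulr_ile1 ?mulr_ge0 ?wt1_ge0 ?wt1_le1.
Qed.

Lemma wt7E z : wt7 z = \prod_(i < 7) wt1 (hcoord z i).
Proof.
rewrite !big_ord_recl big_ord0 !hcoordE/= /wt7 /wt4 /wt3; ring.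
Qed.

Lemma wt7_shift (h : R) i z : `|h| <= 1 -> wt7 (h *: hbasis R i + z) <= 3 * wt7 z.
Proof.
move=> h1; rewrite !wt7E (bigD1 i)//= [in leRHS](bigD1 i)//= mulrA.
under eq_bigr => k /= ki do rewrite hcoord_line hcoord_basis eq_sym (negPf ki) mulr0 addr0.
rewrite ler_wpM2r//; first by apply: prodr_ge0 => k _; exact: wt1_ge0.
rewrite hcoord_line hcoord_basis eqxx mulr1 addrC; exact: wt1_shift.
Qed.

Lemma measurable_imquat (f : imquat R -> R) : continuous f ->
  @measurable_fun _ _ (measurableTypeR R * measurableTypeR R * measurableTypeR R)%type R setT f.
Proof. by move=> cf; exact: (continuous_measurable_imquat cf). Qed.

Lemma measurable_quat (f : quat R -> R) : continuous f ->
  @measurable_fun _ _ (measurableTypeR R * measurableTypeR R * measurableTypeR R * measurableTypeR R)%type R setT f.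
Proof. by move=> cf; exact: (continuous_measurable_quat cf). Qed.

Lemma measurable_heis (f : heis R -> R) : continuous f ->
  @measurable_fun _ _ (measurableTypeR R * measurableTypeR R * measurableTypeR R * measurableTypeR R * (measurableTypeR R * measurableTypeR R * measurableTypeR R))%type R setT f.
Proof. by move=> cf; exact: (continuous_measurable_heis cf). Qed.

Lemma rschwartz_slice f (x : quat R) : rschwartz f ->
  rintegrable (imquat_leb R) (fun t => f (x, t)).
Proof.
move=> sf; have [M HM] := rapid_wt7 (rschwartz_rapid sf).
have M0 : 0 <= M.
  by have := le_trans (normr_ge0 _) (HM 0); rewrite pmulr_lge0// wt7_gt0.
refine (@rintegrable_le _ _ _ _ _ _ _ _ (rintegrableZ M (rintegrable_wt3 R))).
  apply: measurable_imquat; apply: continuous_comp2 (rschwartz_continuous sf); continuity.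
move=> t; apply: (le_trans (HM _)); rewrite ler_wpM2l// /wt7/=.
by rewrite ler_piMl ?wt3_ge0 ?wt4_le1.
Qed.

(** Translation invariance in t, through [Rintegral_derivative0]. *)
Lemma Rintegral_hD_t f (x : quat R) l : rschwartz f ->
  \int[imquat_leb R]_t hD (ti l) f (x, t) = 0.
Proof.
move=> sf; have sD := rschwartz_hD (ti l) sf.
have [M HM] := rapid_wt7 (rschwartz_rapid sD).
have M0 : 0 <= M.
  by have := le_trans (normr_ge0 _) (HM 0); rewrite pmulr_lge0// wt7_gt0.
pose e : imquat R := (hbasis R (ti l)).2.
have e0 : (hbasis R (ti l)).1 = 0.
  exact: hbasis_ti.
have eE h t : (x, h *: e + t) = h *: hbasis R (ti l) + (x, t) :> heis R.
  by rewrite heis_lineE e0 scaler0 add0r.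
pose tau (h : R) (t : imquat R) : imquat R := h *: e + t.
have stau h : scales_measure (imquat_leb R) (tau h) 1 by exact: scales_imquatD.
have tau0 t : tau 0 t = t by rewrite /tau scale0r add0r.
have dtau (h : R) (t : imquat R) :
    is_derive h (1 : R) (fun h => f (x, tau h t)) (hD (ti l) f (x, tau h t)).
  rewrite /tau eE; under eq_fun do rewrite eE.
  by apply: is_derive_along; exact: rschwartz_is_derive.
have bnd (h : R) (t : imquat R) : `|h| < 1 -> `|hD (ti l) f (x, tau h t)| <= (M * 3) * wt3 t.
  move=> h1; rewrite /tau eE; apply: (le_trans (HM _)); rewrite -mulrA ler_wpM2l//.
  apply: (le_trans (wt7_shift _ _ (ltW h1))); rewrite ler_wpM2l// /wt7/=.
  by rewrite ler_piMl ?wt3_ge0 ?wt4_le1.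
pose g (t : imquat R) := f (x, t); pose dg (t : imquat R) := hD (ti l) f (x, t).
have ig : rintegrable (imquat_leb R) g by exact: rschwartz_slice.
have H := @Rintegral_derivative0 R _ _ (imquat_leb R) tau g dg _ stau tau0 ig dtau bnd
  (rintegrableZ (M * 3) (rintegrable_wt3 R)).
by rewrite -[RHS]H.
Qed.

Definition null_integral f := forall x : quat R, \int[imquat_leb R]_t f (x, t) = 0.

(** The t-integral is identically 0 in x and may be differentiated under the integral sign. *)
Lemma null_integral_hD_x f j : rschwartz f -> null_integral f -> null_integral (hD (xi j) f).
Proof.
move=> sf nf x; have sD := rschwartz_hD (xi j) sf.
have [M HM] := rapid_wt7 (rschwartz_rapid sD).
have M0 : 0 <= M.
  by have := le_trans (normr_ge0 _) (HM 0); rewrite pmulr_lge0// wt7_gt0.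
pose e : quat R := (hbasis R (xi j)).1.
have e0 : (hbasis R (xi j)).2 = 0.
  exact: hbasis_xi.
have eE h t : (h *: e + x, t) = h *: hbasis R (xi j) + (x, t) :> heis R.
  by rewrite heis_lineE e0 scaler0 add0r.
have dtau (h : R) (t : imquat R) :
    is_derive h (1 : R) (fun h => f (h *: e + x, t)) (hD (xi j) f (h *: e + x, t)).
  rewrite eE; under eq_fun do rewrite eE.
  by apply: is_derive_along; exact: rschwartz_is_derive.
have bnd (h : R) (t : imquat R) : `|h - 0| < 1 -> `|hD (xi j) f (h *: e + x, t)| <= M * wt3 t.
  move=> _; apply: (le_trans (HM _)); rewrite ler_wpM2l// /wt7/=.
  by rewrite ler_piMl ?wt3_ge0 ?wt4_le1.
pose F (h : R) (t : imquat R) := f (h *: e + x, t).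
pose F' (h : R) (t : imquat R) := hD (xi j) f (h *: e + x, t).
have iF h : rintegrable (imquat_leb R) (F h) by exact: rschwartz_slice.
have := @is_derive_Rintegral R _ _ (imquat_leb R) F F' _ 0 iF dtau bnd (rintegrableZ M (rintegrable_wt3 R)).
have -> : (fun h => \int[imquat_leb R]_t F h t) = cst 0.
  by apply/funext => h; rewrite [LHS]nf.
case=> _; rewrite derive_cst => ->.
by apply: eq_Rintegral => t _; rewrite /F' scale0r add0r.
Qed.

End vanishing_moments.

Section rstar.
Context (R : realType).
Implicit Types (z : heis R) (f g : heis R -> R) (i : 'I_7) (l k : 'I_3) (j : 'I_4).

Fixpoint tmul (L : seq 'I_3) f : heis R -> R :=
  if L is l :: L' then tmul L' (fun z => hcoord z (ti l) * f z) else f.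

(* Indexing the moments by lists of coordinates instead of exponents lets
   the closure properties go by induction. *)
Definition rstar f := rschwartz f /\ forall L, null_integral (tmul L f).

Lemma tmulD L f g : tmul L (fun z => f z + g z) = (fun z => tmul L f z + tmul L g z).
Proof.
elim: L f g => //= l L IH f g; rewrite -IH; congr tmul; apply/funext => z.
by rewrite mulrDr.
Qed.

Lemma tmulM L (h : heis R -> R) f : tmul L (fun z => h z * f z) = (fun z => h z * tmul L f z).
Proof.
elim: L f => //= l L IH f; rewrite -IH; congr tmul; apply/funext => z.
by rewrite mulrCA.
Qed.

Lemma rschwartz_tmul L f : rschwartz f -> rschwartz (tmul L f).
Proof. by elim: L f => //= l L IH f sf; apply: IH; exact: rschwartz_hcoord. Qed.

Lemma rstar_rschwartz f : rstar f -> rschwartz f. Proof. by case. Qed.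

Lemma rstarD f g : rstar f -> rstar g -> rstar (fun z => f z + g z).
Proof.
move=> [sf nf] [sg ng]; split; first exact: rschwartzD.
move=> L x; rewrite tmulD.
rewrite (RintegralD measurableT (rschwartz_slice x (rschwartz_tmul L sf))
  (rschwartz_slice x (rschwartz_tmul L sg))).
by rewrite nf ng addr0.
Qed.

Lemma rstarZ c f : rstar f -> rstar (fun z => c * f z).
Proof.
move=> [sf nf]; split; first exact: rschwartzZ.
move=> L x; rewrite (tmulM L (fun=> c)).
by rewrite (RintegralZl _ measurableT (rschwartz_slice x (rschwartz_tmul L sf))) nf mulr0.
Qed.

Lemma rstar_t l f : rstar f -> rstar (fun z => hcoord z (ti l) * f z).
Proof.
move=> [sf nf]; split; first exact: rschwartz_hcoord.
by move=> L; exact: (nf (l :: L)).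
Qed.

Lemma hcoord_xi j z : hcoord z (xi j) = hcoord (z.1, 0) (xi j).
Proof. by rewrite !hcoordE; case: j => -[|[|[|[|k]]]]. Qed.

Lemma hcoord_ti l z : hcoord z (ti l) = hcoord (0, z.2) (ti l).
Proof. by rewrite !hcoordE; case: l => -[|[|[|k]]]. Qed.

Lemma rstar_x j f : rstar f -> rstar (fun z => hcoord z (xi j) * f z).
Proof.
move=> [sf nf]; split; first exact: rschwartz_hcoord.
move=> L x; rewrite (tmulM L (fun z => hcoord z (xi j))).
under eq_Rintegral do rewrite hcoord_xi.
by rewrite (RintegralZl _ measurableT (rschwartz_slice x (rschwartz_tmul L sf))) nf mulr0.
Qed.

Lemma rstar_hcoord i f : rstar f -> rstar (fun z => hcoord z i * f z).
Proof.
move=> sf; case: (@split_ordP 4 3 i) => [j|l] ->; [exact: rstar_x|exact: rstar_t].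
Qed.

Lemma hD_hcoord i (k : 'I_7) f : rschwartz f ->
  hD i (fun z => hcoord z k * f z) = (fun z => (i == k)%:R * f z + hcoord z k * hD i f z).
Proof.
move=> sf; apply: hD_eq => z.
by apply: is_derive_mul; [exact: is_derive_hcoord|exact: rschwartz_is_derive].
Qed.

Lemma rstar_hD_x j f : rstar f -> rstar (hD (xi j) f).
Proof.
move=> [sf nf]; split; first exact: rschwartz_hD.
move=> L; have -> : tmul L (hD (xi j) f) = hD (xi j) (tmul L f).
  elim: L f sf {nf} => //= l L IH f sf; rewrite -IH; last exact: rschwartz_hcoord.
  congr tmul; rewrite hD_hcoord//; apply/funext => z.
  by have -> : (xi j == ti l) = false; [exact: eq_lrshift|rewrite mul0r add0r].
by apply: null_integral_hD_x; [exact: rschwartz_tmul|exact: nf].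
Qed.

(** Induction on the moment list through t_k d_l f = d_l (t_k f) - delta_kl f. The first term is a
    derivative of a function with vanishing moments and a shorter list, the second is a multiple of
    f. *)
Lemma rstar_hD_t l f : rstar f -> rstar (hD (ti l) f).
Proof.
move=> rf; split; first exact: rschwartz_hD (rstar_rschwartz rf).
move=> L; elim: L f rf => [|k L IH] f rf.
  by move=> x; apply: Rintegral_hD_t; exact: rstar_rschwartz.
move=> x /=; have rkf := rstar_t k rf.
have -> : (fun z => hcoord z (ti k) * hD (ti l) f z) =
    (fun z => hD (ti l) (fun z => hcoord z (ti k) * f z) z + - (ti l == ti k)%:R * f z).
  apply/funext => z; rewrite hD_hcoord; last exact: rstar_rschwartz.
  ring.
have := (rstarZ (- (ti l == ti k)%:R) rf).2 L x.
have s1 := rschwartz_tmul L (rschwartz_hD (ti l) (rstar_rschwartz rkf)).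
have s2 := rschwartz_tmul L (rstar_rschwartz (rstarZ (- (ti l == ti k)%:R) rf)).
rewrite tmulD (RintegralD measurableT (rschwartz_slice x s1) (rschwartz_slice x s2)).
by rewrite (IH _ rkf x) => ->; rewrite addr0.
Qed.

Lemma rstar_hD i f : rstar f -> rstar (hD i f).
Proof.
move=> sf; case: (@split_ordP 4 3 i) => [j|l] ->; [exact: rstar_hD_x|exact: rstar_hD_t].
Qed.

Lemma tmul_imonom L f z :
  tmul L f z = f z * imonom (fun l => count_mem l L) z.2.
Proof.
have imE s (t : imquat R) : imonom s t = \prod_(l < 3) hcoord (0, t) (ti l) ^+ s l.
  case: t => [[t1 t2] t3]; rewrite /imonom; apply: eq_bigr => l _.
  by rewrite hcoordE; case: l => -[|[|[|]]].
elim: L f => [|k L IH] f /=.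
  by rewrite imE big1 ?mulr1// => l _; rewrite expr0.
rewrite IH (mulrC (hcoord _ _)) -mulrA; congr (_ * _); rewrite !imE hcoord_ti.
under [RHS]eq_bigr do rewrite exprD.
rewrite big_split/=; congr (_ * _).
rewrite (bigD1 k)//= eqxx expr1 big1 ?mulr1// => l /negPf lk.
by rewrite eq_sym lk.
Qed.

Lemma rstarP f : rstar f <-> rschwartz f /\
  forall x s, \int[imquat_leb R]_t (f (x, t) * imonom s t) = 0.
Proof.
split=> -[sf nf]; split => //.
  move=> x s.
  (* Each coordinate is listed as often as its exponent in [s] prescribes. *)
  pose L := nseq (s 0) 0 ++ nseq (s 1) 1 ++ nseq (s 2) 2 : seq 'I_3.
  have := nf L x; under eq_Rintegral do rewrite tmul_imonom/=.
  rewrite (_ : (fun l => count_mem l L) = s)//; apply/funext => l.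
  rewrite /L !count_cat !count_nseq/=.
  case: l => -[|[|[|//]]] lt; rewrite ?mul1n ?mul0n ?addn0 ?add0n;
    by congr s; apply: val_inj.
move=> L x; under eq_Rintegral do rewrite tmul_imonom/=; exact: nf.
Qed.

End rstar.

Arguments hbasis : simpl never.

(** * The Radon transform of real functions *)

Section rradon.
Context (R : realType).
Implicit Types (x y : quat R) (t : imquat R) (z w v : heis R) (f g : heis R -> R).
Implicit Types (i : 'I_7) (l k : 'I_3) (j : 'I_4).

Definition twist y x : imquat R := 2 *: qIm (qmul (qconj y) x).

(** The formula with the integration variable in the first slot; [rradon_heis_mul] reconciles it
    with the group translate in [radon]. *)
Definition rradon f : heis R -> R :=
  fun z => \int[quat_leb R]_y f (y, z.2 - twist y z.1).

(** Differences are written as sums with opposites, the shape which [continuousD'] and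
    [continuousN'] expect. *)
Lemma twistE y x : twist y x =
  (2 * (y.1.1.1 * x.1.1.2 + - (y.1.1.2 * x.1.1.1) + - (y.1.2 * x.2) + y.2 * x.1.2),
   2 * (y.1.1.1 * x.1.2 + y.1.1.2 * x.2 + - (y.1.2 * x.1.1.1) + - (y.2 * x.1.1.2)),
   2 * (y.1.1.1 * x.2 + - (y.1.1.2 * x.1.2) + y.1.2 * x.1.1.2 + - (y.2 * x.1.1.1))).
Proof.
case: y => [[[y0 y1] y2] y3]; case: x => [[[x0 x1] x2] x3].
rewrite /twist/=; congr (_, _, _); rewrite /GRing.scale/=; ring.
Qed.

Lemma imquat_eq t (t' : imquat R) : t.1.1 = t'.1.1 -> t.1.2 = t'.1.2 -> t.2 = t'.2 -> t = t'.
Proof. by case: t => [[? ?] ?]; case: t' => [[? ?] ?] /= -> -> ->. Qed.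

Lemma im_line1 (h : R) t (t' : imquat R) : (h *: t + t').1.1 = h * t.1.1 + t'.1.1. Proof. by []. Qed.
Lemma im_line2 (h : R) t (t' : imquat R) : (h *: t + t').1.2 = h * t.1.2 + t'.1.2. Proof. by []. Qed.
Lemma im_line3 (h : R) t (t' : imquat R) : (h *: t + t').2 = h * t.2 + t'.2. Proof. by []. Qed.
Lemma twist_line y x e (h : R) : twist y (h *: e + x) = h *: twist y e + twist y x.
Proof.
apply: imquat_eq; rewrite ?im_line1 ?im_line2 ?im_line3 !twistE/=;
  rewrite /GRing.scale/=; ring.
Qed.

Lemma twist_coord y x l : hcoord (0, twist y x) (ti l) =
  \sum_(j < 4) hcoord (y, 0) (xi j) * hcoord (0, twist (hbasis R (xi j)).1 x) (ti l).
Proof.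
rewrite !big_ord_recl big_ord0 !twistE !hcoordE.
by case: l => -[|[|[|//]]] lt /=; ring.
Qed.

Lemma twist_coordr y x l : hcoord (0, twist y x) (ti l) =
  \sum_(j < 4) hcoord (x, 0) (xi j) * hcoord (0, twist y (hbasis R (xi j)).1) (ti l).
Proof.
rewrite !big_ord_recl big_ord0 !twistE !hcoordE.
by case: l => -[|[|[|//]]] lt /=; ring.
Qed.

Lemma sum4E (F : 'I_4 -> R) : \sum_(j < 4) F j = F 0 + (F 1 + (F 2 + F 3)).
Proof.
rewrite !big_ord_recl big_ord0 addr0.
by congr (F _ + (F _ + (F _ + F _))); apply: val_inj.
Qed.

Lemma sum3E (F : 'I_3 -> R) : \sum_(j < 3) F j = F 0 + (F 1 + F 2).
Proof.
rewrite !big_ord_recl big_ord0 addr0.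
by congr (F _ + (F _ + F _)); apply: val_inj.
Qed.

Lemma rstar_twist f x l : rstar f ->
  rstar (fun z => hcoord (0, twist z.1 x) (ti l) * f z).
Proof.
move=> sf.
pose c j := hcoord (0, twist (hbasis R (xi j)).1 x) (ti l).
have -> : (fun z => hcoord (0, twist z.1 x) (ti l) * f z) =
  (fun z => c 0 * (hcoord z (xi 0) * f z) + (c 1 * (hcoord z (xi 1) * f z) +
    (c 2 * (hcoord z (xi 2) * f z) + c 3 * (hcoord z (xi 3) * f z)))).
  apply/funext => z; rewrite twist_coord sum4E -!(hcoord_xi _ z) /c; ring.
by apply: rstarD; [|apply: rstarD; [|apply: rstarD]]; apply: rstarZ; exact: rstar_hcoord.
Qed.

Lemma continuous_twist (U : topologicalType) (a b : U -> quat R) :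
  continuous a -> continuous b -> continuous (fun u => twist (a u) (b u)).
Proof.
move=> ca cb; under eq_fun do rewrite twistE.
have a1 := continuous_fst' ca; have a11 := continuous_fst' a1.
have b1 := continuous_fst' cb; have b11 := continuous_fst' b1.
have a111 := continuous_fst' a11; have b111 := continuous_fst' b11.
have a112 := continuous_snd' a11; have b112 := continuous_snd' b11.
have a12 := continuous_snd' a1; have b12 := continuous_snd' b1.
have a2 := continuous_snd' ca; have b2 := continuous_snd' cb.
have c2 := @continuous_cst' U R 2.
have N (f g : U -> R) (cf : continuous f) (cg : continuous g) := continuousN' (continuousM' cf cg).
have M (f g : U -> R) (cf : continuous f) (cg : continuous g) := continuousM' cf cg.
have D (f g : U -> R) (cf : continuous f) (cg : continuous g) := continuousD' cf cg.
have c1 := M _ _ c2 (D _ _ (D _ _ (D _ _ (M _ _ a111 b112) (N _ _ a112 b111)) (N _ _ a12 b2)) (M _ _ a2 b12)).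
have c2' := M _ _ c2 (D _ _ (D _ _ (D _ _ (M _ _ a111 b12) (M _ _ a112 b2)) (N _ _ a12 b111)) (N _ _ a2 b112)).
have c3 := M _ _ c2 (D _ _ (D _ _ (D _ _ (M _ _ a111 b2) (N _ _ a112 b12)) (M _ _ a12 b112)) (N _ _ a2 b111)).
exact: continuous_pair (continuous_pair c1 c2') c3.
Qed.

Lemma continuous_rradon_arg (U : topologicalType) (a b : U -> quat R) (c : U -> imquat R) :
  continuous a -> continuous b -> continuous c ->
  continuous (fun u => (a u, c u - twist (a u) (b u)) : heis R).
Proof.
move=> ca cb cc; apply: continuous_pair => // u.
by apply: cvgB; [exact: cc|exact: continuous_twist].
Qed.

Lemma rapid_wt4 f : rapid f -> exists2 M, 0 <= M & forall z, `|f z| <= M * wt4 z.1.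
Proof.
move=> /rapid_wt7[M HM].
have M0 : 0 <= M.
  by have := le_trans (normr_ge0 _) (HM 0); rewrite pmulr_lge0// wt7_gt0.
exists M => // z; apply: (le_trans (HM _)); rewrite ler_wpM2l// /wt7.
by rewrite ler_piMr ?wt4_ge0 ?wt3_le1.
Qed.

Lemma measurable_rradon f z : continuous f ->
  measurable_fun setT (fun y : measurableTypeR R * measurableTypeR R * measurableTypeR R * measurableTypeR R
     => f (y, z.2 - twist y z.1)).
Proof.
move=> cf; apply: measurable_quat.
exact: continuous_comp2 (continuous_rradon_arg (@continuous_id' _)
  (@continuous_cst' _ _ z.1) (@continuous_cst' _ _ z.2)) cf.
Qed.

Lemma rradon_slice f z : rschwartz f ->
  rintegrable (quat_leb R) (fun y => f (y, z.2 - twist y z.1)).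
Proof.
move=> sf; have [M M0 HM] := rapid_wt4 (rschwartz_rapid sf).
exact: (rintegrable_le (measurable_rradon z (rschwartz_continuous sf)) (fun y => HM _)
  (rintegrableZ M (rintegrable_wt4 R))).
Qed.

Lemma rradonD f g z : rschwartz f -> rschwartz g ->
  rradon (fun z => f z + g z) z = rradon f z + rradon g z.
Proof.
by move=> sf sg; exact: (RintegralD measurableT (rradon_slice z sf) (rradon_slice z sg)).
Qed.

Lemma rradonZ c f z : rschwartz f -> rradon (fun z => c * f z) z = c * rradon f z.
Proof. by move=> sf; exact: (RintegralZl _ measurableT (rradon_slice z sf)). Qed.

Lemma continuous_rradon f : rschwartz f -> continuous (rradon f).
Proof.
move=> sf; have [M M0 HM] := rapid_wt4 (rschwartz_rapid sf).
apply: (@continuous_Rintegral R _ _ (quat_leb R) (heis R)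
  (fun z y => f (y, z.2 - twist y z.1)) (fun y => M * wt4 y)).
- by move=> z; apply: measurable_rradon; exact: rschwartz_continuous.
- move=> y; apply: continuous_comp2 (rschwartz_continuous sf).
  apply: continuous_rradon_arg; first exact: continuous_cst'.
    by move=> ?; exact: cvg_fst.
  by move=> ?; exact: cvg_snd.
- by move=> z y; exact: HM.
- exact: rintegrableZ (rintegrable_wt4 R).
Qed.

Lemma is_derive_rradon_t f l z : rschwartz f ->
  is_derive z (hbasis R (ti l)) (rradon f) (rradon (hD (ti l) f) z).
Proof.
move=> sf; have [M M0 HM] := rapid_wt4 (rschwartz_rapid (rschwartz_hD (ti l) sf)).
apply: line_is_derive.
pose F (h : R) y := f (h *: hbasis R (ti l) + (y, z.2 - twist y z.1)).
pose F' (h : R) y := hD (ti l) f (h *: hbasis R (ti l) + (y, z.2 - twist y z.1)).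
have FE h y : F h y = f (y, (h *: hbasis R (ti l) + z).2 - twist y (h *: hbasis R (ti l) + z).1).
  by rewrite /F !heis_lineE !hbasis_ti /= scaler0 !add0r addrA.
have iF h : rintegrable (quat_leb R) (F h).
  rewrite (_ : F h = (fun y => f (y, (h *: hbasis R (ti l) + z).2 - twist y (h *: hbasis R (ti l) + z).1))).
    exact: rradon_slice.
  by apply/funext => y; exact: FE.
have dF (h : R) y : is_derive h (1 : R) (F ^~ y) (F' h y).
  by apply: is_derive_along; exact: rschwartz_is_derive.
have bF (h : R) y : `|h - 0| < 1 -> `|F' h y| <= M * wt4 y.
  move=> _; have := HM (h *: hbasis R (ti l) + (y, z.2 - twist y z.1)).
  by rewrite [in X in wt4 X]heis_lineE hbasis_ti /= scaler0 add0r.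
have := @is_derive_Rintegral R _ _ (quat_leb R) F F' _ 0 iF dF bF (rintegrableZ M (rintegrable_wt4 R)).
have -> : \int[quat_leb R]_y F' 0 y = rradon (hD (ti l) f) z.
  by apply: eq_Rintegral => y _; rewrite /F' scale0r add0r.
have -> : (fun h => \int[quat_leb R]_y F h y) = (fun h => rradon f (h *: hbasis R (ti l) + z)).
  by apply/funext => h; apply: eq_Rintegral => y _; rewrite FE.
exact.
Qed.

Lemma hcoord_inj z w : (forall i, hcoord z i = hcoord w i) -> z = w.
Proof.
move=> H; have := H 0; have := H 1; have := H 2; have := H 3; have := H 4; have := H 5; have := H 6.
rewrite !hcoordE/=; case: z {H} => [[[[? ?] ?] ?] [[? ?] ?]]; case: w => [[[[? ?] ?] ?] [[? ?] ?]] /=.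
by move=> -> -> -> -> -> -> ->.
Qed.

Lemma hcoordZ (h : R) v i : hcoord (h *: v) i = h * hcoord v i.
Proof. by have := hcoord_line 0 v i h; rewrite addr0 => ->; rewrite hcoordE; case: i => -[|[|[|[|[|[|[|i]]]]]]] lt //=; rewrite add0r. Qed.

Lemma im_basisE (v : imquat R) : (0, v) =
  hcoord (0, v) (ti 0) *: hbasis R (ti 0) + (hcoord (0, v) (ti 1) *: hbasis R (ti 1) +
  hcoord (0, v) (ti 2) *: hbasis R (ti 2)) :> heis R.
Proof.
apply: hcoord_inj => i; rewrite !hcoord_line hcoordZ !hcoord_basis !hcoordE.
case: i => -[|[|[|[|[|[|[|i]]]]]]] lt //=; ring.
Qed.

Lemma is_derive_im f z (v : imquat R) : rschwartz f ->
  is_derive z ((0, v) : heis R) f (\sum_(l < 3) hcoord (0, v) (ti l) * hD (ti l) f z).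
Proof.
move=> sf; rewrite [X in is_derive _ X _ _]im_basisE sum3E.
have d l z' : is_derive z' (hcoord (0, v) (ti l) *: hbasis R (ti l)) f
    (hcoord (0, v) (ti l) * hD (ti l) f z').
  by apply: is_derive_dirZ; exact: rschwartz_is_derive.
have c l : continuous (fun z => hcoord (0, v) (ti l) * hD (ti l) f z).
  apply: continuousM'; first exact: continuous_cst'.
  by apply: rschwartz_continuous; exact: rschwartz_hD.
exact: (is_derive_dirD (d 0) (c 0) (is_derive_dirD (d 1) (c 1) (d 2 z))).
Qed.

(** The variable x enters only through the shift of t, so the chain rule yields t-derivatives of f
    with coefficients linear in y. As y is the first coordinate of the argument of f, this is again
    the Radon transform of a function in [rstar]. *)
Lemma is_derive_rradon_x f j z : rstar f ->
  is_derive z (hbasis R (xi j)) (rradon f)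
    (rradon (fun w => - \sum_(l < 3) hcoord (0, twist w.1 (hbasis R (xi j)).1) (ti l) * hD (ti l) f w) z).
Proof.
move=> rf; have sf := rstar_rschwartz rf.
pose e := (hbasis R (xi j)).1.
pose f' w := - \sum_(l < 3) hcoord (0, twist w.1 e) (ti l) * hD (ti l) f w.
have sf' : rschwartz f'.
  have -> : f' = (fun w => -1 * (hcoord (0, twist w.1 e) (ti 0) * hD (ti 0) f w +
     (hcoord (0, twist w.1 e) (ti 1) * hD (ti 1) f w + hcoord (0, twist w.1 e) (ti 2) * hD (ti 2) f w))).
    by apply/funext => w; rewrite /f' sum3E mulN1r.
  by apply: rstar_rschwartz; apply: rstarZ; apply: rstarD; [|apply: rstarD]; apply: rstar_twist; exact: rstar_hD.
have [M M0 HM] := rapid_wt4 (rschwartz_rapid sf').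
apply: line_is_derive.
(* Moving x along the basis vector moves the argument of f along the central direction - twist y e,
   which depends on y. *)
pose v y : heis R := (0, - twist y e).
pose F (h : R) y := f (h *: v y + (y, z.2 - twist y z.1)).
pose F' (h : R) y := f' (h *: v y + (y, z.2 - twist y z.1)).
have FE h y : F h y = f (y, (h *: hbasis R (xi j) + z).2 - twist y (h *: hbasis R (xi j) + z).1).
  rewrite /F !heis_lineE !hbasis_xi -/e /= !scaler0 !add0r twist_line.
  by congr (f (_, _)); rewrite scalerN opprD [RHS]addrCA.
have iF h : rintegrable (quat_leb R) (F h).
  rewrite (_ : F h = (fun y => f (y, (h *: hbasis R (xi j) + z).2 - twist y (h *: hbasis R (xi j) + z).1))).
    exact: rradon_slice.
  by apply/funext => y; exact: FE.
have dF (h : R) y : is_derive h (1 : R) (F ^~ y) (F' h y).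
  apply: is_derive_along; apply: is_derive_eq (is_derive_im _ _ sf) _.
  have W : (h *: v y + (y, z.2 - twist y z.1)).1 = y by rewrite heis_lineE /= scaler0 add0r.
  rewrite /F' /f' W -[RHS]mulN1r mulr_sumr; apply: eq_bigr => l _; rewrite mulrA; congr (_ * _).
  by rewrite !hcoordE; case: l => -[|[|[|//]]] lt /=; rewrite mulN1r.
have bF (h : R) y : `|h - 0| < 1 -> `|F' h y| <= M * wt4 y.
  move=> _; have := HM (h *: v y + (y, z.2 - twist y z.1)).
  by rewrite [in X in wt4 X]heis_lineE/= scaler0 add0r.
have := @is_derive_Rintegral R _ _ (quat_leb R) F F' _ 0 iF dF bF (rintegrableZ M (rintegrable_wt4 R)).
have -> : \int[quat_leb R]_y F' 0 y = rradon f' z.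
  by apply: eq_Rintegral => y _; rewrite /F' scale0r add0r.
have -> : (fun h => \int[quat_leb R]_y F h y) = (fun h => rradon f (h *: hbasis R (xi j) + z)).
  by apply/funext => h; apply: eq_Rintegral => y _; rewrite FE.
exact.
Qed.

(** Multiplication by t and differentiation can be moved inside a Radon transform, multiplication by
    x cannot: it is adjoined formally. *)
Inductive xspan : (heis R -> R) -> Prop :=
| xspan_rradon f : rstar f -> xspan (rradon f)
| xspanD f g : xspan f -> xspan g -> xspan (fun z => f z + g z)
| xspanZ c f : xspan f -> xspan (fun z => c * f z)
| xspan_x j f : xspan f -> xspan (fun z => hcoord z (xi j) * f z).

(** Write t as (t - twist y x) + twist y x. The first term is the t-argument of f; the second is
    bilinear, so its x-factors go outside the integral and its y-factors are absorbed into f. *)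
Lemma rradon_t f l z : rstar f ->
  hcoord z (ti l) * rradon f z = rradon (fun w => hcoord w (ti l) * f w) z +
   \sum_(j < 4) hcoord z (xi j) * rradon (fun w => hcoord (0, twist w.1 (hbasis R (xi j)).1) (ti l) * f w) z.
Proof.
move=> rf; have sf := rstar_rschwartz rf.
pose g j w := hcoord (0, twist w.1 (hbasis R (xi j)).1) (ti l) * f w.
have sg j : rschwartz (g j) by apply: rstar_rschwartz; exact: rstar_twist.
have s1 : rschwartz (fun w => hcoord w (ti l) * f w) by exact: rschwartz_hcoord.
pose a j := hcoord z (xi j).
have s j : rschwartz (fun w => a j * g j w) by exact: rschwartzZ.
have s23 := rschwartzD (s 2) (s 3); have s123 := rschwartzD (s 1) s23.
have s0123 := rschwartzD (s 0) s123.
transitivity (rradon (fun w => hcoord w (ti l) * f w +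
    (a 0 * g 0 w + (a 1 * g 1 w + (a 2 * g 2 w + a 3 * g 3 w)))) z); last first.
  rewrite (rradonD z s1 s0123) (rradonD z (s 0) s123) (rradonD z (s 1) s23) (rradonD z (s 2) (s 3)).
  by rewrite !(rradonZ _ z (sg _)) sum4E.
rewrite -(rradonZ _ z sf).
apply: eq_Rintegral => y _ /=.
have E : hcoord z (ti l) = hcoord (y, z.2 - twist y z.1) (ti l) + hcoord (0, twist y z.1) (ti l).
  by rewrite !hcoordE; case: l {g sg s1 s s23 s123 s0123} => -[|[|[|//]]] lt /=; rewrite subrK.
rewrite [in LHS]E (twist_coordr y z.1) sum4E -!(hcoord_xi _ z) /g/= /a; ring.
Qed.

Lemma xspan_t l g : xspan g -> xspan (fun z => hcoord z (ti l) * g z).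
Proof.
elim=> {g}.
- move=> f rf.
  have -> : (fun z => hcoord z (ti l) * rradon f z) = (fun z => rradon (fun w => hcoord w (ti l) * f w) z +
   \sum_(j < 4) hcoord z (xi j) * rradon (fun w => hcoord (0, twist w.1 (hbasis R (xi j)).1) (ti l) * f w) z).
    by apply/funext => z; exact: rradon_t.
  under eq_fun do rewrite sum4E.
  apply: xspanD; first by apply: xspan_rradon; exact: rstar_hcoord.
  by apply: xspanD; [|apply: xspanD; [|apply: xspanD]]; apply: xspan_x; apply: xspan_rradon; exact: rstar_twist.
- move=> f g _ IHf _ IHg; have := xspanD IHf IHg.
  by congr xspan; apply/funext => z; rewrite mulrDr.
- move=> c f _ IHf; have := xspanZ c IHf.
  by congr xspan; apply/funext => z; rewrite mulrCA.
- move=> j f _ IHf; have := xspan_x j IHf.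
  by congr xspan; apply/funext => z; rewrite mulrCA.
Qed.

Lemma xspan_hcoord i g : xspan g -> xspan (fun z => hcoord z i * g z).
Proof.
move=> sg; case: (@split_ordP 4 3 i) => [j|l] ->; [exact: xspan_x|exact: xspan_t].
Qed.

Lemma rradon_regular f : rstar f -> [/\ continuous (rradon f),
  forall i z, derivable (rradon f) z (hbasis R i) & forall i, xspan (hD i (rradon f))].
Proof.
move=> rf; have sf := rstar_rschwartz rf; split.
- exact: continuous_rradon.
- move=> i z; case: (@split_ordP 4 3 i) => [j|l] ->.
    by have [] := is_derive_rradon_x j z rf.
  by have [] := is_derive_rradon_t l z sf.
- move=> i; case: (@split_ordP 4 3 i) => [j|l] ->; last first.
    rewrite (hD_eq (fun z => is_derive_rradon_t l z sf)).
    by apply: xspan_rradon; exact: rstar_hD.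
  rewrite (hD_eq (fun z => is_derive_rradon_x j z rf)).
  apply: xspan_rradon; set e := (hbasis R _).1.
  have -> : (fun w => - (\sum_(l < 3) hcoord (0, twist w.1 e) (ti l) * hD (ti l) f w)) = (fun w => -1 * (hcoord (0, twist w.1 e) (ti 0) * hD (ti 0) f w +
     (hcoord (0, twist w.1 e) (ti 1) * hD (ti 1) f w + hcoord (0, twist w.1 e) (ti 2) * hD (ti 2) f w))).
    by apply/funext => w; rewrite sum3E mulN1r.
  by apply: rstarZ; apply: rstarD; [|apply: rstarD]; apply: rstar_twist; exact: rstar_hD.
Qed.

End rradon.

(** * Cosine transforms *)

Section fourier_real.
Context (R : realType).
Implicit Types (x y : quat R) (t a : imquat R) (z w v : heis R) (f g : heis R -> R).
Implicit Types (i : 'I_7) (l k : 'I_3) (j : 'I_4) (c : R).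

Definition hdot z w : R := qdot z.1 w.1 + idot z.2 w.2.

(* The phase [c = - pi / 2] gives the sine transform. *)
Definition fcos f w c : R := \int[heis_leb R]_z (f z * cos (c + hdot z w)).

Lemma hdotE z w : hdot z w = \sum_(i < 7) hcoord z i * hcoord w i.
Proof.
rewrite !big_ord_recl big_ord0 /hdot qdotE idotE !hcoordE/=; ring.
Qed.

Lemma hdot_line (h : R) v z w : hdot (h *: v + z) w = hdot z w + h * hdot v w.
Proof.
rewrite !hdotE mulr_sumr -big_split/=; apply: eq_bigr => i _.
by rewrite hcoord_line; ring.
Qed.

Lemma hdot_basis i w : hdot (hbasis R i) w = hcoord w i.
Proof.
rewrite hdotE (bigD1 i)//= hcoord_basis eqxx mul1r big1 ?addr0// => k ki.
by rewrite hcoord_basis eq_sym (negPf ki) mul0r.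
Qed.

Lemma continuous_hdot w : continuous (hdot^~ w).
Proof.
have key (s : seq 'I_7) : continuous (fun z => \sum_(i <- s) hcoord z i * hcoord w i).
  elim: s => [|i s IH].
    rewrite (_ : (fun z => _) = (fun=> 0)); first exact: continuous_cst'.
    by apply/funext => z; rewrite big_nil.
  rewrite (_ : (fun z => _) = (fun z => hcoord z i * hcoord w i +
    \sum_(i <- s) hcoord z i * hcoord w i)); last by apply/funext => z; rewrite big_cons.
  apply: continuousD' IH.
  by apply: continuousM'; [exact: continuous_hcoord|exact: continuous_cst'].
rewrite (_ : hdot^~ w = (fun z => \sum_(i <- index_enum _) hcoord z i * hcoord w i)); first exact: key.
by apply/funext => z; rewrite hdotE.
Qed.

Lemma is_derive_phase c w i z :
  is_derive z (hbasis R i) (fun z => c + hdot z w) (hcoord w i).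
Proof.
apply: line_is_derive; under eq_fun do rewrite hdot_line hdot_basis addrA.
exact: is_derive_affine.
Qed.

Lemma continuous_phase c w : continuous (fun z => c + hdot z w).
Proof. by move=> z; apply: cvgD; [exact: cvg_cst|exact: continuous_hdot]. Qed.

Lemma rapid_wt7_ge0 f : rapid f -> exists2 M, 0 <= M & forall z, `|f z| <= M * wt7 z.
Proof.
move=> /rapid_wt7[M HM]; exists M => //.
by have := le_trans (normr_ge0 _) (HM 0); rewrite pmulr_lge0// wt7_gt0.
Qed.

Lemma rintegrable_wt7_le f M : continuous f -> (forall z, `|f z| <= M * wt7 z) ->
  rintegrable (heis_leb R) f.
Proof.
move=> cf HM.
exact: (rintegrable_le (measurable_heis cf) HM (rintegrableZ M (rintegrable_wt7 R))).
Qed.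

Lemma rschwartz_integrable f : rschwartz f -> rintegrable (heis_leb R) f.
Proof.
move=> sf; have [M _ HM] := rapid_wt7_ge0 (rschwartz_rapid sf).
exact: rintegrable_wt7_le (rschwartz_continuous sf) HM.
Qed.

Lemma le_mul_bound (a b m : R) : `|a| <= m -> `|b| <= 1 -> `|a * b| <= m.
Proof.
move=> am b1; rewrite normrM; apply: le_trans am.
by rewrite ler_piMr.
Qed.

Lemma continuous_trig f c w (T : R -> R) : continuous T -> continuous f ->
  continuous (fun z => f z * T (c + hdot z w)).
Proof.
move=> cT cf; apply: continuousM' cf _; apply: continuous_comp2 cT.
exact: continuous_phase.
Qed.

Lemma fcos_integrable f w c : rschwartz f ->
  rintegrable (heis_leb R) (fun z => f z * cos (c + hdot z w)).
Proof.
move=> sf; have [M _ HM] := rapid_wt7_ge0 (rschwartz_rapid sf).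
apply: (@rintegrable_wt7_le _ M).
  by apply: continuous_trig; [exact: continuous_cos|exact: rschwartz_continuous].
by move=> z; apply: le_mul_bound (HM z) (cos_max _).
Qed.

Lemma Rintegral_heis_derive0 i (g dg : heis R -> R) M : rintegrable (heis_leb R) g ->
  (forall z, is_derive z (hbasis R i) g (dg z)) -> 0 <= M ->
  (forall z, `|dg z| <= M * wt7 z) -> \int[heis_leb R]_z dg z = 0.
Proof.
move=> ig dgE M0 HM.
pose tau (h : R) z := h *: hbasis R i + z.
have stau h : scales_measure (heis_leb R) (tau h) 1.
  exact: (scales_heis (h *: hbasis R i) (@continuous_cst' _ _ (h *: hbasis R i).2)).
have tau0 z : tau 0 z = z by rewrite /tau scale0r add0r.
have dtau (h : R) z : is_derive h (1 : R) (fun h => g (tau h z)) (dg (tau h z)).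
  by apply: is_derive_along.
have bnd (h : R) z : `|h| < 1 -> `|dg (tau h z)| <= (M * 3) * wt7 z.
  move=> h1; apply: (le_trans (HM _)); rewrite -mulrA ler_wpM2l//.
  exact: wt7_shift (ltW h1).
have H := @Rintegral_derivative0 R _ _ (heis_leb R) tau g dg _ stau tau0 ig dtau bnd
  (rintegrableZ (M * 3) (rintegrable_wt7 R)).
by rewrite -[RHS]H.
Qed.

(** Two integrations by parts at once, so that the phase is unchanged. The function [g] is chosen so
    that the cross terms in its derivative cancel, and a derivative integrates to 0. *)
Lemma fcos_hD2 f i w c : rschwartz f ->
  fcos (hD i (hD i f)) w c = - hcoord w i ^+ 2 * fcos f w c.
Proof.
move=> sf; have sD := rschwartz_hD i sf; have sDD := rschwartz_hD i sD.
pose th z := c + hdot z w; set wi := hcoord w i.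
pose g z := hD i f z * cos (th z) + wi * (f z * sin (th z)).
pose dg z := hD i (hD i f) z * cos (th z) + wi ^+ 2 * (f z * cos (th z)).
have dcos z : is_derive z (hbasis R i) (fun z => cos (th z)) (- sin (th z) * wi).
  by apply: is_derive_comp1 (is_derive_phase c w i z) _; exact: is_derive_cos.
have dsin z : is_derive z (hbasis R i) (fun z => sin (th z)) (cos (th z) * wi).
  by apply: is_derive_comp1 (is_derive_phase c w i z) _; exact: is_derive_sin.
have dgE z : is_derive z (hbasis R i) g (dg z).
  have d1 := is_derive_mul (rschwartz_is_derive i z sD) (dcos z).
  have d2 := is_derive_mulZ wi (is_derive_mul (rschwartz_is_derive i z sf) (dsin z)).
  apply: is_derive_eq (is_derive_add d1 d2) _; rewrite /dg; ring.
have [M M0 HM] := rapid_wt7_ge0 (rschwartz_rapid sf).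
have [M1 M10 HM1] := rapid_wt7_ge0 (rschwartz_rapid sD).
have [M2 M20 HM2] := rapid_wt7_ge0 (rschwartz_rapid sDD).
have ig : rintegrable (heis_leb R) g.
  apply: (@rintegrable_wt7_le _ (M1 + `|wi| * M)).
    apply: continuousD'; first by apply: continuous_trig; [exact: continuous_cos|exact: rschwartz_continuous].
    apply: continuousM'; first exact: continuous_cst'.
    by apply: continuous_trig; [exact: continuous_sin|exact: rschwartz_continuous].
  move=> z; apply: (le_trans (ler_normD _ _)); rewrite mulrDl lerD//.
    exact: le_mul_bound (HM1 z) (cos_max _).
  rewrite normrM -mulrA ler_wpM2l//; exact: le_mul_bound (HM z) (normr_sin_le1 _).
have bdg z : `|dg z| <= (M2 + `|wi ^+ 2| * M) * wt7 z.
  apply: (le_trans (ler_normD _ _)); rewrite mulrDl lerD//.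
    exact: le_mul_bound (HM2 z) (cos_max _).
  rewrite normrM -mulrA ler_wpM2l//; exact: le_mul_bound (HM z) (cos_max _).
have := Rintegral_heis_derive0 ig dgE (addr_ge0 M20 (mulr_ge0 (normr_ge0 _) M0)) bdg.
have i1 := fcos_integrable w c sDD; have i2 := fcos_integrable w c sf.
rewrite (RintegralD measurableT i1 (rintegrableZ (wi ^+ 2) i2)).
rewrite (RintegralZl _ measurableT i2) -/(fcos f w c) -/(fcos _ w c) => H.
by apply/eqP; rewrite mulNr -addr_eq0 H.
Qed.

Lemma fcosD f g w c : rschwartz f -> rschwartz g ->
  fcos (fun z => f z + g z) w c = fcos f w c + fcos g w c.
Proof.
move=> sf sg; rewrite /fcos -(RintegralD measurableT (fcos_integrable w c sf) (fcos_integrable w c sg)).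
by apply: eq_Rintegral => z _; rewrite mulrDl.
Qed.

Lemma fcosZ b f w c : rschwartz f -> fcos (fun z => b * f z) w c = b * fcos f w c.
Proof.
move=> sf; rewrite /fcos -(RintegralZl _ measurableT (fcos_integrable w c sf)).
by apply: eq_Rintegral => z _; rewrite mulrA.
Qed.

(** The substitution x |-> - 2 x a of Psi. By [idot_twist] it is the adjoint side of the twist,
    <twist y x, a> = <y, - 2 x a>, and this identity carries the slice formula. *)
Definition qright x a : quat R := -2 *: qmul x (quat_of_im a).

Lemma qrightE x a : qright x a =
  (2 * (x.1.1.2 * a.1.1 + x.1.2 * a.1.2 + x.2 * a.2),
   - 2 * (x.1.1.1 * a.1.1 + x.1.2 * a.2 - x.2 * a.1.2),
   - 2 * (x.1.1.1 * a.1.2 - x.1.1.2 * a.2 + x.2 * a.1.1),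
   - 2 * (x.1.1.1 * a.2 + x.1.1.2 * a.1.2 - x.1.2 * a.1.1)).
Proof.
case: x => [[[x0 x1] x2] x3]; case: a => [[a1 a2] a3].
by rewrite /qright/=; congr (_, _, _, _); rewrite /GRing.scale/=; ring.
Qed.

Lemma idot_twist y x a : idot (twist y x) a = qdot y (qright x a).
Proof. rewrite idotE qdotE twistE qrightE/=; ring. Qed.

Lemma idotDl t (t' : imquat R) a : idot (t + t') a = idot t a + idot t' a.
Proof.
rewrite !idotE; case: t => [[t1 t2] t3]; case: t' => [[s1 s2] s3] /=; ring.
Qed.

(** The slice formula. The shear [phi] preserves the measure and brings out f (y, t - twist y x),
    while the adjoint identity cancels the twist in the phase and leaves <t, a>. Fubini with y as
    inner variable then exhibits the Radon transform. *)
Lemma rradon_fourier f x a c : rschwartz f ->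
  rintegrable (imquat_leb R) (fun t => rradon f (x, t) * cos (c + idot t a)) /\
  \int[imquat_leb R]_t (rradon f (x, t) * cos (c + idot t a)) =
    fcos f (qright x a, a) c.
Proof.
move=> sf.
pose H z := f z * cos (c + hdot z (qright x a, a)).
pose phi z : heis R := (0 + z.1, - twist z.1 x + z.2).
have sphi : scales_measure (heis_leb R) phi 1.
  apply: (@scales_heis R 0 (fun y => - twist y x)) => y; apply: cvgN.
  exact: continuous_twist (@continuous_id' _) (@continuous_cst' _ _ x) y.
have iH : rintegrable (heis_leb R) H by exact: fcos_integrable.
have [iHp HpE] := scales_Rintegral sphi iH.
have HE y t : H (phi (y, t)) = f (y, t - twist y x) * cos (c + idot t a).
  rewrite /H /phi/= add0r addrC; congr (_ * cos (_ + _)).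
  rewrite /hdot/= -idot_twist -idotDl; congr idot.
  by rewrite addrCA subrr addr0.
have sl t : rintegrable (quat_leb R) (fun y => H (phi (y, t))).
  have i1 := rintegrableZ (cos (c + idot t a)) (rradon_slice (x, t) sf).
  have E : (fun y => H (phi (y, t))) = (fun y => cos (c + idot t a) * f (y, (x, t).2 - twist y (x, t).1)).
    by apply/funext => y; rewrite HE mulrC.
  by rewrite E; exact: i1.
have [ift E] := @Rfubini_sym R _ _ _ _ (quat_leb R) (imquat_leb R) (H \o phi) iHp sl.
have tE t : \int[quat_leb R]_y (H \o phi) (y, t) = rradon f (x, t) * cos (c + idot t a).
  rewrite /rradon mulrC -(RintegralZl _ measurableT (rradon_slice (x, t) sf)).
  by apply: eq_Rintegral => y _; rewrite /= HE mulrC.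
split.
  by move: ift; under eq_fun do rewrite tE.
rewrite /fcos -[RHS]mul1r -HpE; symmetry; etransitivity; first exact: E.
by apply: eq_Rintegral => t _; exact: tE.
Qed.

Lemma fcos_slice f x w c : rschwartz f ->
  rintegrable (imquat_leb R) (fun t => f (x, t) * cos (c + hdot (x, t) w)).
Proof.
move=> sf; apply: (@rintegrable_le _ _ _ (imquat_leb R) _ (fun t => `|f (x, t)|)).
- apply: measurable_imquat.
  have ct : continuous (fun z => f z * cos (c + hdot z w)).
    by apply: continuous_trig; [exact: continuous_cos|exact: rschwartz_continuous].
  exact: continuous_comp2 (@continuous_pairl _ _ x) ct.
- by move=> t; apply: le_mul_bound (cos_max _).
- exact: integrable_norm (rschwartz_slice x sf).
Qed.

Lemma fcos_fubini f w c : rschwartz f ->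
  rintegrable (quat_leb R) (fun x => \int[imquat_leb R]_t (f (x, t) * cos (c + hdot (x, t) w))) /\
  fcos f w c = \int[quat_leb R]_x \int[imquat_leb R]_t (f (x, t) * cos (c + hdot (x, t) w)).
Proof.
move=> sf.
exact: (@Rfubini R _ _ _ _ (quat_leb R) (imquat_leb R) (fun z => f z * cos (c + hdot z w))
  (fcos_integrable w c sf) (fun x => fcos_slice x w c sf)).
Qed.

Lemma fcos_bounded f : rschwartz f -> exists2 C, 0 <= C & forall w c, `|fcos f w c| <= C.
Proof.
move=> sf; exists (\int[heis_leb R]_z `|f z|); first exact: Rintegral_ge0.
move=> w c; have ic := fcos_integrable w c sf.
apply: (le_trans (le_normr_Rintegral measurableT ic)).
have iN : rintegrable (heis_leb R) (fun z => `|f z|) by exact: integrable_norm (rschwartz_integrable sf).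
apply: (le_Rintegral measurableT (integrable_norm ic) iN) => z _ /=.
exact: le_mul_bound (cos_max _).
Qed.

(** At frequency a = 0 the cosine does not depend on t, so the inner integral is a multiple of the
    zeroth moment. *)
Lemma fcos_null f x c : null_integral f -> rschwartz f -> fcos f (x, 0) c = 0.
Proof.
move=> nf sf; rewrite (fcos_fubini (x, 0) c sf).2.
rewrite -[RHS](mul0r (fine (quat_leb R setT))) -Rintegral_cst//.
apply: eq_Rintegral => y _.
have E t : f (y, t) * cos (c + hdot (y, t) (x, 0)) = cos (c + qdot y x) * f (y, t).
  by rewrite mulrC /hdot/= idotE/= !mulr0 !addr0.
under eq_Rintegral do rewrite E.
by rewrite (RintegralZl _ measurableT (rschwartz_slice y sf)) nf mulr0.
Qed.

(** The l^1 norm on R^3: homogeneous, and adapted to bounding sums over the three t-coordinates. *)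
Definition im1 a : R := `|a.1.1| + `|a.1.2| + `|a.2|.

Lemma hcoord_ti_im1 a : im1 a = \sum_(l < 3) `|hcoord (0, a) (ti l)|.
Proof. by rewrite /im1 !big_ord_recl big_ord0 !hcoordE/= addr0 addrA. Qed.

(* Vanishing moments: the transform is flat at a = 0. Along the segment r a,
   the r-derivative is the transform of a . t f, again a function with
   vanishing moments, so the order of vanishing goes up by induction. *)
Lemma fcos_flat n f : rstar f ->
  exists2 C, 0 <= C & forall x a c, `|fcos f (x, a) c| <= C * im1 a ^+ n.
Proof.
elim: n f => [|n IH] f rf.
  have [C C0 HC] := fcos_bounded (rstar_rschwartz rf).
  by exists C => // x a c; rewrite expr0 mulr1.
have sf := rstar_rschwartz rf.
have /choice[C HC] l : exists C, 0 <= C /\ forall x a c,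
    `|fcos (fun z => hcoord z (ti l) * f z) (x, a) c| <= C * im1 a ^+ n.
  by have [C C0 HC] := IH _ (rstar_hcoord (ti l) rf); exists C.
have C0 l : 0 <= C l by have [] := HC l.
exists (\sum_(l < 3) C l); first exact: sumr_ge0.
move=> x a c.
have im0 : 0 <= im1 a by rewrite hcoord_ti_im1; exact: sumr_ge0.
pose v : heis R := (0, a).
have wE (r : R) : (x, r *: a) = r *: v + (x, 0).
  by rewrite heis_lineE/= scaler0 add0r addr0.
pose F (r : R) z := f z * cos (c + hdot z (x, r *: a)).
(* As cos' = cos (. + pi / 2), the r-derivative is again a cosine transform, with a shifted
   phase. *)
pose F' (r : R) z := (\sum_(l < 3) hcoord v (ti l) * (hcoord z (ti l) * f z)) *
   cos (c + pi / 2 + hdot z (x, r *: a)).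
have hd z (r : R) : hdot z (x, r *: a) = hdot z (x, 0) + r * \sum_(l < 3) hcoord v (ti l) * hcoord z (ti l).
  rewrite !hdotE wE mulr_sumr !big_ord_recl !big_ord0 !hcoord_line !hcoordE/=; ring.
have dF (r : R) z : is_derive r (1 : R) (F ^~ z) (F' r z).
  rewrite /F; under eq_fun do rewrite hd addrA.
  have d1 := is_derive_comp1 (is_derive_affine (c + hdot z (x, 0)) (\sum_(l < 3) hcoord v (ti l) * hcoord z (ti l)) r) (is_derive_cos _).
  apply: is_derive_eq (is_derive_mulZ (f z) d1) _.
  rewrite /F' hd (_ : forall A B : R, c + pi / 2 + (A + B) = (c + A + B) + pi / 2); last by move=> A B; ring.
  rewrite cosDpihalf; under [in RHS]eq_bigr do rewrite mulrA.
  by rewrite -mulr_suml; ring.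
have iF r : rintegrable (heis_leb R) (F r) by exact: fcos_integrable.
have sl l : rschwartz (fun z => hcoord z (ti l) * f z) by exact: rschwartz_hcoord.
have sG : rschwartz (fun z => \sum_(l < 3) hcoord v (ti l) * (hcoord z (ti l) * f z)).
  under eq_fun do rewrite sum3E.
  by apply: rschwartzD; [|apply: rschwartzD]; exact: rschwartzZ.
have iG : rintegrable (heis_leb R) (fun z => `|\sum_(l < 3) hcoord v (ti l) * (hcoord z (ti l) * f z)|).
  exact: integrable_norm (rschwartz_integrable sG).
have bF (b r : R) z : `|r - b| < 1 -> `|F' r z| <= `|\sum_(l < 3) hcoord v (ti l) * (hcoord z (ti l) * f z)|.
  by move=> _; apply: le_mul_bound (cos_max _).
have dpsi (r : R) := @is_derive_Rintegral R _ _ (heis_leb R) F F' _ r iF dF (bF r) iG.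
have psi' (r : R) : \int[heis_leb R]_z F' r z = \sum_(l < 3) hcoord v (ti l) *
    fcos (fun z => hcoord z (ti l) * f z) (x, r *: a) (c + pi / 2).
  rewrite -[LHS]/(fcos (fun z => \sum_(l < 3) hcoord v (ti l) * (hcoord z (ti l) * f z)) _ _) sum3E.
  under [X in fcos X]eq_fun do rewrite sum3E.
  have s12 := rschwartzD (rschwartzZ (hcoord v (ti 1)) (sl 1)) (rschwartzZ (hcoord v (ti 2)) (sl 2)).
  rewrite (fcosD _ _ (rschwartzZ (hcoord v (ti 0)) (sl 0)) s12).
  rewrite (fcosD _ _ (rschwartzZ (hcoord v (ti 1)) (sl 1)) (rschwartzZ (hcoord v (ti 2)) (sl 2))).
  by rewrite !(fcosZ _ _ _ (sl _)).
(* Mean value theorem on [0, 1]: the transform vanishes at r = 0, and the coefficients of its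
   derivative supply the extra factor [im1 a]. *)
have [r] := @mvt_line R R (fun r => \int[heis_leb R]_z F r z) 1 _ 0 1 dpsi.
rewrite normr1 !addr0 => r1.
have rE (q : R) : q *: (1 : R) = q by rewrite /GRing.scale/= mulr1.
rewrite !rE mulr1.
have -> : \int[heis_leb R]_z F 0 z = 0.
  by rewrite -[LHS]/(fcos f (x, 0 *: a) c) scale0r (fcos_null _ _ (rf.2 [::])).
have -> : \int[heis_leb R]_z F 1 z = fcos f (x, a) c by rewrite -[LHS]/(fcos f (x, 1 *: a) c) scale1r.
rewrite subr0 psi' => ->.
apply: (le_trans (ler_norm_sum _ _ _)).
rewrite mulr_suml; apply: ler_sum => l _.
have [_ /(_ x (r *: a) (c + pi / 2)) Hl] := HC l.
have imr : im1 (r *: a) <= im1 a.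
  by rewrite /im1/= !normrM -!mulrDr -[leRHS]mul1r ler_wpM2r.
have imr0 : 0 <= im1 (r *: a) by rewrite hcoord_ti_im1; exact: sumr_ge0.
have imv : `|hcoord v (ti l)| <= im1 a.
  by rewrite hcoord_ti_im1 (bigD1 l)//= lerDl sumr_ge0.
have imn : C l * im1 (r *: a) ^+ n <= C l * im1 a ^+ n.
  by apply: ler_wpM2l => //; apply: lerXn2r; rewrite ?nnegrE.
by rewrite normrM exprSr mulrA mulrC ler_pM// (le_trans Hl).
Qed.

Lemma null_integral_rradon f : rstar f -> null_integral (rradon f).
Proof.
move=> rf x; have [_] := rradon_fourier x 0 0 (rstar_rschwartz rf).
under eq_Rintegral do rewrite idotE/= !mulr0 !addr0 cos0 mulr1.
move=> ->; rewrite /qright.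
exact: fcos_null (rf.2 [::]) (rstar_rschwartz rf).
Qed.

End fourier_real.

(** * Fourier inversion in t and decay of the Radon transform *)

Section slice_inversion.
Context (R : realType).
Implicit Types (x y : quat R) (s t a : imquat R).

Lemma idot0r s : idot s 0 = 0.
Proof. by rewrite idotE/= !mulr0 !addr0. Qed.

Lemma qdot0r x : qdot x 0 = 0.
Proof. by rewrite qdotE/= !mulr0 !addr0. Qed.

Lemma idotC s t : idot s t = idot t s.
Proof. by rewrite !idotE; ring. Qed.

Lemma idotBr a s t : idot a (s - t) = idot a s - idot a t.
Proof. by rewrite !idotE/=; ring. Qed.

Lemma cvg_shift (V : normedModType R) (v w : V) (r : nat -> R) : r @ \oo --> (0 : R) ->
  (fun n => v + r n *: w) @ \oo --> v.
Proof.
move=> r0; have : (fun n => v + r n *: w) @ \oo --> v + (0 : R) *: w.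
  by apply: cvgD; [exact: cvg_cst|exact: cvgZr_tmp].
by rewrite scale0r addr0.
Qed.

Lemma measurable_idot d (T : measurableType d)
    (p q : T -> measurableTypeR R * measurableTypeR R * measurableTypeR R) :
  measurable_fun setT p -> measurable_fun setT q ->
  measurable_fun setT (fun z => idot (p z) (q z)).
Proof.
move=> mp mq; under eq_fun do rewrite idotE.
have c1 (h : T -> measurableTypeR R * measurableTypeR R * measurableTypeR R) : measurable_fun setT h -> measurable_fun setT (fun z => (h z).1.1).
  by move=> mh; exact: (measurableT_comp measurable_fst (measurableT_comp measurable_fst mh)).
have c2 (h : T -> measurableTypeR R * measurableTypeR R * measurableTypeR R) : measurable_fun setT h -> measurable_fun setT (fun z => (h z).1.2).
  by move=> mh; exact: (measurableT_comp measurable_snd (measurableT_comp measurable_fst mh)).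
have c3 (h : T -> measurableTypeR R * measurableTypeR R * measurableTypeR R) : measurable_fun setT h -> measurable_fun setT (fun z => (h z).2).
  by move=> mh; exact: (measurableT_comp measurable_snd mh).
apply: measurable_funD; last exact: measurable_funM (c3 _ mp) (c3 _ mq).
by apply: measurable_funD; [exact: measurable_funM (c1 _ mp) (c1 _ mq)|exact: measurable_funM (c2 _ mp) (c2 _ mq)].
Qed.

(** Two limits of one sequence: [gaussian_inversion] with u s = s - t gives the right side, and
    [gaussian_limit] with la = 1, concentrating at t, gives the left side. *)
Lemma slice_inversion (k G : imquat R -> R) (M : R) t : continuous k -> (forall s, `|k s| <= M) ->
  rintegrable (imquat_leb R) k -> rintegrable (imquat_leb R) G ->
  (forall a, `|\int[imquat_leb R]_s (k s * cos (0 + idot a (s - t)))| <= G a) ->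
  (2 * pi) ^+ 3 * k t = \int[imquat_leb R]_a \int[imquat_leb R]_s (k s * cos (0 + idot a (s - t))).
Proof.
move=> ck kM ik iG HG.
have gk := gaussian_kernel_imquat R.
have mu : measurable_fun setT (fun s : measurableTypeR R * measurableTypeR R * measurableTypeR R =>
    (s - t : imquat R) : measurableTypeR R * measurableTypeR R * measurableTypeR R).
  under eq_fun do rewrite addrC.
  by have [] := scales_imquatD (- t).
have md := measurable_idot measurable_fst (measurableT_comp mu measurable_snd).
have c1 := @gaussian_inversion R _ _ _ _ (imquat_leb R) (imquat_leb R) _ _ _ k (fun=> 0) G
  (fun s => s - t) gk (@idot_ge0 R) ik (measurable_cst (0 : R)) md HG iG.
have msq := measurable_idot mu mu.
have c2 := @gaussian_limit R _ _ (imquat_leb R) _ _ 3 k (fun s => idot (s - t) (s - t))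
  (fun r w => t + r *: w) 0 (k t) M 1 gk idot0r (idot0r 0) ltr01.
apply: (cvg_unique _ _ c1) => //.
have -> : (2 * pi) ^+ 3 * k t = (2 * pi / 1) ^+ 3 * k t by rewrite divr1.
rewrite (_ : (fun m => _) = (fun m : nat => \int[imquat_leb R]_v (k v *
     ((Num.sqrt pi / m.+1%:R^-1) ^+ 3 *
      expR (- ((1 ^+ 2 * idot (v - t) (v - t)) / (4 * m.+1%:R^-1 ^+ 2))))))); last first.
  by apply/funext => m; apply: eq_Rintegral => s _; rewrite cos0 mulr1 expr1n mul1r.
apply: c2 => //.
- by move=> r r0; exact: scales_imquat.
- by move=> r w; rewrite addrC addKr !idotE/= /GRing.scale/=; ring.
- exact: measurable_imquat.
- move=> w r r0; apply: (@cvg_comp _ _ _ (fun m => t + r m *: (w : imquat R)) k _ (nbhs t)); last exact: ck.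
  exact: cvg_shift.
Qed.

(** Inversion with the majorant 0; the phase - <a, t> recentres the transform at t. *)
Lemma slice_unique (k : imquat R -> R) (M : R) : continuous k -> (forall s, `|k s| <= M) ->
  rintegrable (imquat_leb R) k ->
  (forall a (c : R), \int[imquat_leb R]_s (k s * cos (c + idot s a)) = 0) -> forall t, k t = 0.
Proof.
move=> ck kM ik H t.
have H0 a : \int[imquat_leb R]_s (k s * cos (0 + idot a (s - t))) = 0.
  rewrite -[RHS](H a (- idot a t)); apply: eq_Rintegral => s _.
  by rewrite add0r idotBr (idotC a s) addrC.
have i0 : rintegrable (imquat_leb R) (fun=> 0 : R).
  have := rintegrableZ 0 ik; by under eq_fun do rewrite mul0r.
have b0 a : `|\int[imquat_leb R]_s (k s * cos (0 + idot a (s - t)))| <= 0 by rewrite H0 normr0.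
have := slice_inversion (t := t) ck kM ik i0 b0.
under eq_Rintegral do rewrite H0.
rewrite Rintegral_cst// mul0r => /eqP; rewrite mulf_eq0 expf_eq0/= mulf_eq0 pnatr_eq0/=.
by rewrite gt_eqF ?pi_gt0//= => /eqP.
Qed.

End slice_inversion.

(** * Fourier multipliers of the space [rstar] *)

Section multiplier.
Context (R : realType).
Implicit Types (x y : quat R) (t a : imquat R) (z w : heis R) (f g : heis R -> R) (m : heis R -> R).
Implicit Types (c : R).

(** A symbol realized by an operator preserving [rstar]. Boundedness and flatness of transforms,
    applied to the image [g], become decay estimates for the transform of f. *)
Definition multiplier m := forall f, rstar f ->
  exists2 g, rstar g & forall w c, fcos g w c = m w * fcos f w c.

Lemma multiplier1 : multiplier (fun=> 1).
Proof. by move=> f rf; exists f => // w c; rewrite mul1r. Qed.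

Lemma multiplierD m m' : multiplier m -> multiplier m' -> multiplier (fun w => m w + m' w).
Proof.
move=> hm hm' f rf; have [g rg gE] := hm f rf; have [g' rg' gE'] := hm' f rf.
exists (fun z => g z + g' z); first exact: rstarD.
by move=> w c; rewrite fcosD ?gE ?gE' ?mulrDl//; exact: rstar_rschwartz.
Qed.

Lemma multiplierM m m' : multiplier m -> multiplier m' -> multiplier (fun w => m w * m' w).
Proof.
move=> hm hm' f rf; have [g' rg' gE'] := hm' f rf; have [g rg gE] := hm g' rg'.
by exists g => // w c; rewrite gE gE' mulrA.
Qed.

Lemma multiplierX n m : multiplier m -> multiplier (fun w => m w ^+ n).
Proof.
move=> hm; elim: n => [|n IH]; first exact: multiplier1.
by under eq_fun do rewrite exprS; exact: multiplierM.
Qed.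

Lemma multiplier_hcoord2 i : multiplier (fun w => hcoord w i ^+ 2).
Proof.
move=> f rf; exists (fun z => -1 * hD i (hD i f) z).
  by apply: rstarZ; do 2!apply: rstar_hD.
move=> w c; rewrite fcosZ; first by rewrite fcos_hD2 ?mulN1r ?mulNr ?opprK//; exact: rstar_rschwartz.
by do 2!apply: rschwartz_hD; exact: rstar_rschwartz.
Qed.

Lemma multiplier_qdot : multiplier (fun w => qdot w.1 w.1).
Proof.
rewrite (_ : (fun w => _) = (fun w => hcoord w (xi 0) ^+ 2 + hcoord w (xi 1) ^+ 2 +
  hcoord w (xi 2) ^+ 2 + hcoord w (xi 3) ^+ 2)).
  pose m2 j := multiplier_hcoord2 (xi j).
  exact: multiplierD (multiplierD (multiplierD (m2 0) (m2 1)) (m2 2)) (m2 3).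
by apply/funext => w; rewrite qdotE !hcoordE.
Qed.

Lemma multiplier_wt3 : multiplier (fun w => (wt3 w.2)^-1).
Proof.
rewrite (_ : (fun w => _) = (fun w => (1 + hcoord w (ti 0) ^+ 2) * (1 + hcoord w (ti 1) ^+ 2) *
  (1 + hcoord w (ti 2) ^+ 2))).
  pose m2 l := multiplierD multiplier1 (multiplier_hcoord2 (ti l)).
  exact: multiplierM (multiplierM (m2 0) (m2 1)) (m2 2).
by apply/funext => w; rewrite !hcoordE/= /wt3 /wt1 !invfM !invrK.
Qed.

End multiplier.

Section rradon_rschwartz.
Context (R : realType).
Implicit Types (x y : quat R) (t a : imquat R) (z w : heis R) (f g : heis R -> R).
Implicit Types (c : R).

Lemma wt3_gt0 a : 0 < wt3 a.
Proof. by rewrite /wt3 !mulr_gt0// wt1_gt0. Qed.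

Lemma rradon_bounded f : rschwartz f -> exists M, forall z, `|rradon f z| <= M.
Proof.
move=> sf; have [M M0 HM] := rapid_wt4 (rschwartz_rapid sf).
have iw := rintegrableZ M (rintegrable_wt4 R).
exists (\int[quat_leb R]_y (M * wt4 y)) => z; have ism := rradon_slice z sf.
apply: (le_trans (le_normr_Rintegral measurableT ism)).
by apply: (le_Rintegral measurableT (integrable_norm ism) iw) => y _; exact: HM.
Qed.

Lemma rradon_integrable f x : rschwartz f -> rintegrable (imquat_leb R) (fun t => rradon f (x, t)).
Proof.
move=> sf; have [] := rradon_fourier x 0 0 sf.
by under eq_fun do rewrite idot0r addr0 cos0 mulr1.
Qed.

Lemma fcos_wt3 f : rstar f ->
  exists2 C, 0 <= C & forall w c, `|fcos f w c| <= C * wt3 w.2.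
Proof.
move=> rf; have [g rg gE] := multiplier_wt3 rf.
have [C C0 HC] := fcos_bounded (rstar_rschwartz rg).
exists C => // w c; have := HC w c.
by rewrite gE normrM normfV (gtr0_norm (wt3_gt0 _)) mulrC ler_pdivrMr ?wt3_gt0.
Qed.

(** Slice inversion of t |-> R f (x, t): the slice formula computes its transform, and [fcos_wt3]
    supplies the integrable majorant. *)
Lemma rradon_inversion f x t : rstar f ->
  (2 * pi) ^+ 3 * rradon f (x, t) =
  \int[imquat_leb R]_a fcos f (qright x a, a) (- idot a t).
Proof.
move=> rf; have sf := rstar_rschwartz rf.
have [M HM] := rradon_bounded sf; have [C C0 HC] := fcos_wt3 rf.
have E a : \int[imquat_leb R]_s (rradon f (x, s) * cos (0 + idot a (s - t))) =
    fcos f (qright x a, a) (- idot a t).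
  rewrite -(rradon_fourier x a _ sf).2; apply: eq_Rintegral => s _.
  by rewrite add0r idotBr (idotC a s) addrC.
have ck : continuous (fun s => rradon f (x, s)).
  exact: continuous_comp2 (@continuous_pairl _ _ x) (continuous_rradon sf).
have bE a : `|\int[imquat_leb R]_s (rradon f (x, s) * cos (0 + idot a (s - t)))| <= C * wt3 a.
  by rewrite E; exact: HC.
have := @slice_inversion R _ _ _ t ck (fun s => HM (x, s)) (rradon_integrable x sf)
  (rintegrableZ C (rintegrable_wt3 R)) bE.
by move=> ->; apply: eq_Rintegral => a _; exact: E.
Qed.

Lemma qdot_qright x a : qdot (qright x a) (qright x a) = 4 * (qdot x x * idot a a).
Proof. by rewrite qrightE !qdotE idotE/=; ring. Qed.

Lemma im1_sqr a : im1 a ^+ 2 <= 3 * idot a a.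
Proof.
rewrite idotE /im1 -!expr2 -(real_normK (num_real a.1.1)) -(real_normK (num_real a.1.2)) -(real_normK (num_real a.2)).
have := sqr_ge0 (`|a.1.1| - `|a.1.2|); have := sqr_ge0 (`|a.1.1| - `|a.2|).
have := sqr_ge0 (`|a.1.2| - `|a.2|); nra.
Qed.

Lemma idot_eq0 a : (idot a a == 0) = (a == 0).
Proof.
apply/eqP/eqP => [|->]; last exact: idot0r.
case: a => [[a1 a2] a3]; rewrite idotE/= -!expr2 => H.
have := sqr_ge0 a1; have := sqr_ge0 a2; have := sqr_ge0 a3 => h3 h2 h1.
have e1 : a1 ^+ 2 = 0 by lra.
have e2 : a2 ^+ 2 = 0 by lra.
have e3 : a3 ^+ 2 = 0 by lra.
by move: e1 e2 e3 => /eqP; rewrite sqrf_eq0 => /eqP -> /eqP; rewrite sqrf_eq0 => /eqP -> /eqP; rewrite sqrf_eq0 => /eqP ->.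
Qed.

(* |x|^2 is a quarter of |x a|^2 / |a|^2, and the flatness of the transform at
   a = 0 absorbs the denominator. *)
Lemma fcos_qright_decay N f : rstar f -> exists2 C, 0 <= C & forall x a c,
  `|qdot x x ^+ N * fcos f (qright x a, a) c| <= C * wt3 a.
Proof.
move=> rf; have [g rg gE] := multiplierM (multiplierX N (@multiplier_qdot R)) (@multiplier_wt3 R) rf.
have [C C0 HC] := fcos_flat (2 * N) rg.
(* 3 comes from [im1_sqr] and 4 from [qdot_qright]. Flatness of order 2 N is exactly what the
   division by (4 |a|^2)^N uses up. *)
exists (C * (3 / 4) ^+ N); first by rewrite mulr_ge0// exprn_ge0// divr_ge0.
move=> x a c; have w0 := wt3_gt0 a.
have [->|a0] := eqVneq a 0.
  rewrite (fcos_null _ _ (rf.2 [::]) (rstar_rschwartz rf)) mulr0 normr0 mulr_ge0//.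
    by rewrite mulr_ge0// exprn_ge0// divr_ge0.
  exact: ltW (wt3_gt0 _).
have d0 : 0 < idot a a by rewrite lt_neqAle idot_ge0 andbT eq_sym idot_eq0.
have {}HC := HC (qright x a) a c.
have I : im1 a ^+ (2 * N) <= (3 * idot a a) ^+ N.
  by rewrite exprM lerXn2r ?im1_sqr// nnegrE ?sqr_ge0// mulr_ge0// ltW.
have {HC}I := le_trans HC (ler_wpM2l C0 I).
pose K := (4 * idot a a) ^+ N / wt3 a.
have K0 : 0 < K by rewrite divr_gt0// exprn_gt0// mulr_gt0.
rewrite -(ler_pM2l K0).
rewrite (_ : K * _ = `|fcos g (qright x a, a) c|).
  apply: (le_trans I); rewrite le_eqVlt; apply/orP; left; apply/eqP.
  rewrite /K !exprMn exprVn; field.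
  by rewrite expf_neq0// gt_eqF.
rewrite gE/= qdot_qright -{1}(gtr0_norm K0) -normrM; congr Num.norm.
by rewrite /K !exprMn; ring.
Qed.

Lemma continuous_idot t : continuous (idot t).
Proof.
rewrite (_ : idot t = (fun a => t.1.1 * a.1.1 + t.1.2 * a.1.2 + t.2 * a.2)).
  have c1 := continuous_fst' (continuous_fst' (@continuous_id' (imquat R))).
  have c2 := continuous_snd' (continuous_fst' (@continuous_id' (imquat R))).
  have c3 := continuous_snd' (@continuous_id' (imquat R)).
  exact: (continuousD' (continuousD' (continuousM' (@continuous_cst' _ _ _) c1)
    (continuousM' (@continuous_cst' _ _ _) c2)) (continuousM' (@continuous_cst' _ _ _) c3)).
by apply/funext => a; exact: idotE.
Qed.

Lemma continuous_fcos_qright f x t : rschwartz f ->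
  continuous (fun a => fcos f (qright x a, a) (- idot a t)).
Proof.
move=> sf.
apply: (@continuous_Rintegral R _ _ (heis_leb R) (imquat R)
  (fun a z => f z * cos (- idot a t + hdot z (qright x a, a))) (fun z => `|f z|)).
- move=> a; apply: measurable_heis; apply: continuous_trig; first exact: continuous_cos.
  exact: rschwartz_continuous.
- move=> z; apply: continuousM'; first exact: continuous_cst'.
  apply: continuous_comp2 (@continuous_cos R).
  (* Although a also enters through [qright x a], the whole phase is linear in a. *)
  have E a : - idot a t + hdot z (qright x a, a) = idot (twist z.1 x + z.2 - t) a.
    by rewrite !idotDl idot_twist (idotC a) /hdot/= !idotE/=; ring.
  by under eq_fun do rewrite E; exact: continuous_idot.
- by move=> a z; apply: le_mul_bound (cos_max _).
- exact: integrable_norm (rschwartz_integrable sf).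
Qed.

Lemma rradon_decay N f : rstar f ->
  exists M, forall z, `|qdot z.1 z.1 ^+ N * rradon f z| <= M.
Proof.
move=> rf; have [C C0 HC] := fcos_qright_decay N rf; have sf := rstar_rschwartz rf.
have [C' C'0 HC'] := fcos_wt3 rf.
have iw := rintegrableZ C (rintegrable_wt3 R).
have p0 : 0 < (2 * pi : R) ^+ 3 by rewrite exprn_gt0// mulr_gt0// pi_gt0.
exists (\int[imquat_leb R]_a (C * wt3 a) / (2 * pi) ^+ 3) => -[x t] /=.
rewrite ler_pdivlMr// mulrC -{1}(gtr0_norm p0) -normrM mulrCA rradon_inversion//.
pose I a := fcos f (qright x a, a) (- idot a t).
have mI := measurable_imquat (continuous_fcos_qright (x := x) (t := t) sf).
have iI : rintegrable (imquat_leb R) I.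
  exact: rintegrable_le mI (fun a => HC' _ _) (rintegrableZ C' (rintegrable_wt3 R)).
rewrite -(RintegralZl _ measurableT iI).
have iqI := rintegrableZ (qdot x x ^+ N) iI.
apply: (le_trans (le_normr_Rintegral measurableT iqI)).
apply: (le_Rintegral measurableT (integrable_norm iqI) iw) => a _; exact: HC.
Qed.

(** The induction keeps N arbitrary to pay for a factor x_j: |x_j| <= 1 + |x|^2 trades it for one
    more power of |x|^2. *)
Lemma xspan_decay N g : xspan g -> exists M, forall z, `|qdot z.1 z.1 ^+ N * g z| <= M.
Proof.
move=> sg; elim: sg N => {g}.
- by move=> f rf N; exact: rradon_decay.
- move=> f g _ IHf _ IHg N; have [M HM] := IHf N; have [M' HM'] := IHg N.
  by exists (M + M') => z; rewrite mulrDr (le_trans (ler_normD _ _))// lerD.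
- move=> c f _ IH N; have [M HM] := IH N.
  by exists (`|c| * M) => z; rewrite mulrCA normrM ler_wpM2l.
- move=> j f _ IH N; have [M HM] := IH N; have [M' HM'] := IH N.+1.
  exists (M + M') => z.
  have x1 : `|hcoord z (xi j)| <= 1 + qdot z.1 z.1.
    have : hcoord z (xi j) ^+ 2 <= qdot z.1 z.1.
      rewrite qdotE !hcoordE -!expr2.
      have := sqr_ge0 z.1.1.1.1; have := sqr_ge0 z.1.1.1.2; have := sqr_ge0 z.1.1.2; have := sqr_ge0 z.1.2.
      by case: j => -[|[|[|[|//]]]] lt /=; lra.
    rewrite -real_normK ?num_real//; have := sqr_ge0 (`|hcoord z (xi j)| - 1); nra.
  rewrite mulrCA normrM; apply: (le_trans (ler_wpM2r (normr_ge0 _) x1)).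
  rewrite mulrDl mul1r lerD//; apply: le_trans (HM' z).
  by rewrite exprS -mulrA [leRHS]normrM (@ger0_norm _ (qdot _ _) (qdot_ge0 _)).
Qed.

Lemma xspan_hmonom (al : 'I_7 -> nat) g : xspan g -> xspan (fun z => hmonom al z * g z).
Proof.
move=> sg; rewrite /hmonom.
have key (s : seq 'I_7) : xspan (fun z => \prod_(i <- s) hcoord z i ^+ al i * g z).
  elim: s => [|i s IH].
    by under eq_fun do rewrite big_nil mul1r.
  under eq_fun do rewrite big_cons -mulrA.
  elim: (al i) => [|n IHn]; first by under eq_fun do rewrite expr0 mul1r.
  by under eq_fun do rewrite exprS -mulrA; exact: xspan_hcoord.
exact: key.
Qed.

(** The class absorbs every monomial, t included, so boundedness of all its members (N = 0) is
    already rapid decay. *)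
Lemma xspan_rapid g : xspan g -> rapid g.
Proof.
move=> sg al; have [M HM] := xspan_decay 0 (xspan_hmonom al sg).
by exists M => z; have := HM z; rewrite expr0 mul1r.
Qed.

(** Coinduction up to span based on the Radon transforms alone: their derivatives lie in [xspan],
    which is contained in the span of [P]. *)
Lemma xspan_rschwartz g : xspan g -> rschwartz g.
Proof.
pose P h := exists2 f : heis R -> R, rstar f & h = rradon f.
have sub h : xspan h -> hspan P h.
  elim=> {h}.
  - by move=> f rf; apply: hspan_base; exists f.
  - by move=> f h _ Hf _ Hh; exact: hspanD.
  - by move=> c f _ Hf; exact: hspanZ.
  - by move=> j f _ Hf; exact: hspan_hcoord.
move=> /sub; apply: rschwartz_span => _ [f rf ->].
have [cr dr xr] := rradon_regular rf; split => //.
- by move=> i; exact: sub.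
- exact/xspan_rapid/xspan_rradon.
Qed.

Lemma xspan_null g : xspan g -> null_integral g.
Proof.
elim=> {g}.
- exact: null_integral_rradon.
- move=> f g xf nf xg ng x.
  rewrite (RintegralD measurableT (rschwartz_slice x (xspan_rschwartz xf)) (rschwartz_slice x (xspan_rschwartz xg))).
  by rewrite nf ng addr0.
- move=> c f xf nf x.
  by rewrite (RintegralZl _ measurableT (rschwartz_slice x (xspan_rschwartz xf))) nf mulr0.
- move=> j f xf nf x; under eq_Rintegral do rewrite hcoord_xi/=.
  by rewrite (RintegralZl _ measurableT (rschwartz_slice x (xspan_rschwartz xf))) nf mulr0.
Qed.

(** Multiplication by t stays in [xspan], so each moment of R f is the t-integral of a member of
    that class. Such integrals vanish, since a factor in x comes out of the t-integral. *)
Lemma rstar_rradon f : rstar f -> rstar (rradon f).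
Proof.
move=> rf; have xf := xspan_rradon rf; split; first exact: xspan_rschwartz.
move=> L; apply: xspan_null.
by elim: L (rradon f) xf => //= l L IH g xg; apply: IH; exact: xspan_t.
Qed.

End rradon_rschwartz.

(** * Inversion of the real Radon transform *)

Section rradon_bijective.
Context (R : realType).
Implicit Types (x y : quat R) (t a : imquat R) (z w : heis R) (f g h : heis R -> R).
Implicit Types (c : R).

Lemma multiplier_idot : multiplier (fun w : heis R => idot w.2 w.2).
Proof.
rewrite (_ : (fun w => _) = (fun w => hcoord w (ti 0) ^+ 2 + hcoord w (ti 1) ^+ 2 +
  hcoord w (ti 2) ^+ 2)).
  pose m2 l := multiplier_hcoord2 (R := R) (ti l).
  exact: multiplierD (multiplierD (m2 0) (m2 1)) (m2 2).
by apply/funext => w; rewrite idotE !hcoordE.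
Qed.

Lemma wt4_decay x : (1 + qdot x x) ^- 4 <= wt4 x.
Proof.
rewrite /wt4 /wt1 -!invfM lef_pV2 ?posrE; last 2 first.
- by rewrite exprn_gt0// ltr_pwDl// qdot_ge0.
- by rewrite !mulr_gt0// ltr_pwDl// sqr_ge0.
have s0 := sqr_ge0 x.1.1.1; have s1 := sqr_ge0 x.1.1.2; have s2 := sqr_ge0 x.1.2; have s3 := sqr_ge0 x.2.
have q : qdot x x = x.1.1.1 ^+ 2 + x.1.1.2 ^+ 2 + x.1.2 ^+ 2 + x.2 ^+ 2 by rewrite qdotE !expr2.
rewrite (_ : (1 + qdot x x) ^+ 4 = (1 + qdot x x) * (1 + qdot x x) * (1 + qdot x x) * (1 + qdot x x)); last by ring.
by repeat apply: ler_pM; rewrite ?mulr_ge0//; lra.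
Qed.

(** Makes the y-integral of the inversion absolutely convergent. The multiplier (1 + |w.1|^2)^4
    provides one power for each factor of [wt4], and |2 y a| = 2 |a| |y| turns decay in the
    frequency into decay in y as long as a is not 0. *)
Lemma fcos_wt4 f a : rstar f -> a != 0 ->
  exists2 C, 0 <= C & forall y c, `|fcos f (qright y a, a) c| <= C * wt4 y.
Proof.
move=> rf a0; have d0 : 0 < idot a a by rewrite lt_neqAle idot_ge0 andbT eq_sym idot_eq0.
have [g rg gE] := multiplierX 4 (multiplierD (@multiplier1 R) (@multiplier_qdot R)) rf.
have [C C0 HC] := fcos_bounded (rstar_rschwartz rg).
(* Chosen so that 1 + 4 |a|^2 |y|^2, multiplied by B, dominates 1 + |y|^2. *)
pose B := 1 + (4 * idot a a)^-1.
have B0 : 0 <= B by rewrite addr_ge0// invr_ge0 mulr_ge0// ltW.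
exists (C * B ^+ 4) => [|y c]; first by rewrite mulr_ge0// exprn_ge0.
have := HC (qright y a, a) c; rewrite gE/= qdot_qright normrM.
set Q := 1 + _; have y0 := qdot_ge0 y.
have Q0 : 0 < Q by rewrite ltr_pwDl// !mulr_ge0// ltW.
rewrite (gtr0_norm (exprn_gt0 4 Q0)) mulrC -ler_pdivlMr ?exprn_gt0// => /le_trans; apply.
rewrite -mulrA ler_wpM2l//; apply: le_trans (ler_wpM2l (exprn_ge0 4 B0) (wt4_decay y)).
rewrite -!exprVn -exprMn; apply: lerXn2r; rewrite ?nnegrE ?invr_ge0 ?mulr_ge0 ?invr_ge0//.
- exact: ltW.
- by rewrite addr_ge0.
rewrite ler_pdivlMr ?ltr_pwDl// mulrC ler_pdivrMr// /B /Q.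
rewrite (_ : _ * _ = 1 + (4 * idot a a)^-1 + (1 + 4 * idot a a) * qdot y y); last first.
  by field; rewrite gt_eqF.
have : 0 <= (4 * idot a a)^-1 by rewrite invr_ge0 mulr_ge0// ltW.
have := mulr_ge0 (ltW d0) y0; lra.
Qed.

(** Right multiplication by an imaginary quaternion is skew-adjoint. *)
Lemma qdot_qright_swap x y a : qdot x (qright y a) = - qdot y (qright x a).
Proof. by rewrite !qrightE !qdotE/=; ring. Qed.

Lemma quat_eq x y : x.1.1.1 = y.1.1.1 -> x.1.1.2 = y.1.1.2 -> x.1.2 = y.1.2 -> x.2 = y.2 -> x = y.
Proof. by case: x => [[[? ?] ?] ?]; case: y => [[[? ?] ?] ?] /= -> -> -> ->. Qed.

Lemma qrightB x y a : qright (x - y) a = qright x a - qright y a.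
Proof.
by apply: quat_eq; rewrite !qrightE/=; ring.
Qed.

Lemma qdotBr x y y' : qdot x (y - y') = qdot x y - qdot x y'.
Proof. by rewrite !qdotE/=; ring. Qed.

Definition slice_cos h a c x : R := \int[imquat_leb R]_t (h (x, t) * cos (c + idot t a)).

Lemma slice_cos_fcos h a c x :
  slice_cos h a c x = \int[imquat_leb R]_t (h (x, t) * cos (c + hdot (x, t) (0, a))).
Proof. by apply: eq_Rintegral => t _; rewrite /hdot/= qdot0r add0r. Qed.

Lemma slice_cos_regular h a c : rschwartz h ->
  continuous (slice_cos h a c) /\ exists M, forall x, `|slice_cos h a c x| <= M.
Proof.
move=> sh; have [M M0 HM] := rapid_wt7_ge0 (rschwartz_rapid sh).
have iw := rintegrableZ M (rintegrable_wt3 R).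
have HM3 x t : `|h (x, t) * cos (c + idot t a)| <= M * wt3 t.
  apply: le_mul_bound (cos_max _); apply: (le_trans (HM _)).
  by rewrite ler_wpM2l// /wt7/= ler_piMl ?wt4_le1// ltW// wt3_gt0.
have cE x : (fun t => h (x, t) * cos (c + idot t a)) = (fun t => h (x, t) * cos (c + hdot (x, t) (0, a))).
  by apply/funext => t; rewrite /hdot/= qdot0r add0r.
have ism x : rintegrable (imquat_leb R) (fun t => h (x, t) * cos (c + idot t a)).
  by rewrite cE; exact: fcos_slice.
split.
  apply: (@continuous_Rintegral R _ _ (imquat_leb R) (quat R)
    (fun x t => h (x, t) * cos (c + idot t a)) (fun t => M * wt3 t)) => //.
  - by move=> x; exact: rintegrable_measurable (ism x).
  - move=> t; apply: continuousM'; last exact: continuous_cst'.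
    exact: continuous_comp2 (@continuous_pairr _ _ t) (rschwartz_continuous sh).
exists (\int[imquat_leb R]_t (M * wt3 t)) => x.
apply: (le_trans (le_normr_Rintegral measurableT (ism x))).
by apply: (le_Rintegral measurableT (integrable_norm (ism x)) iw) => t _; exact: HM3.
Qed.

(** Fubini with t inside: the inner integral is a t-transform of R h (y, .), and the slice formula
    replaces it by a transform of h. *)
Lemma fcos_rradon h x a c : rstar h -> fcos (rradon h) (qright x a, a) c =
  \int[quat_leb R]_y fcos h (qright y a, a) (c + qdot y (qright x a)).
Proof.
move=> rh; have sh := rstar_rschwartz rh.
rewrite (fcos_fubini _ _ (rstar_rschwartz (rstar_rradon rh))).2.
apply: eq_Rintegral => y _; rewrite -(rradon_fourier y a _ sh).2.
by apply: eq_Rintegral => t _; rewrite /hdot/= addrA.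
Qed.

Lemma measurable_qdot d (T : measurableType d) (p q : T -> measurableTypeR R * measurableTypeR R * measurableTypeR R * measurableTypeR R) :
  measurable_fun setT p -> measurable_fun setT q ->
  measurable_fun setT (fun s => qdot (p s) (q s)).
Proof.
move=> mp mq.
rewrite (_ : (fun s => _) = (fun s => idot (p s).1 (q s).1 + (p s).2 * (q s).2)); last first.
  by apply/funext => s; rewrite qdotE idotE.
apply: measurable_funD; last exact: measurable_funM (measurableT_comp measurable_snd mp) (measurableT_comp measurable_snd mq).
exact: measurable_idot (measurableT_comp measurable_fst mp) (measurableT_comp measurable_fst mq).
Qed.

Lemma continuous_qdot y : continuous (fun x => qdot x y).
Proof.
rewrite (_ : (fun x => _) = (fun x : quat R => x.1.1.1 * y.1.1.1 + x.1.1.2 * y.1.1.2 + x.1.2 * y.1.2 + x.2 * y.2)).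
  have c0 := continuous_fst' (continuous_fst' (continuous_fst' (@continuous_id' (quat R)))).
  have c1 := continuous_snd' (continuous_fst' (continuous_fst' (@continuous_id' (quat R)))).
  have c2 := continuous_snd' (continuous_fst' (@continuous_id' (quat R))).
  have c3 := continuous_snd' (@continuous_id' (quat R)).
  exact: (continuousD' (continuousD' (continuousD' (continuousM' c0 (@continuous_cst' _ _ _))
    (continuousM' c1 (@continuous_cst' _ _ _))) (continuousM' c2 (@continuous_cst' _ _ _)))
    (continuousM' c3 (@continuous_cst' _ _ _))).
by apply/funext => x; exact: qdotE.
Qed.

Lemma continuous_qright x a : continuous (fun z : heis R => qright (x - z.1) a).
Proof.
(* The component of [qright q a] along a unit quaternion e is <e, qright q a> = - <q, qright e a>,
   and the latter is an inner product of q with a fixed vector. *)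
have key (e : quat R) : continuous (fun z : heis R => - qdot (x - z.1) (qright e a)).
  apply: continuousN'; apply: continuous_comp2 (@continuous_qdot _) => z.
  by apply: cvgB; [exact: cvg_cst|exact: cvg_fst].
rewrite (_ : (fun z => _) = (fun z => (- qdot (x - z.1) (qright (1, 0, 0, 0) a),
  - qdot (x - z.1) (qright (0, 1, 0, 0) a), - qdot (x - z.1) (qright (0, 0, 1, 0) a),
  - qdot (x - z.1) (qright (0, 0, 0, 1) a)))).
  by do 3?(apply: continuous_pair; last exact: key).
by apply/funext => z; apply: quat_eq; rewrite !qdotE !qrightE/=; ring.
Qed.

Lemma measurable_heis_quat (u : heis R -> quat R) : continuous u ->
  @measurable_fun _ _ (measurableTypeR R * measurableTypeR R * measurableTypeR R * measurableTypeR R * (measurableTypeR R * measurableTypeR R * measurableTypeR R))%type (measurableTypeR R * measurableTypeR R * measurableTypeR R * measurableTypeR R)%type setT u.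
Proof.
move=> cu; have c1 := continuous_fst' cu; have c2 := continuous_fst' c1.
rewrite (_ : u = (fun z => ((u z).1.1.1, (u z).1.1.2, (u z).1.2, (u z).2))); last first.
  by apply/funext => z; case: (u z) => [[[? ?] ?] ?].
apply: measurable_fun_pair; last exact: measurable_heis (continuous_snd' cu).
apply: measurable_fun_pair; last exact: measurable_heis (continuous_snd' c1).
apply: measurable_fun_pair; last exact: measurable_heis (continuous_snd' c2).
exact: measurable_heis (continuous_fst' c2).
Qed.

(** [fcos_rradon] writes the left transform as a y-integral of transforms of h. By skew-adjointness
    the phases combine into al z + <y, (x - z.1) acted on by qright>, so Gaussian regularization in
    y concentrates at z.1 = x with la = 2 |a|. This leaves (2 pi / la)^4 times the transform in t of
    h (x, .). *)
Lemma rradon_recover_slice h x a c : rstar h ->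
  idot a a ^+ 2 * fcos (rradon h) (qright x a, a) c = pi ^+ 4 * slice_cos h a c x.
Proof.
move=> rh; have sh := rstar_rschwartz rh.
(* At a = 0 the similarity degenerates; both sides vanish there, the right one by the zeroth
   moment. *)
have [a0|a0] := eqVneq a 0.
  rewrite a0 idot0r expr0n mul0r slice_cos_fcos.
  have E t : h (x, t) * cos (c + hdot (x, t) (0, 0)) = cos c * h (x, t).
    by rewrite mulrC /hdot/= qdot0r idot0r !addr0.
  under eq_Rintegral do rewrite E.
  by rewrite (RintegralZl _ measurableT (rschwartz_slice x sh)) (rh.2 [::] x) !mulr0.
have d0 : 0 < idot a a by rewrite lt_neqAle idot_ge0 andbT eq_sym idot_eq0.
have [G0 G00 HG] := fcos_wt4 rh a0.
have [ck [M HM]] := slice_cos_regular a c sh.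
pose al z := c + idot z.2 a.
pose u z := qright (x - z.1) a.
pose la := 2 * Num.sqrt (idot a a).
have la0 : 0 < la by rewrite mulr_gt0// sqrtr_gt0.
have la2 : la ^+ 2 = 4 * idot a a by rewrite exprMn sqr_sqrtr ?ltW//; ring.
have uE z : qdot (u z) (u z) = la ^+ 2 * qdot (z.1 - x) (z.1 - x).
  by rewrite /u qdot_qright la2 !qdotE/=; ring.
have phase y z : c + qdot y (qright x a) + hdot z (qright y a, a) = al z + qdot y (u z).
  by rewrite /al /u qrightB qdotBr /hdot/= (qdot_qright_swap z.1); ring.
have IE y : \int[heis_leb R]_z (h z * cos (al z + qdot y (u z))) =
    fcos h (qright y a, a) (c + qdot y (qright x a)).
  by apply: eq_Rintegral => z _; rewrite phase.
have IG y : `|\int[heis_leb R]_z (h z * cos (al z + qdot y (u z)))| <= G0 * wt4 y.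
  by rewrite IE; exact: HG.
have cal : continuous al.
  rewrite (_ : al = (fun z => c + hdot z (0, a))); first exact: continuous_phase.
  by apply/funext => z; rewrite /hdot/= qdot0r add0r.
have mdot : measurable_fun setT (fun p : (measurableTypeR R * measurableTypeR R * measurableTypeR R * measurableTypeR R) *
   (measurableTypeR R * measurableTypeR R * measurableTypeR R * measurableTypeR R * (measurableTypeR R * measurableTypeR R * measurableTypeR R)) => qdot p.1 (u p.2)).
  apply: measurable_qdot; first exact: measurable_fst.
  exact: (measurableT_comp (measurable_heis_quat (continuous_qright (x := x) (a := a))) measurable_snd).
have gk := gaussian_kernel_quat R.
have ih := rschwartz_integrable sh.
have c1 := @gaussian_inversion R _ _ _ _ (heis_leb R) (quat_leb R) _ _ _ h al _ u gk
  (@qdot_ge0 R) ih (measurable_heis cal) mdot IG (rintegrableZ G0 (rintegrable_wt4 R)).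
have msq : measurable_fun setT (fun y : measurableTypeR R * measurableTypeR R * measurableTypeR R * measurableTypeR R => qdot (y - x) (y - x)).
  have mB : measurable_fun setT (fun y : measurableTypeR R * measurableTypeR R * measurableTypeR R * measurableTypeR R => (y - x : quat R) : measurableTypeR R * measurableTypeR R * measurableTypeR R * measurableTypeR R).
    under eq_fun do rewrite addrC; by have [] := scales_quatD (- x).
  exact: (measurable_qdot mB mB).
have c2 := @gaussian_limit R _ _ (quat_leb R) _ _ 4 (slice_cos h a c) (fun y => qdot (y - x) (y - x))
  (fun r v => x + r *: v) 0 (slice_cos h a c x) M la gk (@qdot0r R) (qdot0r 0) la0.
have sA (r : R) : 0 < r -> scales_measure (quat_leb R) (fun v : quat R => x + r *: v) (r^-1 ^+ 4).
  by move=> r0; exact: scales_quat.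
have sqA (r : R) (v : quat R) : qdot (x + r *: v - x) (x + r *: v - x) = r ^+ 2 * qdot v v.
  by rewrite addrC addKr !qdotE/= /GRing.scale/=; ring.
have kA (v : quat R) (r : nat -> R) : r @ \oo --> 0 ->
    (fun n => slice_cos h a c (x + r n *: v)) @ \oo --> slice_cos h a c x.
  move=> r0; apply: (@cvg_comp _ _ _ (fun n => x + r n *: (v : quat R)) (slice_cos h a c) _ (nbhs x)); last exact: ck.
  exact: cvg_shift.
have c2' := c2 sA sqA (measurable_quat ck) msq HM kA.
have H : fcos (rradon h) (qright x a, a) c = (2 * pi / la) ^+ 4 * slice_cos h a c x.
  rewrite fcos_rradon//.
  under eq_Rintegral do rewrite -IE.
  apply: (cvg_unique _ c1) => //.
  (* The Gaussian depends on z.1 only: integrating out t first turns the average over R^7 into an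
     average of [slice_cos] over R^4, which is the sequence of [c2']. *)
  rewrite (_ : (fun m => _) = (fun m : nat => \int[quat_leb R]_y (slice_cos h a c y *
     ((Num.sqrt pi / m.+1%:R^-1) ^+ 4 *
      expR (- ((la ^+ 2 * qdot (y - x) (y - x)) / (4 * m.+1%:R^-1 ^+ 2))))))) //.
  apply/funext => m; set K := (Num.sqrt pi / _) ^+ 4; set e := m.+1%:R^-1.
  pose E (y : quat R) := K * expR (- (la ^+ 2 * qdot (y - x) (y - x) / (4 * e ^+ 2))).
  rewrite -[RHS]/(\int[quat_leb R]_y (slice_cos h a c y * E y)).
  pose F z := h z * cos (c + hdot z (0, a)) * E z.1.
  have e0 : 0 < e by rewrite invr_gt0.
  have K0 : 0 <= K by rewrite exprn_ge0// divr_ge0// ?sqrtr_ge0// ltW.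
  have EK y : `|E y| <= K.
    rewrite normrM (ger0_norm K0) ler_piMr// ger0_norm ?expR_ge0// -expR0 ler_expR oppr_le0.
    by rewrite divr_ge0// mulr_ge0// ?sqr_ge0// qdot_ge0.
  have FE z : h z * cos (al z) * (K * expR (- (qdot (u z) (u z) / (4 * e ^+ 2)))) = F z.
    by rewrite /F /E uE /al /hdot/= qdot0r add0r.
  have iF : rintegrable (heis_leb R) F.
    have mE : measurable_fun setT (E : measurableTypeR R * measurableTypeR R * measurableTypeR R * measurableTypeR R -> R).
      apply: measurable_funM => //; apply: measurableT_comp => //.
      apply: measurable_funN; apply: measurable_funM => //.
      exact: measurable_funM.
    have mF : measurable_fun setT (F : measurableTypeR R * measurableTypeR R * measurableTypeR R * measurableTypeR R * (measurableTypeR R * measurableTypeR R * measurableTypeR R) -> R).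
      apply: measurable_funM; last exact: measurableT_comp mE measurable_fst.
      exact: rintegrable_measurable (fcos_integrable (0, a) c sh).
    refine (rintegrable_le mF (_ : forall z, `|F z| <= K * `|h z|) (rintegrableZ K (integrable_norm ih))).
    move=> z; rewrite /F normrM mulrC; apply: ler_pM => //.
    exact: le_mul_bound (cos_max _).
  have sF y : rintegrable (imquat_leb R) (fun t => F (y, t)).
    have := rintegrableZ (E y) (fcos_slice y (0, a) c sh).
    by congr rintegrable; apply/funext => t; rewrite mulrC.
  under eq_Rintegral do rewrite FE.
  have [_ FF] := @Rfubini R _ _ _ _ (quat_leb R) (imquat_leb R) F iF sF.
  rewrite -[LHS]/(\int[heis_leb R]_z F z); etransitivity; first exact: FF.
  apply: eq_Rintegral => y _; rewrite slice_cos_fcos [RHS]mulrC.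
  rewrite -(RintegralZl _ measurableT (fcos_slice y (0, a) c sh)).
  by apply: eq_Rintegral => t _; rewrite [RHS]mulrC.
rewrite H mulrA; congr (_ * _).
rewrite (_ : idot a a = la ^+ 2 / 4); last by rewrite la2; field.
by field; exact: lt0r_neq0.
Qed.

(** [g] is R h multiplied by the symbol |a|^4 on the Fourier side. By the slice formula and
    [rradon_recover_slice], R g (x, .) and pi^4 h (x, .) have the same transforms in t, so
    [slice_unique] applies. The transform of [g] is kept in the conclusion because it depends on h
    only through R h, which gives injectivity. *)
Lemma rradon_recover h : rstar h -> exists g, [/\ rstar g,
  forall w c, fcos g w c = (idot w.2 w.2) ^+ 2 * fcos (rradon h) w c &
  forall z, rradon g z = pi ^+ 4 * h z].
Proof.
move=> rh; have [g rg gE] := multiplierX 2 multiplier_idot (rstar_rradon rh).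
exists g; split => // -[x t]; have sg := rstar_rschwartz rg; have sh := rstar_rschwartz rh.
have i1 := rradon_integrable x sg.
have i2 := rintegrableZ (- pi ^+ 4) (rschwartz_slice x sh).
have [M HM] := rradon_bounded sg; have [M' HM'] := rapid_bounded (rschwartz_rapid sh).
apply/eqP; rewrite -subr_eq0 -mulNr; apply/eqP.
apply: (@slice_unique R (fun t => rradon g (x, t) + - pi ^+ 4 * h (x, t)) (M + pi ^+ 4 * M') _ _ (rintegrableD i1 i2)).
- apply: continuousD'.
    exact: continuous_comp2 (@continuous_pairl _ _ x) (continuous_rradon sg).
  apply: continuousM'; first exact: continuous_cst'.
  exact: continuous_comp2 (@continuous_pairl _ _ x) (rschwartz_continuous sh).
- move=> s; apply: (le_trans (ler_normD _ _)); apply: lerD => //.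
  have p4 : 0 <= pi ^+ 4 :> R by rewrite exprn_ge0// pi_ge0.
  by rewrite mulNr normrN normrM (ger0_norm p4) ler_wpM2l.
move=> a c; have [j1 E1] := rradon_fourier x a c sg.
have j2 : rintegrable (imquat_leb R) (fun s => h (x, s) * cos (c + idot s a)).
  have := fcos_slice x (0, a) c sh.
  by congr rintegrable; apply/funext => s; rewrite /hdot/= qdot0r add0r.
have E s : (rradon g (x, s) + - pi ^+ 4 * h (x, s)) * cos (c + idot s a) =
   rradon g (x, s) * cos (c + idot s a) + - pi ^+ 4 * (h (x, s) * cos (c + idot s a)) by ring.
under eq_Rintegral do rewrite E.
rewrite (RintegralD measurableT j1 (rintegrableZ _ j2)) (RintegralZl _ measurableT j2) E1 gE.
by rewrite rradon_recover_slice// mulNr subrr.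
Qed.

Lemma rradon_surj h : rstar h -> exists2 g, rstar g & forall z, rradon g z = h z.
Proof.
move=> rh; have [g [rg _ gE]] := rradon_recover rh.
exists (fun z => pi ^- 4 * g z); first exact: rstarZ.
move=> z; rewrite rradonZ; last exact: rstar_rschwartz.
by rewrite gE mulKf// expf_neq0// gt_eqF// pi_gt0.
Qed.

(** The functions [g], [g'] recovered from R f = R h have equal transforms; by t-inversion their
    Radon transforms agree, and these are pi^4 f and pi^4 h. *)
Lemma rradon_inj f h : rstar f -> rstar h -> (forall z, rradon f z = rradon h z) ->
  forall z, f z = h z.
Proof.
move=> rf rh fh z; have [g [rg gE g1]] := rradon_recover rf; have [g' [rg' gE' g1']] := rradon_recover rh.
have p0 : pi ^+ 4 != 0 :> R by rewrite expf_neq0// gt_eqF// pi_gt0.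
apply: (mulfI p0); rewrite -g1 -g1'; case: z => x t.
have q0 : (2 * pi) ^+ 3 != 0 :> R by rewrite expf_neq0// mulf_neq0// gt_eqF// pi_gt0.
apply: (mulfI q0); rewrite (rradon_inversion x t rg) (rradon_inversion x t rg'); apply: eq_Rintegral => a _.
by rewrite gE gE' (_ : rradon f = rradon h)//; exact/funext.
Qed.

End rradon_bijective.

(** * Complex-valued functions *)

Section complex_valued.
Context (R : realType).
Implicit Types (x y : quat R) (t a : imquat R) (z w : heis R) (h u v : heis R -> R).
Implicit Types (f g : heis R -> R[i]) (c : R).

Local Notation re f := (fun z => complex.Re (f z)).
Local Notation im f := (fun z => complex.Im (f z)).

Lemma complex_eqP (p q : R[i]) : complex.Re p = complex.Re q -> complex.Im p = complex.Im q -> p = q.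
Proof. by case: p => a b; case: q => a' b' /= -> ->. Qed.

Lemma re_scaler (p : R[i]) (r : R) : complex.Re (p * r%:C%C) = complex.Re p * r.
Proof. by case: p => a b /=; rewrite mulr0 subr0. Qed.

Lemma im_scaler (p : R[i]) (r : R) : complex.Im (p * r%:C%C) = complex.Im p * r.
Proof. by case: p => a b /=; rewrite mulr0 add0r. Qed.

Lemma le_normc_scale (m a b M : R) : (`|m%:C%C * Complex a b| <= M%:C%C) =
  (Num.sqrt ((m * a) ^+ 2 + (m * b) ^+ 2) <= M).
Proof. by rewrite normc_def lecR /= !mul0r subr0 addr0. Qed.

Lemma normr_sqrt_l (a b : R) : `|a| <= Num.sqrt (a ^+ 2 + b ^+ 2).
Proof. by rewrite -sqrtr_sqr ler_wsqrtr// lerDl sqr_ge0. Qed.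

Lemma le_sqrt_add (a b M M' : R) : `|a| <= M -> `|b| <= M' ->
  Num.sqrt (a ^+ 2 + b ^+ 2) <= M + M'.
Proof.
move=> aM bM; have M0 : 0 <= M + M' by rewrite addr_ge0// (le_trans _ aM, le_trans _ bM).
rewrite -(ger0_norm M0) -sqrtr_sqr ler_wsqrtr//.
rewrite -(real_normK (num_real a)) -(real_normK (num_real b)).
have := normr_ge0 a; have := normr_ge0 b; nra.
Qed.

(** The shape in which values at w and - w arrive: the even parts agree, the odd parts change
    sign. *)
Lemma sum_diff_inj (p q p' q' : R) : p - q = p' - q' -> p - - q = p' - - q' -> p = p' /\ q = q'.
Proof. by lra. Qed.

Lemma schwartzP f : schwartz f <-> rschwartz (re f) /\ rschwartz (im f).
Proof.
split=> [[sr si H]|[[sr rr] [si ri]]]; last first.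
  split; [exact: sr|exact: si|move=> al l]; have [M HM] := rr l al; have [M' HM'] := ri l al.
  exists (M + M') => z; rewrite le_normc_scale.
  exact: le_sqrt_add (HM z) (HM' z).
split.
- split; [exact: sr|move=> l al]; have [M HM] := H al l; exists M => z.
  by have := HM z; rewrite le_normc_scale; apply: le_trans; exact: normr_sqrt_l.
- split; [exact: si|move=> l al]; have [M HM] := H al l; exists M => z.
  by have := HM z; rewrite le_normc_scale; apply: le_trans; rewrite addrC; exact: normr_sqrt_l.
Qed.

Lemma schwartz_lstarP f : schwartz_lstar f <-> rstar (re f) /\ rstar (im f).
Proof.
have E x s : cintegral (imquat_leb R) (fun t => f (x, t) * (imonom s t)%:C%C) =
    Complex (\int[imquat_leb R]_t (complex.Re (f (x, t)) * imonom s t))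
     (\int[imquat_leb R]_t (complex.Im (f (x, t)) * imonom s t)).
  by congr Complex; apply: eq_Rintegral => t _; rewrite ?re_scaler ?im_scaler.
split=> [[/schwartzP[sr si] H]|[/rstarP[sr nr] /rstarP[si ni]]].
  by split; apply/rstarP; split=> // x s; have := H x s; rewrite E => -[].
split; first exact/schwartzP.
by move=> x s; rewrite E nr ni.
Qed.

Lemma twistDl y y' x : twist (y + y') x = twist y x + twist y' x.
Proof. by apply: imquat_eq; rewrite !twistE/=; ring. Qed.

Lemma twistxx x : twist x x = 0.
Proof. by apply: imquat_eq; rewrite !twistE/=; ring. Qed.

(** Substitution y |-> x + y with x = [z.1]: it leaves the twist with x unchanged, since Im (conj x
    * x) = 0. *)
Lemma rradon_heis_mul h z : rschwartz h ->
  \int[quat_leb R]_y h (heis_mul z (y, 0)) = rradon h z.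
Proof.
move=> sh; have [_ H] := scales_Rintegral (scales_quatD z.1) (rradon_slice z sh).
rewrite mul1r in H; rewrite -[RHS]H; apply: eq_Rintegral => y _.
by rewrite /heis_mul/= addr0 -/(twist y z.1) twistDl twistxx add0r.
Qed.

Lemma radonE f : schwartz f -> radon f = (fun z => Complex (rradon (re f) z) (rradon (im f) z)).
Proof.
move=> /schwartzP[sr si]; apply/funext => z.
by congr Complex; [exact: (rradon_heis_mul z sr)|exact: (rradon_heis_mul z si)].
Qed.

Lemma radon_lstar f : schwartz_lstar f -> schwartz_lstar (radon f).
Proof.
move=> sf; rewrite radonE; last by case: sf.
by have /schwartz_lstarP[rr ri] := sf; apply/schwartz_lstarP; split; exact: rstar_rradon.
Qed.

Lemma radon_inj f g : schwartz_lstar f -> schwartz_lstar g -> radon f = radon g -> f = g.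
Proof.
move=> sf sg; rewrite !radonE; [|by case: sg|by case: sf].
have /schwartz_lstarP[rf jf] := sf; have /schwartz_lstarP[rg jg] := sg.
move=> H; apply/funext => z; apply: complex_eqP.
- by apply: (rradon_inj rf rg) => {}z; have := congr1 (fun k => complex.Re (k z)) H.
- by apply: (rradon_inj jf jg) => {}z; have := congr1 (fun k => complex.Im (k z)) H.
Qed.

Lemma radon_surj g : schwartz_lstar g -> exists2 f, schwartz_lstar f & radon f = g.
Proof.
move=> /schwartz_lstarP[rg ig].
have [u ru uE] := rradon_surj rg; have [v rv vE] := rradon_surj ig.
have s : schwartz_lstar (fun z => Complex (u z) (v z)) by apply/schwartz_lstarP.
exists (fun z => Complex (u z) (v z)) => //; rewrite radonE; last by case: s.
by apply/funext => z; rewrite /= uE vE; case: (g z).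
Qed.

Lemma sin_cos_phase (r : R) : sin r = cos (- (pi / 2) + r).
Proof. by rewrite addrC cosBpihalf. Qed.

Lemma slice_cos_integrable h a c x : rschwartz h ->
  rintegrable (imquat_leb R) (fun t => h (x, t) * cos (c + idot t a)).
Proof.
move=> sh; have := fcos_slice x (0, a) c sh.
by congr rintegrable; apply/funext => t; rewrite /hdot/= qdot0r add0r.
Qed.

Lemma fourier2E f x a : schwartz f -> fourier2 f (x, a) =
  Complex (slice_cos (re f) a 0 x - slice_cos (im f) a (- (pi / 2)) x)
    (slice_cos (re f) a (- (pi / 2)) x + slice_cos (im f) a 0 x).
Proof.
move=> /schwartzP[sr si]; congr Complex.
- rewrite /slice_cos -(RintegralB measurableT (slice_cos_integrable a _ x sr) (slice_cos_integrable a _ x si)).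
  by apply: eq_Rintegral => t _; case: (f (x, t)) => p q /=; rewrite add0r sin_cos_phase.
- rewrite /slice_cos -(RintegralD measurableT (slice_cos_integrable a _ x sr) (slice_cos_integrable a _ x si)).
  by apply: eq_Rintegral => t _; case: (f (x, t)) => p q /=; rewrite add0r sin_cos_phase.
Qed.

Lemma expiD (r s : R) : expi r * expi s = expi (r + s).
Proof. by apply: complex_eqP; rewrite /= ?cosD ?sinD// addrC. Qed.

Lemma fourierE f w : schwartz f -> fourier f w =
  Complex (fcos (re f) w 0 - fcos (im f) w (- (pi / 2)))
    (fcos (re f) w (- (pi / 2)) + fcos (im f) w 0).
Proof.
move=> /schwartzP[sr si].
have E z : f z * expi (qdot z.1 w.1) * expi (idot z.2 w.2) = f z * expi (hdot z w).
  by rewrite -mulrA expiD.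
congr Complex.
- rewrite /fcos -(RintegralB measurableT (fcos_integrable w _ sr) (fcos_integrable w _ si)).
  by apply: eq_Rintegral => z _; rewrite E; case: (f z) => p q /=; rewrite add0r sin_cos_phase.
- rewrite /fcos -(RintegralD measurableT (fcos_integrable w _ sr) (fcos_integrable w _ si)).
  by apply: eq_Rintegral => z _; rewrite E; case: (f z) => p q /=; rewrite add0r sin_cos_phase.
Qed.

Lemma fourier2_radon f x a : schwartz_lstar f ->
  fourier2 (radon f) (x, a) = fourier f (qright x a, a).
Proof.
move=> sf; have sRf := radon_lstar sf.
have [s1 _] := sf; have [s2 _] := sRf.
rewrite fourier2E// fourierE// radonE//=; have /schwartzP[sr si] := s1.
by rewrite /slice_cos !(rradon_fourier _ _ _ sr).2 !(rradon_fourier _ _ _ si).2.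
Qed.

Lemma fourier_null f x : schwartz_lstar f -> fourier f (x, 0) = 0.
Proof.
move=> sf; have /schwartz_lstarP[[sr nr] [si ni]] := sf.
rewrite fourierE; last by case: sf.
by rewrite !(fcos_null _ _ (nr [::]) sr) !(fcos_null _ _ (ni [::]) si) subr0 addr0.
Qed.

(** For an imaginary quaternion t * t = - |t|^2, which cancels both the factor - 2 and the
    denominator. *)
Lemma qright_half x t : t != 0 ->
  qright ((2 * idot t t)^-1 *: qmul x (quat_of_im t)) t = x.
Proof.
move=> t0; have d0 : idot t t != 0 by rewrite idot_eq0.
move: d0; case: x => [[[x0 x1] x2] x3]; case: t t0 => [[t1 t2] t3] _.
rewrite idotE/= => d0; apply: quat_eq; rewrite qrightE/= /GRing.scale/=; field;
  by rewrite ?d0 // mulf_neq0.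
Qed.

Lemma Psi_inv_fourier2_radon f : schwartz_lstar f -> Psi_inv (fourier2 (radon f)) = fourier f.
Proof.
move=> sf; apply/funext => -[x t]; rewrite /Psi_inv/=.
(* The default value 0 of [Psi_inv] at t = 0 is the true one, since F f vanishes there with the
   zeroth moment. *)
have [->|t0] := eqVneq t 0; first by rewrite fourier_null.
by rewrite fourier2_radon// qright_half.
Qed.

Lemma hdotNr z w : hdot z (- w) = - hdot z w.
Proof. by rewrite /hdot !qdotE !idotE/=; ring. Qed.

Lemma fcosN h w c : fcos h (- w) c = fcos h w (- c).
Proof. by apply: eq_Rintegral => z _; rewrite hdotNr -cosN opprD opprK. Qed.

Lemma fcos_phase h w c : rschwartz h ->
  fcos h w c = cos c * fcos h w 0 - sin c * fcos h w (- (pi / 2)).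
Proof.
move=> sh; have i1 := fcos_integrable w 0 sh; have i2 := fcos_integrable w (- (pi / 2)) sh.
rewrite /fcos -(RintegralZl _ measurableT i1) -(RintegralZl _ measurableT i2).
rewrite -(RintegralB measurableT (rintegrableZ _ i1) (rintegrableZ _ i2)).
by apply: eq_Rintegral => z _; rewrite -sin_cos_phase add0r cosD; ring.
Qed.

(** The complex transform mixes cosine and sine transforms of the real and imaginary parts of f. Its
    values at w and - w separate the four, since cosine is even and sine odd; each real part is then
    handled through its Radon transform. *)
Lemma fourier_inj f g : schwartz_lstar f -> schwartz_lstar g -> fourier f = fourier g -> f = g.
Proof.
move=> sf sg H.
have [s1 _] := sf; have [s2 _] := sg.
have /schwartz_lstarP[rf jf] := sf; have /schwartz_lstarP[rg jg] := sg.
have fN h w : rschwartz h -> fcos h w (pi / 2) = - fcos h w (- (pi / 2)).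
  by move=> sh; rewrite fcos_phase// cos_pihalf sin_pihalf mul0r sub0r mul1r.
have key w : (fcos (re f) w 0 = fcos (re g) w 0 /\ fcos (re f) w (- (pi / 2)) = fcos (re g) w (- (pi / 2))) /\
   (fcos (im f) w 0 = fcos (im g) w 0 /\ fcos (im f) w (- (pi / 2)) = fcos (im g) w (- (pi / 2))).
  have h1 : fourier f w = fourier g w by rewrite H.
  have h2 : fourier f (- w) = fourier g (- w) by rewrite H.
  move: h1 h2; rewrite !(fourierE _ s1) !(fourierE _ s2) !fcosN oppr0 opprK.
  rewrite (fN _ _ (rstar_rschwartz rf)) (fN _ _ (rstar_rschwartz jf)).
  rewrite (fN _ _ (rstar_rschwartz rg)) (fN _ _ (rstar_rschwartz jg)).
  move=> [e1 e2] [e3 e4].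
  rewrite addrC [RHS]addrC -[X in _ + X]opprK -[X in _ = _ + X]opprK in e2.
  rewrite addrC [RHS]addrC in e4.
  by have [-> ->] := sum_diff_inj e1 e3; have [-> ->] := sum_diff_inj e4 e2.
have key2 h h' : rstar h -> rstar h' ->
   (forall w, fcos h w 0 = fcos h' w 0 /\ fcos h w (- (pi / 2)) = fcos h' w (- (pi / 2))) ->
   forall z, h z = h' z.
  (* [fcos_phase] rebuilds every phase from the two known ones, so the integrands of the t-inversion
     agree. *)
  move=> rh rh' E; apply: rradon_inj => // -[x t].
  have q0 : (2 * pi) ^+ 3 != 0 :> R by rewrite expf_neq0// mulf_neq0// gt_eqF// pi_gt0.
  apply: (mulfI q0); rewrite (rradon_inversion x t rh) (rradon_inversion x t rh').
  apply: eq_Rintegral => a _; have [e1 e2] := E (qright x a, a).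
  by rewrite (fcos_phase _ _ (rstar_rschwartz rh)) (fcos_phase _ _ (rstar_rschwartz rh')) e1 e2.
apply/funext => z; apply: complex_eqP.
- by apply: (key2 _ _ rf rg) => w; have [] := key w.
- by apply: (key2 _ _ jf jg) => w; have [] := key w.
Qed.

Lemma inv_lstarK (T : (heis R -> R[i]) -> heis R -> R[i]) f :
  (forall f g, schwartz_lstar f -> schwartz_lstar g -> T f = T g -> f = g) ->
  schwartz_lstar f -> inv_lstar T (T f) = f.
Proof.
move=> Tinj sf; apply: pinvKV; last exact/mem_set.
by move=> g h /set_mem sg /set_mem sh; exact: Tinj.
Qed.

End complex_valued.

Theorem theorem7 (R : realType) :
  set_bij (@schwartz_lstar R) (@schwartz_lstar R) (@radon R) /\
  forall f : heis R -> R[i], schwartz_lstar f ->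
    inv_lstar (@radon R) f = inv_lstar (@fourier R) (Psi_inv (fourier2 f)).
Proof.
split.
  split.
  - exact: radon_lstar.
  - by move=> f g /set_mem sf /set_mem sg; exact: radon_inj.
  - by move=> g /radon_surj[f sf <-]; exists f.
(* Every element of the space is some R f. The left side is then f, and the argument of the inverse
   of F on the right is F f itself. *)
move=> _ /radon_surj[f sf <-]; rewrite (inv_lstarK (@radon_inj R))//.
by rewrite Psi_inv_fourier2_radon// (inv_lstarK (@fourier_inj R)).
Qed.
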